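(* Let $K$ be an algebraically closed field of arbitrary characteristic, let $p:X\to\mathbf{P}^2$ be the blow up of $\mathbf{P}^2=\mathbf{P}^2_K$ at $n$ distinct points $P_1,\ldots,P_n$, let $L$ be the pullback to $X$ of the class of a line, and let $E_j$ be the class of $p^{-1}(P_j)$. Let $F=L+iE$, where $E\subset X$ is a smooth rational curve with $E^2=-1$, $d=E\cdot L$, $m$ is the maximum of $E\cdot E_j$ over $1\le j\le n$, and $0\le i\le d$. Let $\mu_F:H^0(X,F)\otimes H^0(X,L)\to H^0(X,F+L)$ be the natural multiplication map, and let $a_E\le b_E$ be the integers with $(p^*\Omega_{\mathbf{P}^2}(1))|_E\cong\mathcal{O}_E(-a_E)\oplus\mathcal{O}_E(-b_E)$. Then $$\dim_K\operatorname{cok}\mu_F\ \le\ \binom{i-b_E}{2}+\binom{i-a_E}{2},$$ with equality in each of the following cases: (a) $i\le a_E+2$; (b) $b_E-a_E\le2$; or (c) $a_E=d-m$.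
   Context: The points $P_1,\ldots,P_n$ are distinct but not assumed to be general. For a divisor (class) $F$ on $X$, $H^0(X,F)$ denotes $H^0(X,\mathcal{O}_X(F))$. $\Omega_{\mathbf{P}^2}$ is the cotangent bundle of $\mathbf{P}^2$ and $\Omega_{\mathbf{P}^2}(1)$ its twist by $\mathcal{O}_{\mathbf{P}^2}(1)$; the pair $(a_E,b_E)$ is called the splitting type of $E$. Convention: $\binom{k}{2}=k(k-1)/2$ for integers $k\ge2$, and $\binom{k}{2}=0$ for all integers $k<2$ (including negative $k$). *)

(* Defs.v *)
From HB Require Import structures.
From mathcomp Require Export all_boot all_order all_algebra mpoly.

Set Implicit Arguments.
Unset Strict Implicit.
Unset Printing Implicit Defensive.

Import GRing.Theory.
Local Open Scope ring_scope.

Notation "x %:F" := (tofrac x) : ring_scope.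

(** Conventions.  Varieties over the algebraically closed field [K] are
    described by their closed points together with their local rings, which
    are subrings of the function field.

    Points of a projective space are represented by nonzero row vectors, up to
    [proj_eq].  The blow-up X of P^2 at P_1, ..., P_n is realized as

      X = { (x, l_1, ..., l_n) | l_j is a line through P_j and x }

    inside P^2 x (P^2* )^n, which is the closure of the graph of the n
    projections of P^2 from the points P_j (the P_j being distinct).  A point
    of X is a matrix with n+1 nonzero rows of length 3: row [ord0] is x, and
    row [lift ord0 j] is the coefficient vector of l_j.  The morphism
    p : X -> P^2 is the projection to row [ord0]. *)

Definition proj_eq (K : fieldType) (N : nat) (u v : 'rV[K]_N) : Prop :=
  exists c : K, c != 0 /\ u = c *: v.

Notation ratfun K N := {fraction {mpoly K[N]}}.

Definition blowup_pt (K : fieldType) (n : nat) (P : 'I_n -> 'rV[K]_3)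
    (z : 'M[K]_(n.+1, 3)) : Prop :=
  (forall i, row i z != 0) /\
  (forall j : 'I_n,
     row (lift ord0 j) z *m (P j)^T = 0 /\
     row (lift ord0 j) z *m (row ord0 z)^T = 0).

(** Multihomogeneous polynomials on P^2 x (P^2* )^n; the [k]-th coordinate of
    the [i]-th factor is the variable with index [mxvec_index i k]. *)
Definition multihomog (K : fieldType) (n : nat) (e : 'I_n.+1 -> nat)
    (G : {mpoly K[n.+1 * 3]}) : Prop :=
  forall mm, mm \in msupp G ->
  forall i, (\sum_(k < 3) mm (mxvec_index i k))%N = e i.

Definition evpt (K : fieldType) (n : nat) (z : 'M[K]_(n.+1, 3))
    (G : {mpoly K[n.+1 * 3]}) : K :=
  G.@[mxvec z 0].

Definition subst (K : fieldType) (n N : nat)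
    (M : 'M[{mpoly K[N]}]_(n.+1, 3)) (G : {mpoly K[n.+1 * 3]}) : {mpoly K[N]} :=
  mmap (@mpolyC N K) (mxvec M 0) G.

(** The generic point of X: x = (X_0 : X_1 : X_2), and the line l_j joining
    P_j to x has the cross product P_j x X as coefficient vector (indices of
    coordinates are modulo 3). *)
Definition generic_pt (K : fieldType) (n : nat) (P : 'I_n -> 'rV[K]_3) :
    'M[{mpoly K[3]}]_(n.+1, 3) :=
  \matrix_(i < n.+1, k < 3)
    match unlift ord0 i with
    | None => 'X_k
    | Some j => P j 0 (k + 1) *: 'X_(k + 2) - P j 0 (k + 2) *: 'X_(k + 1)
    end.

(** [J z] is the stalk at z.  Elements of K(X_0, X_1, X_2) that are homogeneous
    of degree t are the rational sections of O_X(tL) = p^* O(t). *)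
Definition sheaf (K : fieldType) (n : nat) : Type :=
  'M[K]_(n.+1, 3) -> ratfun K 3 -> Prop.

(** O_X(tL); in particular [OXL P 0] is the structure sheaf of X. *)
Definition OXL (K : fieldType) (n : nat) (P : 'I_n -> 'rV[K]_3) (t : nat) :
    sheaf K n :=
  fun z f => exists (e : 'I_n.+1 -> nat) (G H : {mpoly K[n.+1 * 3]}),
    [/\ multihomog (fun i => (e i + (if i == ord0 then t else 0))%N) G,
        multihomog e H,
        evpt z H != 0 &
        f = (subst (generic_pt P) G)%:F / (subst (generic_pt P) H)%:F].

Definition ideal_sheaf (K : fieldType) (n : nat) (P : 'I_n -> 'rV[K]_3)
    (Z : 'M[K]_(n.+1, 3) -> Prop) : sheaf K n :=
  fun z f => exists (e : 'I_n.+1 -> nat) (G H : {mpoly K[n.+1 * 3]}),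
    [/\ multihomog e G, multihomog e H,
        forall w, Z w -> evpt w G = 0,
        evpt z H != 0 &
        f = (subst (generic_pt P) G)%:F / (subst (generic_pt P) H)%:F].

(** O_X(tL + iZ) = Hom (I_Z^i, O_X(tL)), for a (reduced) curve Z in X. *)
Definition OX (K : fieldType) (n : nat) (P : 'I_n -> 'rV[K]_3) (t : nat)
    (Z : 'M[K]_(n.+1, 3) -> Prop) (i : nat) : sheaf K n :=
  fun z f => forall g : 'I_i -> ratfun K 3,
    (forall k, ideal_sheaf P Z z (g k)) -> OXL P t z (f * \prod_k g k).

Definition H0 (K : fieldType) (n : nat) (P : 'I_n -> 'rV[K]_3)
    (J : sheaf K n) (f : ratfun K 3) : Prop :=
  forall z, blowup_pt P z -> J z f.

(** The exceptional curve E_j = p^{-1}(P_j). *)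
Definition exceptional (K : fieldType) (n : nat) (P : 'I_n -> 'rV[K]_3)
    (j : 'I_n) (z : 'M[K]_(n.+1, 3)) : Prop :=
  blowup_pt P z /\ proj_eq (row ord0 z) (P j).

(** The stalk of O_{P^1}(k) at q, inside K(s, t). *)
Definition OP1 (K : fieldType) (k : int) (q : 'rV[K]_2) (c : ratfun K 2) :
    Prop :=
  exists (u v : nat) (A B : {mpoly K[2]}),
    [/\ A \is u.-homog, B \is v.-homog, u%:Z - v%:Z = k,
        B.@[q 0] != 0 & c = A%:F / B%:F].

(** [J = g O] inside the field [F]. *)
Definition generates (F : fieldType) (J O : F -> Prop) (g : F) : Prop :=
  g != 0 /\ forall f, J f <-> O (f / g).

(** A morphism P^1 -> P^2 x (P^2* )^n is a matrix of binary forms, those of a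
    given row having the same degree and no common zero (a consequence of
    [blowup_pt] below). *)
Definition image_pt (K : fieldType) (n : nat)
    (phi : 'M[{mpoly K[2]}]_(n.+1, 3)) (q : 'rV[K]_2) : 'M[K]_(n.+1, 3) :=
  map_mx (meval (q 0)) phi.

Definition morphism_P1 (K : fieldType) (n : nat) (P : 'I_n -> 'rV[K]_3)
    (phi : 'M[{mpoly K[2]}]_(n.+1, 3)) : Prop :=
  (exists e : 'I_n.+1 -> nat, forall i k, phi i k \is (e i).-homog) /\
  (forall q : 'rV[K]_2, q != 0 -> blowup_pt P (image_pt phi q)).

Definition image_curve (K : fieldType) (n : nat) (P : 'I_n -> 'rV[K]_3)
    (phi : 'M[{mpoly K[2]}]_(n.+1, 3)) (z : 'M[K]_(n.+1, 3)) : Prop :=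
  blowup_pt P z /\
  exists q : 'rV[K]_2, q != 0 /\
    forall i, proj_eq (row i z) (row i (image_pt phi q)).

(** The rational function [h] on X is regular at the generic point of the curve
    phi(P^1), and its pullback along phi is [c]. *)
Definition pulls_back (K : fieldType) (n : nat) (P : 'I_n -> 'rV[K]_3)
    (phi : 'M[{mpoly K[2]}]_(n.+1, 3)) (h : ratfun K 3) (c : ratfun K 2) :
    Prop :=
  exists (e : 'I_n.+1 -> nat) (A B : {mpoly K[n.+1 * 3]}),
    [/\ multihomog e A, multihomog e B, subst phi B != 0,
        h = (subst (generic_pt P) A)%:F / (subst (generic_pt P) B)%:F &
        c = (subst phi A)%:F / (subst phi B)%:F].

(** A smooth rational curve in X, given as the image of a closed immersion
    phi : P^1 -> X: phi is injective on points and O_X -> phi_* O_{P^1} is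
    surjective on stalks. *)
Definition smooth_rational_curve (K : fieldType) (n : nat)
    (P : 'I_n -> 'rV[K]_3) (phi : 'M[{mpoly K[2]}]_(n.+1, 3)) : Prop :=
  [/\ morphism_P1 P phi,
      forall q q' : 'rV[K]_2, q != 0 -> q' != 0 ->
        (forall i, proj_eq (row i (image_pt phi q)) (row i (image_pt phi q'))) ->
        proj_eq q q' &
      forall q : 'rV[K]_2, q != 0 -> forall c, OP1 0 q c ->
        exists h, OXL P 0 (image_pt phi q) h /\ pulls_back P phi h c].

(** For an invertible sheaf J on X: phi^* J is isomorphic to O_{P^1}(k), i.e.
    J has degree k on the curve phi(P^1).  The isomorphism sends the local
    generator [g q] of J at phi(q) to the local generator [c q] of O_{P^1}(k)
    at q.  With J = O_X(D), this says that phi(P^1) . D = k. *)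
Definition degree_on (K : fieldType) (n : nat) (P : 'I_n -> 'rV[K]_3)
    (phi : 'M[{mpoly K[2]}]_(n.+1, 3)) (J : sheaf K n) (k : int) : Prop :=
  exists (g : 'rV[K]_2 -> ratfun K 3) (c : 'rV[K]_2 -> ratfun K 2),
    (forall q : 'rV[K]_2, q != 0 ->
       generates (J (image_pt phi q)) (OXL P 0 (image_pt phi q)) (g q) /\
       generates (OP1 k q) (OP1 0 q) (c q)) /\
    (forall q q' : 'rV[K]_2, q != 0 -> q' != 0 ->
       pulls_back P phi (g q / g q') (c q / c q')).

(** Transition matrix of Omega_{P^2}(1), evaluated at x = f.  On the chart
    x_i <> 0 this bundle has the frame x_i (x) d(x_k / x_i), k <> i, and
      x_i (x) d(x_k / x_i)
        = (x_i / x_j) *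
          \sum_(l <> j) d(x_k / x_i) / d(x_l / x_j) * (x_j (x) d(x_l / x_j)),
    where x_k / x_i = (x_k / x_j) / (x_i / x_j).  The two elements of
    {0,1,2} \ {i} are the [lift i k], k < 2. *)
Definition Omega1_transition (F : fieldType) (f : 'I_3 -> F) (i j : 'I_3) :
    'M[F]_2 :=
  \matrix_(k < 2, l < 2)
    (f i / f j *
      ((lift i k == lift j l)%:R * (f j / f i)
       - (i == lift j l)%:R * (f (lift i k) * f j / f i ^+ 2))).

(** (p o phi)^* Omega_{P^2}(1) is isomorphic to O(-a) (+) O(-b) on P^1: row [k]
    of [C i] is the image of x_i (x) d(x_(lift i k) / x_i). *)
Definition splitting_type (K : fieldType) (n : nat)
    (phi : 'M[{mpoly K[2]}]_(n.+1, 3)) (a b : int) : Prop :=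
  let f k := (phi ord0 k)%:F : ratfun K 2 in
  exists C : 'I_3 -> 'M[ratfun K 2]_2,
    (forall i (q : 'rV[K]_2), q != 0 -> (phi ord0 i).@[q 0] != 0 ->
       (forall k, OP1 (- a) q (C i k 0) /\ OP1 (- b) q (C i k 1)) /\
       generates (OP1 (- a - b) q) (OP1 0 q) (\det (C i))) /\
    (forall i j, f i != 0 -> f j != 0 ->
       C i = Omega1_transition f i j *m C j).

(** The image of U (x) V under multiplication. *)
Definition mul_image (K : fieldType) (N : nat) (U V : ratfun K N -> Prop)
    (h : ratfun K N) : Prop :=
  exists (r : nat) (u v : 'I_r -> ratfun K N),
    [/\ forall k, U (u k), forall k, V (v k) & h = \sum_k u k * v k].

(** dim_K (V / W) = r: the classes of b_0, ..., b_(r-1) form a basis. *)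
Definition quotient_dim (K : fieldType) (N : nat) (V W : ratfun K N -> Prop)
    (r : nat) : Prop :=
  exists b : 'I_r -> ratfun K N,
    (forall k, V (b k)) /\
    (forall f, V f ->
       exists! c : 'rV[K]_r, W (f - \sum_k ((c 0 k)%:MP)%:F * b k)).

Definition binom2 (k : int) : nat := if 2 <= k then 'C(`|k|, 2) else 0.

(* Main.v *)
(* Let Q be the equation of the plane curve p(E), of degree d and multiplicity
   m_j at P_j.  Multiplication by Q^i identifies H^0(X, tL + iE) with the forms of
   degree t + id having multiplicity at least i m_j at P_j, and everything takes
   place inside the polynomial ring.  Comparing Riemann-Roch on X and on P^1 for
   multiples of an ample class, and then E^2 = -1, gives the values of
   \sum_j m_j^2 and \sum_j m_j.  A dimension count, by induction on i, then shows
   that H^0(X, tL + iE) -> H^0(P^1, O(td - i)) is onto with kernel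
   H^0(X, tL + (i-1)E) for 0 < i <= td, and similarly after subtracting E_j.

   Hence, for i <= d, the cokernel of mu_(L + iE) is an extension of the cokernel
   of H^0(O_E(d - i)) (x) H^0(L) -> H^0(O_E(2d - i)), of dimension
   max(i - 1 - a, 0) + max(i - 1 - b, 0), by a quotient of the cokernel of
   mu_(L + (i-1)E); summing over i gives the binomial bound.  No dimension is lost
   at step i if every syzygy of degree d - i on E (that is, every section of
   Omega(1)(d - i)) lifts to X, or if mu_(L + (i-1)E) is onto.  The latter holds for
   i <= a + 2; there are no syzygies if i > b; and if b = m_j, the syzygies are
   the multiples of the one given by the pencil of lines through P_j, which lift. *)
From HB Require Import structures.
Require Import Defs.
From mathcomp Require Import all_boot all_order all_algebra mpoly.
From mathcomp Require Import perm ring zify.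
From Stdlib Require Import Classical_Prop FunctionalExtensionality.

Set Implicit Arguments.
Unset Strict Implicit.
Unset Printing Implicit Defensive.

Import GRing.Theory.
Local Open Scope ring_scope.

(** The sheaves are given by their stalks alone, so vanishing of cohomology has to be replaced by
    counting. Exactness of restriction to E comes from a squeeze: imposing the multiplicities as
    linear conditions bounds a dimension from below, restriction to E bounds it from above by the
    previous dimension plus that of a space of binary forms, and the values of \sum_j m_j^2 and
    \sum_j m_j are exactly those for which both bounds agree. Those values come from large multiples
    of an ample class, where the points impose independent conditions; there the surjectivity of
    restriction to E, usually Serre vanishing, is derived from Bezout for binary forms, applied to
    two sections without common zero that the closed immersion provides. Multiplicities are read off
    Taylor expansions instead of derivatives, which treats all characteristics alike. *)

(** * Substitutions into polynomials and homogeneous forms *)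

Lemma mpoly_rmorph_eq (K : comNzRingType) (N : nat) (A : comNzRingType)
    (f g : {rmorphism {mpoly K[N]} -> A}) :
  (forall c, f c%:MP = g c%:MP) -> (forall i, f 'X_i = g 'X_i) -> f =1 g.
Proof.
move=> fgC fgX p; rewrite (mpolyE p) !rmorph_sum; apply: eq_bigr => m _.
rewrite -mul_mpolyC !rmorphM fgC; congr (_ * _).
rewrite mpolyXE_id !rmorph_prod; apply: eq_bigr => i _.
by rewrite !rmorphXn fgX.
Qed.

Lemma rmorph_mmap (K A B : comNzRingType) (N : nat) (f : {rmorphism K -> A})
    (h : 'I_N -> A) (g : {rmorphism A -> B}) (p : {mpoly K[N]}) :
  g (mmap f h p) = mmap (g \o f) (g \o h) p.
Proof.
rewrite /mmap rmorph_sum; apply: eq_bigr => m _.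
rewrite rmorphM /mmap1 rmorph_prod; congr (_ * _).
by apply: eq_bigr => i _; rewrite rmorphXn.
Qed.

Lemma eq_mmap (K A : nzRingType) (N : nat) (f g : K -> A) (h k : 'I_N -> A) :
  f =1 g -> h =1 k -> mmap f h =1 mmap g k.
Proof.
move=> fg hk p; rewrite /mmap; apply: eq_bigr => m _; rewrite fg /mmap1.
by congr (_ * _); apply: eq_bigr => i _; rewrite hk.
Qed.

Lemma meval_mmap (K : comNzRingType) (N M : nat) (h : 'I_N -> {mpoly K[M]})
    (v : 'I_M -> K) (p : {mpoly K[N]}) :
  (mmap (@mpolyC M K) h p).@[v] = p.@[fun i => (h i).@[v]].
Proof.
rewrite rmorph_mmap /meval; apply: eq_mmap => // c /=.
exact: mevalC.
Qed.

Lemma mmapXU (K A : comNzRingType) (N : nat) (f : {rmorphism K -> A})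
    (h : 'I_N -> A) i : mmap f h 'X_i = h i.
Proof. by rewrite mmapX mmap1U. Qed.

Lemma mmap_dhomog (K : comNzRingType) (N M d k : nat)
    (h : 'I_N -> {mpoly K[M]}) (p : {mpoly K[N]}) :
  (forall i, h i \is d.-homog) -> p \is k.-homog ->
  mmap (@mpolyC M K) h p \is (d * k)%N.-homog.
Proof.
move=> hh hp; rewrite /mmap big_seq; apply: rpred_sum => m mp.
rewrite mul_mpolyC; apply: rpredZ; rewrite /mmap1.
have <- : mdeg m = k by exact: (dhomog_mf hp).
rewrite mdegE big_distrr /=.
elim/big_rec2: _ => [|i e y _ ih]; first exact: dhomog1.
by apply: dhomogM => //; apply: dhomogMn.
Qed.

Lemma dhomogXi (K : comNzRingType) (N : nat) (i : 'I_N) :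
  ('X_i : {mpoly K[N]}) \is 1.-homog.
Proof. by rewrite dhomogX /= mdeg1. Qed.

Lemma dhomogXin (K : comNzRingType) (N k : nat) (i : 'I_N) :
  ('X_i ^+ k : {mpoly K[N]}) \is k.-homog.
Proof. by have := dhomogMn k (@dhomogXi K N i); rewrite mul1n. Qed.

Lemma mpolyXU_neq0 (K : nzRingType) (N : nat) (i : 'I_N) : 'X_i != 0 :> {mpoly K[N]}.
Proof. by rewrite -msize_poly_eq0 msizeX mdeg1. Qed.

Lemma homog_eq0C (K : comNzRingType) (N : nat) (p : {mpoly K[N]}) :
  p \is 0.-homog -> p = (p@_0%MM)%:MP.
Proof.
move=> hp; apply/mpolyP => m; rewrite mcoeffC.
have [->|nz] := eqVneq m 0%MM; first by rewrite mulr1.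
by rewrite mulr0; apply: (dhomog_nemf_coeff hp); rewrite mdeg_eq0.
Qed.

(** * Forms in two variables *)

Section InfiniteField.
Variable K : closedFieldType.

(** The polynomial X p + 1 is not constant, hence has a root, and p cannot vanish there. *)
Lemma closed_nonroot (p : {poly K}) : p != 0 -> exists x, ~~ root p x.
Proof.
move=> p0; have sz : size ('X * p + 1) != 1.
  rewrite size_polyDl ?size_mulX // ?size_polyXM.
    by rewrite mulrC size_mulX // eqSS size_poly_eq0.
  by rewrite mulrC size_mulX // size_poly1 ltnS size_poly_gt0.
have [x] := closed_rootP _ sz; rewrite /root !hornerE => /eqP e.
exists x; apply/eqP => px; move/eqP: e; rewrite px mulr0 add0r.
by rewrite oner_eq0.
Qed.

Lemma poly_eq0_closed (p : {poly K}) : (forall x, p.[x] = 0) -> p = 0.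
Proof.
move=> p0; apply/eqP; apply: contraT => /closed_nonroot [x].
by rewrite /root p0 eqxx.
Qed.

Lemma mnm_rconsE (N : nat) (m : 'X_{1..N.+1}) (m0 : 'X_{1..N}) :
  (forall i, m0 i = m (widen_ord (leqnSn N) i)) ->
  m = [multinom of rcons m0 (m ord_max)].
Proof.
move=> m0E; apply/mnmP => i; rewrite [RHS](mnm_nth 0%N) /= nth_rcons size_tuple.
have [lt_iN|eq_iN|eN] := ltngtP (i : nat) N.
- rewrite -(mnm_nth 0%N _ (Ordinal lt_iN)) m0E.
  by congr (m _); apply: val_inj.
- by move: (ltn_ord i); rewrite ltnS leqNgt eq_iN.
- by congr (fun_of_multinom m _); apply: val_inj; rewrite /= eN.
Qed.

Lemma mcoeff_muni (N : nat) (p : {mpoly K[N.+1]}) (j : nat) (m : 'X_{1..N}) :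
  ((muni p)`_j)@_m = p@_[multinom of rcons m j].
Proof.
rewrite {1}muniE coef_sum raddf_sum /=.
have E m' : m' \in msupp p -> (p@_m' *: 'X_[[multinom (m' (widen_ord (leqnSn N) i)) | i < N]]
      *: 'X^(m' ord_max))`_j@_m = p@_m' * (m' == [multinom of rcons m j])%:R.
  move=> _; rewrite coefZ coefXn; case: (eqVneq m' [multinom of rcons m j]) => [->|ne].
    have -> : [multinom of rcons m j] ord_max = j.
      by rewrite (mnm_nth 0%N) /= nth_rcons size_tuple ltnn eqxx.
    rewrite eqxx mulr1 mcoeffZ; congr (_ * _).
    have -> : [multinom [multinom of rcons m j] (widen_ord (leqnSn N) i) | i < N] = m.
      apply/mnmP => i; rewrite mnmE (mnm_nth 0%N) /= nth_rcons size_tuple.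
      by rewrite ltn_ord -mnm_nth.
    by rewrite mcoeffX eqxx.
  case: (eqVneq j (m' ord_max)) => [ej|_]; last by rewrite mulr0 mcoeff0 mulr0.
  rewrite mulr1 mcoeffZ mcoeffX; case: eqP => // em; case/eqP: ne.
  by rewrite (@mnm_rconsE _ m' m) -?ej // => i; rewrite -em mnmE.
rewrite (eq_big_seq _ E).
have [mp|mp] := boolP ([multinom of rcons m j] \in msupp p).
  rewrite (bigD1_seq _ mp) ?msupp_uniq //= eqxx mulr1 big1 ?addr0 // => m' /negPf ->.
  by rewrite mulr0.
rewrite (memN_msupp_eq0 mp) big_seq big1 // => m' m'p.
case: eqP => [e|]; last by rewrite mulr0.
by rewrite -e m'p in mp.
Qed.

(** Induction on the number of variables: at a point where the leading coefficient in the last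
    variable does not vanish, a nonzero polynomial in that variable remains. *)
Lemma mpoly_nonroot (N : nat) (p : {mpoly K[N]}) : p != 0 -> exists v, p.@[v] != 0.
Proof.
elim: N p => [|N IH] p p0.
  exists (fun=> 0); rewrite (nvar0_mpolyC p) mevalC.
  by apply: contraNneq p0 => e; rewrite (nvar0_mpolyC p) e mpolyC0.
have : muni p != 0.
  apply: contraNneq p0 => H1; apply/eqP/mpolyP => m; rewrite mcoeff0.
  rewrite (@mnm_rconsE _ m [multinom (m (widen_ord (leqnSn N) i)) | i < N]).
    by rewrite -mcoeff_muni H1 coef0 mcoeff0.
  by move=> i; rewrite mnmE.
rewrite -lead_coef_eq0 => /IH [v lv].
have : map_poly (meval v) (muni p) != 0.
  apply: contraNneq lv => /polyP/(_ (size (muni p)).-1).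
  by rewrite coef_map coef0 /= => e; rewrite /lead_coef e.
move=> /closed_nonroot [x rx].
exists (fun i => if unlift ord_max i is Some j then v j else x).
apply: contraNneq rx => p1; rewrite /root -p1 muniE raddf_sum /= horner_sum mevalE.
apply/eqP/eq_bigr => m _.
rewrite map_polyZ map_polyXn hornerZ hornerXn /= mevalZ mevalX -mulrA; congr (_ * _).
rewrite big_ord_recr /= unlift_none; congr (_ * _).
apply: eq_bigr => i _; rewrite mnmE.
have -> : widen_ord (leqnSn N) i = lift ord_max i.
  by apply: val_inj; rewrite /= /bump leqNgt ltn_ord.
by rewrite liftK.
Qed.

Lemma mpoly_eq0_closed (N : nat) (p : {mpoly K[N]}) :
  (forall v, p.@[v] = 0) -> p = 0.
Proof.
move=> p0; apply/eqP; apply: contraT => /mpoly_nonroot [v].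
by rewrite p0 eqxx.
Qed.
End InfiniteField.

Section ModLinear.
Variables (K A : comNzRingType) (N : nat) (f : {rmorphism K -> A}).

(** Congruent substitutions give congruent values. This is the source of the factor theorems for
    forms in two and three variables, which need no division algorithm. *)
Lemma mmap_cong (h h' : 'I_N -> A) (l : A) (p : {mpoly K[N]}) :
  (forall i, exists b, h i = h' i + l * b) ->
  exists b, mmap f h p = mmap f h' p + l * b.
Proof.
move=> hh'; rewrite /mmap /mmap1.
elim/big_ind2: _ => [|x1 x2 y1 y2 [b ->] [c ->]|m _].
- by exists 0; rewrite mulr0 addr0.
- by exists (b + c); ring.
suff [b ->] : exists b, \prod_(i < N) h i ^+ m i = \prod_(i < N) h' i ^+ m i + l * b.
  by exists (f p@_m * b); ring.
elim/big_ind2: _ => [|x1 x2 y1 y2 [b ->] [c ->]|i _].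
- by exists 0; rewrite mulr0 addr0.
- by exists (x1 * c + b * y1 + l * b * c); ring.
elim: (m i) => [|e [b IH]]; first by exists 0; rewrite mulr0 addr0.
have [c hc] := hh' i; rewrite !exprS IH hc.
by exists (h' i * b + c * h' i ^+ e + l * b * c); ring.
Qed.

Lemma mmap_scale (h : 'I_N -> A) (c : A) (k : nat) (p : {mpoly K[N]}) :
  p \is k.-homog -> mmap f (fun i => c * h i) p = c ^+ k * mmap f h p.
Proof.
move=> hp; rewrite /mmap big_distrr /= big_seq [RHS]big_seq; apply: eq_bigr => m mp.
rewrite mulrCA; congr (_ * _); rewrite /mmap1.
have <- : mdeg m = k by exact: (dhomog_mf hp).
rewrite mdegE -prodrXr -big_split /=; apply: eq_bigr => i _.
by rewrite exprMn.
Qed.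

End ModLinear.

Lemma meval_scale (K : comNzRingType) (N k : nat) (v : 'I_N -> K) (c : K)
    (p : {mpoly K[N]}) :
  p \is k.-homog -> p.@[fun i => c * v i] = c ^+ k * p.@[v].
Proof. exact: (@mmap_scale _ _ _ idfun). Qed.

Lemma pihomogM (K : comNzRingType) (N l d : nat) (p B : {mpoly K[N]}) :
  p \is l.-homog -> pihomog mdeg (l + d) (p * B) = p * pihomog mdeg d B.
Proof.
move=> hp; have := @pihomog_partitionE _ _ mdeg (maxn d.+1 (msize B)) B (leq_maxr _ _).
move=> {1}->; rewrite big_distrr raddf_sum /=.
have dl : (d < maxn d.+1 (msize B))%N by rewrite leq_max leqnn.
rewrite (bigD1 (Ordinal dl)) //= big1 ?addr0 => [|i ne].
  by rewrite pihomog_dE //; apply: dhomogM => //; apply: pihomogP.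
apply: (@pihomog_ne0 _ _ _ (l + i)%N).
- by rewrite eqn_add2l eq_sym; apply: contraNneq ne => e; apply/eqP/val_inj.
- by apply: dhomogM => //; apply: pihomogP.
Qed.

(** The homogeneous component of [p * B] in degree l + k is p times the component of [B] in degree
    k. *)
Lemma homog_cofactor (K : idomainType) (N l k : nat) (p B : {mpoly K[N]}) :
  p != 0 -> p \is l.-homog -> p * B \is (l + k)%N.-homog -> B \is k.-homog.
Proof.
move=> p0 hp hpB; have : p * pihomog mdeg k B = p * B.
  by rewrite -(pihomogM k B hp) pihomog_dE.
by move/(mulfI p0) <-; apply: pihomogP.
Qed.

Lemma homog_cofactor_lt (K : idomainType) (N l k : nat) (p B : {mpoly K[N]}) :
  p != 0 -> p \is l.-homog -> p * B \is k.-homog -> (k < l)%N -> B = 0.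
Proof.
move=> p0 hp hpB lt_kl; apply/eqP; apply/negPn/negP => B0.
have /(dhomog_mf hpB) /= := mlead_supp (mulf_neq0 p0 B0).
rewrite mleadM // mdegD (dhomog_mf hp (mlead_supp p0)) => e.
by move: lt_kl; rewrite -e ltnNge leq_addr.
Qed.

Lemma ord2P (i : 'I_2) : i = 0 \/ i = 1.
Proof. by case: i => [[|[|//]]] h; [left|right]; apply: val_inj. Qed.

Lemma ord3P (i : 'I_3) : [\/ i = 0, i = 1 | i = 2%:R].
Proof.
by case: i => [[|[|[|//]]]] h; [apply: Or31|apply: Or32|apply: Or33]; apply: val_inj.
Qed.

Section BinaryForms.
Variable K : closedFieldType.
Local Notation S := {mpoly K[2]}.
Implicit Types (A B : S) (q : 'rV[K]_2).

(** The linear form on P^1 with zero [q]. *)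
Definition lam q : S := q 0 1 *: 'X_0 - q 0 0 *: 'X_1.

Lemma lam_homog q : lam q \is 1.-homog.
Proof. by apply: rpredB; apply: rpredZ; rewrite dhomogX /= mdeg1. Qed.

Lemma rV2P q : q != 0 -> exists i, q 0 i != 0.
Proof.
move=> q0; apply/existsP; rewrite -negb_forall; apply: contraNN q0 => /forallP qi.
by apply/eqP/rowP => i; rewrite mxE; apply/eqP/qi.
Qed.

Lemma lamE q (v : 'I_2 -> K) : (lam q).@[v] = q 0 1 * v 0 - q 0 0 * v 1.
Proof. by rewrite mevalB !mevalZ !mevalXU. Qed.

Lemma lam_neq0 q : q != 0 -> lam q != 0.
Proof.
move=> /rV2P [i qi]; apply/eqP => l0; have := lamE q; rewrite l0 => h.
case: (ord2P i) qi => ->; apply/negP; rewrite negbK; apply/eqP.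
  have := h (fun j => (j == 1)%:R); rewrite meval0 /= mulr1 mulr0 sub0r => /eqP.
  by rewrite eq_sym oppr_eq0 => /eqP.
by have := h (fun j => (j == 0)%:R); rewrite meval0 /= mulr1 mulr0 subr0.
Qed.

Lemma lam_eq0 q q' : q != 0 -> q' != 0 -> (lam q).@[q' 0] = 0 -> proj_eq q' q.
Proof.
move=> q0 q'0; rewrite lamE => /eqP; rewrite subr_eq0 => /eqP e.
have [i qi] := rV2P q0; exists (q' 0 i / q 0 i).
have E : q' = (q' 0 i / q 0 i) *: q.
  apply/rowP => j; rewrite mxE; apply: (mulIf qi); rewrite mulrAC divfK //.
  have /orP[/eqP->|/eqP ij] : (j == i) || (j == 1 - i).
  - by case: (ord2P i) (ord2P j) => -> [] ->.
  - by [].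
  by case: (ord2P i) ij => -> ->; rewrite ?subr0 ?subrr; [rewrite mulrC -e mulrC|rewrite mulrC e mulrC].
split=> //; apply: contraNneq q'0 => c0; by rewrite E c0 scale0r.
Qed.

(** If q_i is nonzero, then q_i X_j and q_j X_i agree modulo [lam q] for all j, so q_i^k A is
    congruent to X_i^k A(q) = 0. *)
Lemma form2_factor A k q : A \is k.-homog -> q != 0 -> A.@[q 0] = 0 ->
  exists A', A' \is (k.-1).-homog /\ A = lam q * A'.
Proof.
move=> hA q0 Aq; have [i qi] := rV2P q0.
pose h' (j : 'I_2) : S := 'X_i * (q 0 j)%:MP.
have h'0 : mmap (@mpolyC 2 K) h' A = 0.
  rewrite (mmap_scale _ _ _ hA) -/(comp_mpoly _ _).
  have -> : mmap (@mpolyC 2 K) (fun j => (q 0 j)%:MP) A = (A.@[q 0])%:MP.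
    by rewrite rmorph_mmap; apply: eq_mmap.
  by rewrite Aq mulr0.
have [b] : exists b, mmap (@mpolyC 2 K) (fun j => (q 0 i)%:MP * 'X_j) A
                   = mmap (@mpolyC 2 K) h' A + lam q * b.
  apply: mmap_cong => j; rewrite /h' /lam -!mul_mpolyC.
  case: (ord2P i) (ord2P j) => -> [] ->.
  - by exists 0; rewrite mulr0 addr0 mulrC.
  - by exists (-1); ring.
  - by exists 1; ring.
  - by exists 0; rewrite mulr0 addr0 mulrC.
rewrite (mmap_scale _ _ _ hA) h'0 add0r => e.
have mmX : mmap (@mpolyC 2 K) (fun j => 'X_j) A = A.
  by apply: (@mpoly_rmorph_eq _ _ _ _ idfun) => [c|j] /=; rewrite ?mmapC ?mmapXU.
rewrite mmX in e.
have E : A = lam q * ((q 0 i ^- k)%:MP * b).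
  rewrite mulrCA -e mulrA -rmorphXn -rmorphM /= mulVf ?expf_neq0 // mpolyC1 mul1r //.
exists ((q 0 i ^- k)%:MP * b); split=> //.
have [A0|A0] := eqVneq A 0.
  have /eqP := E; rewrite A0 eq_sym mulf_eq0 (negPf (lam_neq0 q0)) /= => /eqP ->.
  exact: dhomog0.
(* In degree 0 the cofactor is 0, which makes the truncated degree [k.-1] correct. *)
case: k hA {e h'0} E => [|k] hA E /=.
  set B := _ * b in E *; have B0 : B = 0.
    by apply: (homog_cofactor_lt (lam_neq0 q0) (lam_homog q) _ (ltn0Sn 0)); rewrite -E.
  by rewrite B0 dhomog0.
by apply: (homog_cofactor (lam_neq0 q0) (lam_homog q)); rewrite -E.
Qed.

End BinaryForms.

Lemma meval_proj (K : fieldType) (N k : nat) (A : {mpoly K[N]}) (q q' : 'rV[K]_N) :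
  A \is k.-homog -> proj_eq q' q -> (A.@[q' 0] == 0) = (A.@[q 0] == 0).
Proof.
move=> hA [c [c0 ->]].
have -> : A.@[(c *: q) 0] = c ^+ k * A.@[q 0].
  by rewrite -(meval_scale _ _ hA); apply: meval_eq => i; rewrite mxE.
by rewrite mulf_eq0 expf_eq0 (negPf c0) andbF.
Qed.

(** * Fractions, zeros of binary forms, and global sections on P^1 *)

Section Fractions.
Variable R : idomainType.
Implicit Types a b c d l : R.

Lemma tofrac_divK a b c d :
  b != 0 -> d != 0 -> a%:F / b%:F = c%:F / d%:F -> a * d = c * b.
Proof.
move=> b0 d0 /eqP; rewrite eqr_div ?tofrac_eq0 // -!tofracM tofrac_eq => /eqP ->.
by rewrite mulrC.
Qed.

Lemma tofrac_div_eq a b c d :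
  b != 0 -> d != 0 -> a * d = c * b -> a%:F / b%:F = c%:F / d%:F.
Proof.
move=> b0 d0 e; apply/eqP; rewrite eqr_div ?tofrac_eq0 //.
by rewrite -!tofracM tofrac_eq e mulrC.
Qed.

Lemma tofrac_div_cancel l a b : l != 0 -> (l * a)%:F / (l * b)%:F = a%:F / b%:F.
Proof.
move=> l0; rewrite !tofracM -mulf_div divff ?mul1r // tofrac_eq0 //.
Qed.

Lemma tofrac_divM a b c d : a%:F / b%:F * (c%:F / d%:F) = (a * c)%:F / (b * d)%:F.
Proof. by rewrite !tofracM mulf_div. Qed.

Lemma tofrac_eq_div a b c : b != 0 -> a = c * b -> a%:F / b%:F = c%:F.
Proof. by move=> b0 ->; rewrite tofracM mulfK // tofrac_eq0. Qed.

Lemma tofrac_inj a b : a%:F = b%:F -> a = b.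
Proof. by move/eqP; rewrite tofrac_eq => /eqP. Qed.

Lemma tofrac_div_eqE a b c : b != 0 -> a%:F / b%:F = c%:F -> a = c * b.
Proof.
move=> b0 e; apply: tofrac_inj; rewrite tofracM -e divfK //.
by rewrite tofrac_eq0.
Qed.

End Fractions.

Section CommonZeros.
Variable K : closedFieldType.
Local Notation S := {mpoly K[2]}.
Implicit Types (A B : S) (q : 'rV[K]_2).

Definition pt2 (x y : K) : 'rV[K]_2 := \row_i (if i == 0 then x else y).

Lemma pt2_neq0 x y : (x != 0) || (y != 0) -> pt2 x y != 0.
Proof.
move=> xy; apply/eqP => /rowP h; have := h 0; have := h 1; rewrite !mxE /= => y0 x0.
by rewrite x0 y0 eqxx in xy.
Qed.

Lemma form2_root A k : A \is k.-homog -> (0 < k)%N ->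
  exists2 q : 'rV[K]_2, q != 0 & A.@[q 0] = 0.
Proof.
move=> hA k0; have [e|A10] := eqVneq A.@[pt2 1 0 0] 0.
  by exists (pt2 1 0) => //; apply: pt2_neq0; rewrite oner_eq0.
pose p := mmap (@polyC K) (fun i : 'I_2 => if i == 0 then 'X else 1) A.
have pE x : p.[x] = A.@[pt2 x 1 0].
  rewrite /p -/(horner_eval x _) rmorph_mmap; apply: eq_mmap => [c|i] /=.
    by rewrite /horner_eval hornerC.
  by rewrite /horner_eval mxE; case: eqP => _; rewrite ?hornerX // hornerC.
have [sz|/closed_rootP [x]] := boolP (size p == 1); last first.
  rewrite /root pE => /eqP e; exists (pt2 x 1) => //.
  by apply: pt2_neq0; rewrite oner_eq0 orbT.
(* If A(x, 1) is constant, then A is a multiple of X_1^k, which vanishes at (1 : 0) although A does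
   not. *)
pose B := A - p`_0 *: 'X_1 ^+ k.
have hB : B \is k.-homog.
  apply: rpredB => //; apply: rpredZ.
  exact: dhomogXin.
have B0 : B = 0.
  (* The factor X_1 removes the points with v_1 = 0, which the dehomogenization does not see. *)
  suff /eqP : B * 'X_1 = 0 by rewrite mulf_eq0 (negPf (mpolyXU_neq0 _ _)) orbF => /eqP.
  apply: mpoly_eq0_closed => v; rewrite mevalM mevalXU.
  have [->|v1] := eqVneq (v 1) 0; first by rewrite mulr0.
  have -> : B.@[v] = v 1 ^+ k * B.@[pt2 (v 0 / v 1) 1 0].
    rewrite -(meval_scale _ _ hB); apply: meval_eq => i; rewrite mxE.
    by case: (ord2P i) => -> /=; rewrite ?mulr1 // mulrC divfK.
  rewrite mevalB mevalZ rmorphXn /= mevalXU -pE.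
  by rewrite mxE /= expr1n mulr1 {1}(size1_polyC (eq_leq (eqP sz))) hornerC subrr mulr0 mul0r.
move/eqP: B0; rewrite subr_eq0 => /eqP AE.
move: A10; rewrite AE mevalZ rmorphXn /= mevalXU mxE /= expr0n.
by rewrite eqn0Ngt k0 mulr0 eqxx.
Qed.

Lemma form2_zeros A k : A \is k.-homog -> A != 0 ->
  exists zs : seq 'rV[K]_2, (forall z, z \in zs -> z != 0) /\
    forall q, q != 0 -> A.@[q 0] = 0 -> exists2 z, z \in zs & proj_eq q z.
Proof.
elim: k A => [|k IH] A hA A0.
  exists [::]; split=> // q _; rewrite (homog_eq0C hA) mevalC => e.
  by move: A0; rewrite (homog_eq0C hA) e eqxx.
have [q q0 Aq] := form2_root hA isT.
have [A' [hA' AE]] := form2_factor hA q0 Aq.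
have A'0 : A' != 0 by apply: contraNneq A0 => A'0; rewrite AE A'0 mulr0.
have [zs [zs0 Hzs]] := IH _ hA' A'0.
exists (q :: zs); split=> [z|q']; first by rewrite inE => /orP[/eqP->//|/zs0].
move=> q'0; rewrite AE mevalM => /eqP; rewrite mulf_eq0 => /orP[]/eqP e.
  by exists q; rewrite ?mem_head //; apply: lam_eq0.
by have [z zz pz] := Hzs _ q'0 e; exists z => //; rewrite inE zz orbT.
Qed.

(** At a zero q of the denominator a second representation is regular; comparing the two, the
    numerator vanishes at q too and [lam q] cancels. Induction on the degree of the denominator
    leaves a form. *)
Lemma OP1_global (k : int) (f : ratfun K 2) :
  (forall q, q != 0 -> OP1 k q f) ->
  exists A, [/\ f = A%:F, forall u : nat, k = u%:Z -> A \is u.-homog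
              & k < 0 -> A = 0].
Proof.
move=> H.
have [u [v [A [B [hA hB kE Bq fE]]]]] : OP1 k (pt2 1 0) f.
  by apply: H; apply: pt2_neq0; rewrite oner_eq0.
have {Bq} B0 : B != 0 by apply: contraNneq Bq => ->; rewrite meval0.
move: u A B hA hB kE fE B0; elim: v => [|v IH] u A B hA hB kE fE B0.
  have c0 : B@_0%MM != 0 by apply: contraNneq B0 => e; rewrite (homog_eq0C hB) e mpolyC0.
  exists ((B@_0%MM)^-1 *: A); split.
  - rewrite fE; apply: tofrac_eq_div => //.
    by rewrite mulrC [X in X * _](homog_eq0C hB) mul_mpolyC scalerA divff // scale1r.
  - move=> u' e; have -> : u' = u by move: kE e; clear; lia.
    exact: rpredZ.
  - by move: kE; clear; lia.
have [q q0 Bq] := form2_root hB isT.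
have [u' [v' [A' [B' [hA' hB' kE' Bq' fE']]]]] := H q q0.
have B'0 : B' != 0 by apply: contraNneq Bq' => ->; rewrite meval0.
have AB : A * B' = A' * B by apply: (tofrac_divK B0 B'0); rewrite -fE.
have Aq : A.@[q 0] = 0.
  apply/eqP; have /eqP := congr1 (meval (q 0)) AB.
  by rewrite !mevalM Bq mulr0 mulf_eq0 (negPf Bq') orbF.
have [B1 [hB1 BE]] := form2_factor hB q0 Bq.
have [A1 [hA1 AE]] := form2_factor hA q0 Aq.
have l0 := lam_neq0 q0.
have [A0|A0] := eqVneq A 0.
  exists 0; rewrite fE A0 !tofrac0 mul0r; split=> // *; exact: dhomog0.
have B10 : B1 != 0 by apply: contraNneq B0 => e; rewrite BE e mulr0.
case: u hA hA1 kE => [|u] hA hA1 kE.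
  case/eqP: A0; rewrite (homog_eq0C hA); have := Aq; rewrite (homog_eq0C hA) mevalC => ->.
  by rewrite mpolyC0 mcoeff0 mpolyC0.
apply: (IH u A1 B1) => //; first by move: kE; clear; lia.
by rewrite fE AE BE tofrac_div_cancel.
Qed.

End CommonZeros.

(** * Bezout for binary forms *)

Section Bezout.
Variable K : closedFieldType.
Local Notation S := {mpoly K[2]}.
Implicit Types (A B : S) (q : 'rV[K]_2).

Lemma form2_nonzero_at q k : q != 0 ->
  exists2 A : S, A \is k.-homog & A.@[q 0] != 0.
Proof.
move=> /rV2P [i qi]; exists ('X_i ^+ k); first exact: dhomogXin.
by rewrite rmorphXn /= mevalXU expf_neq0.
Qed.

(** The bound on N says that H^1(P^1, O(N - v1 - v2)) = 0 in the Koszul complex of [h1], [h2]. The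
    proof removes one zero of [h1] at a time. *)
Lemma form2_bezout (v1 v2 N : nat) (h1 h2 A : S) :
  h1 \is v1.-homog -> h2 \is v2.-homog ->
  (forall q, q != 0 -> h1.@[q 0] = 0 -> h2.@[q 0] != 0) ->
  A \is N.-homog -> (v1 + v2 <= N.+1)%N ->
  exists B1 B2, [/\ B1 \is (N - v1)%N.-homog, B2 \is (N - v2)%N.-homog
                  & A = h1 * B1 + h2 * B2].
Proof.
elim: v1 h1 => [|v1 IH] h1 hh1 hh2 h12 hA leN.
  have [h10|h10] := eqVneq h1@_0%MM 0.
    have e : h1 = 0 by rewrite (homog_eq0C hh1) h10 mpolyC0.
    have h2q q : q != 0 -> h2.@[q 0] != 0 by move=> q0; apply: h12; rewrite // e meval0.
    have v20 : v2 = 0%N.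
      case: v2 hh2 {leN h12} => // v2 hh2; have [q q0 /eqP] := form2_root hh2 isT.
      by rewrite (negPf (h2q q q0)).
    have q0 : pt2 1 0 != 0 :> 'rV[K]_2 by apply: pt2_neq0; rewrite oner_eq0.
    rewrite v20 in hh2 *; have := h2q _ q0; rewrite {1}(homog_eq0C hh2) mevalC => c0.
    exists 0, ((h2@_0%MM)^-1 *: A); split; first exact: dhomog0.
      by rewrite subn0; apply: rpredZ.
    by rewrite mulr0 add0r {1}(homog_eq0C hh2) mul_mpolyC scalerA divff // scale1r.
  exists ((h1@_0%MM)^-1 *: A), 0; split; last first.
  - by rewrite mulr0 addr0 {1}(homog_eq0C hh1) mul_mpolyC scalerA divff // scale1r.
  - exact: dhomog0.
  - by rewrite subn0; apply: rpredZ.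
have [q q0 h1q] := form2_root hh1 isT.
have [h1' [hh1' h1E]] := form2_factor hh1 q0 h1q.
have h2q : h2.@[q 0] != 0 := h12 q q0 h1q.
have [q' q'0 h1q'||C1 [C2 [hC1 hC2 AE]]] := IH h1' hh1' hh2 _ hA.
- by apply: h12 => //; rewrite h1E mevalM h1q' mulr0.
- by move: leN; rewrite addSn; apply: ltnW.
have [D0 hD0 D0q] := form2_nonzero_at (N - v1 - v2) q0.
(* Adding [h2 * D] to [C1] and subtracting [h1' * D] from [C2] does not change the sum; the scalar
   makes the new first cofactor vanish at q, so that [lam q] can be moved into [h1]. *)
pose D := (- C1.@[q 0] / h2.@[q 0] / D0.@[q 0]) *: D0.
have hD : D \is (N - v1 - v2)%N.-homog by apply: rpredZ.
have leN' : (v1 + v2 <= N)%N by move: leN; rewrite addSn ltnS.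
have hC1' : C1 + h2 * D \is (N - v1)%N.-homog.
  apply: rpredD => //; have -> : (N - v1 = v2 + (N - v1 - v2))%N by move: leN'; clear; lia.
  exact: dhomogM.
have [B1 [hB1 B1E]] : exists A', A' \is ((N - v1).-1).-homog /\ C1 + h2 * D = lam q * A'.
  apply: form2_factor => //.
  rewrite mevalD mevalM mevalZ divfK // mulrCA divff // mulr1 subrr //.
exists B1, (C2 - h1' * D); split.
- by rewrite subnS.
- apply: rpredB => //; have -> : (N - v2 = v1 + (N - v1 - v2))%N by move: leN'; clear; lia.
  exact: dhomogM.
- rewrite AE h1E; have -> : lam q * h1' * B1 = h1' * (lam q * B1) by ring.
  by rewrite -B1E; ring.
Qed.

Lemma form2_split k A : A \is k.+1.-homog ->
  exists B1 B2, [/\ B1 \is k.-homog, B2 \is k.-homog & A = 'X_0 * B1 + 'X_1 * B2].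
Proof.
move=> hA; have := @form2_bezout 1 1 k.+1 'X_0 'X_1 A (dhomogXi _ _) (dhomogXi _ _) _ hA.
rewrite subn1 /=; apply=> // q /rV2P [i qi]; rewrite !mevalXU => q0.
by case: (ord2P i) qi => ->; rewrite ?q0 ?eqxx.
Qed.

Lemma form2_avoid (U : S -> Prop) (zs : seq 'rV[K]_2) :
  (forall c A B, U A -> U B -> U (A + c *: B)) ->
  (forall q, q != 0 -> exists2 A, U A & A.@[q 0] != 0) ->
  (forall z, z \in zs -> z != 0) ->
  exists2 A, U A & forall z, z \in zs -> A.@[z 0] != 0.
Proof.
move=> Ulin Ubpf; elim: zs => [|z zs IH] zs0.
  have [|A UA _] := Ubpf (pt2 1 0); first by apply: pt2_neq0; rewrite oner_eq0.
  by exists A.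
have [|A UA Azs] := IH; first by move=> w wz; apply: zs0; rewrite inE wz orbT.
have [|B UB Bz] := Ubpf z; first by apply: zs0; rewrite mem_head.
(* The values c for which A + c B vanishes at some point of the list are roots of [p]; no factor is
   zero, by the value of B at z and the values of A elsewhere. *)
pose p := \prod_(w <- z :: zs) (A.@[w 0]%:P + B.@[w 0] *: 'X).
have : p != 0.
  rewrite prodf_seq_neq0; apply/allP => w; rewrite inE => /orP[/eqP->|wz] /=.
    apply: contraNneq Bz => /polyP/(_ 1%N) e; apply/eqP; move: e.
    by rewrite coefD coefC coefZ coefX mulr1 add0r coef0.
  apply: contraNneq (Azs w wz) => /polyP/(_ 0%N) e; apply/eqP; move: e.
  by rewrite coefD coefC coefZ coefX mulr0 addr0 coef0.
move=> /closed_nonroot [c pc]; exists (A + c *: B); first exact: Ulin.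
move=> w wz; apply: contraNneq pc; rewrite mevalD mevalZ => e.
rewrite /root horner_prod prodf_seq_eq0; apply/hasP; exists w => //=.
by rewrite !hornerE mulrC; apply/eqP; rewrite -[RHS]e mulrC.
Qed.

Lemma form2_coprime_pair (U : S -> Prop) (v : nat) :
  (forall c A B, U A -> U B -> U (A + c *: B)) ->
  (forall A, U A -> A \is v.-homog) ->
  (forall q, q != 0 -> exists2 A, U A & A.@[q 0] != 0) ->
  exists h1 h2, [/\ U h1, U h2 & forall q, q != 0 -> h1.@[q 0] = 0 -> h2.@[q 0] != 0].
Proof.
move=> Ulin Uh Ubpf.
have p0 : pt2 1 0 != 0 :> 'rV[K]_2 by apply: pt2_neq0; rewrite oner_eq0.
have [h1 Uh1 h1p] := Ubpf _ p0.
have h10 : h1 != 0 by apply: contraNneq h1p => ->; rewrite meval0.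
have [zs [zs0 Hzs]] := form2_zeros (Uh _ Uh1) h10.
have [h2 Uh2 h2z] := form2_avoid Ulin Ubpf zs0.
exists h1, h2; split=> // q q0 h1q; have [z zz qz] := Hzs q q0 h1q.
by rewrite (meval_proj (Uh _ Uh2) qz); apply: h2z.
Qed.

(** Iterated Bezout: [A] lies in the k-th power of the ideal (h1, h2). It is stated as an induction
    principle for additive predicates, which avoids writing the sum. *)
Lemma form2_bezout_pow (v k N : nat) (h1 h2 A : S) (Pi : S -> Prop) :
  h1 \is v.-homog -> h2 \is v.-homog ->
  (forall q, q != 0 -> h1.@[q 0] = 0 -> h2.@[q 0] != 0) ->
  A \is N.-homog -> (k * v + v <= N.+1)%N -> (forall A B, Pi A -> Pi B -> Pi (A + B)) ->
  (forall a b C, (a + b = k)%N -> C \is (N - k * v)%N.-homog -> Pi (h1 ^+ a * h2 ^+ b * C)) ->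
  Pi A.
Proof.
move=> hh1 hh2 h12; elim: k N A Pi => [|k IH] N A Pi hA leN PiD Pih.
  by have := Pih 0%N 0%N A erefl; rewrite subn0 !expr0 !mul1r; apply.
have [|B1 [B2 [hB1 hB2 ->]]] := form2_bezout hh1 hh2 h12 hA; first by move: leN; clear; lia.
apply: (PiD _ _).
- apply: (IH (N - v)%N B1 (fun B => Pi (h1 * B))) => //.
  + by move: leN; clear; lia.
  + by move=> B C PB PC; rewrite mulrDr; apply: (PiD _ _).
  + move=> a b C e hC; have := Pih a.+1 b C; rewrite exprS !mulrA; apply; first by rewrite addSn e.
  by move: hC; congr (_ \is _.-homog); clear; lia.
- apply: (IH (N - v)%N B2 (fun B => Pi (h2 * B))) => //.
  + by move: leN; clear; lia.
  + by move=> B C PB PC; rewrite mulrDr; apply: (PiD _ _).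
  + move=> a b C e hC; have := Pih a b.+1 C; rewrite exprS !mulrA [h2 * _]mulrC; apply; first by rewrite addnS e.
  by move: hC; congr (_ \is _.-homog); clear; lia.
Qed.

End Bezout.

(* [T e] stands for the image of H^0(X, O(e)) in H^0(P^1, O(deg e)).  [T_imm]
   expresses that phi is a closed immersion: the functions s and t on P^1,
   divided by a form not vanishing at q, lift to X. *)
Section VeryAmple.
Variables (K : closedFieldType) (M : nat) (dg : 'I_M -> nat).
Local Notation S := {mpoly K[2]}.
Local Notation deg e := (\sum_(i < M) e i * dg i)%N.
Variable T : ('I_M -> nat) -> S -> Prop.
Hypothesis T_ext : forall e e' A, e =1 e' -> T e A -> T e' A.
Hypothesis T_hom : forall e A, T e A -> A \is (deg e).-homog.
Hypothesis T_lin : forall e c A B, T e A -> T e B -> T e (A + c *: B).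
Hypothesis T_mul : forall e e' A B, T e A -> T e' B -> T (fun i => e i + e' i)%N (A * B).
Hypothesis T_one : T (fun=> 0%N) 1.
Hypothesis T_bpf : forall e (q : 'rV[K]_2), q != 0 -> exists2 A, T e A & A.@[q 0] != 0.
Hypothesis T_imm : forall q : 'rV[K]_2, q != 0 ->
  exists e H k, [/\ T e ('X_0 * H), T e ('X_1 * H), H \is k.-homog, (deg e = k.+1)%N & H.@[q 0] != 0].

(** The forms that lift after multiplication by either coordinate of P^1; they transfer products
    with s and t to X. *)
Let U e k H := [/\ T e ('X_0 * H), T e ('X_1 * H), H \is k.-homog & (deg e = k.+1)%N].

Let degD e e' : deg (fun i => e i + e' i)%N = (deg e + deg e')%N.
Proof. by rewrite -big_split; apply: eq_bigr => i _; rewrite mulnDl. Qed.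

Let U_lin e k c A B : U e k A -> U e k B -> U e k (A + c *: B).
Proof.
move=> [A0 A1 hA ek] [B0 B1 hB _]; split=> //.
- by rewrite mulrDr -scalerAr; apply: T_lin.
- by rewrite mulrDr -scalerAr; apply: T_lin.
- by apply: rpredD => //; apply: rpredZ.
Qed.

Let U_mul e e' k H A : U e k H -> T e' A ->
  U (fun i => e i + e' i)%N (k + deg e')%N (H * A).
Proof.
move=> [H0 H1 hH ek] TA; split; rewrite ?mulrA; try exact: T_mul.
- by apply: dhomogM => //; apply: T_hom.
- by rewrite degD ek.
Qed.

(** One such form has finitely many zeros. At each of them [T_imm] gives another form, and sections
    without zero at the point raise all the multidegrees to a common one. *)
Lemma ample_bpf : exists e0, forall e, (forall i, e0 i <= e i)%N ->
  exists k, forall q : 'rV[K]_2, q != 0 -> exists2 H, U e k H & H.@[q 0] != 0.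
Proof.
have p0 : pt2 1 0 != 0 :> 'rV[K]_2 by apply: pt2_neq0; rewrite oner_eq0.
have [e1 [H1 [k1 [H10 H11 hH1 ek1 H1p]]]] := T_imm p0.
have H1n0 : H1 != 0 by apply: contraNneq H1p => ->; rewrite meval0.
have [zs [zs0 Hzs]] := form2_zeros hH1 H1n0.
have [e0 He0] : exists e0, forall z, z \in zs -> exists e k H,
    [/\ U e k H, (forall i, e i <= e0 i)%N & H.@[z 0] != 0].
  elim: zs zs0 {Hzs} => [|z zs IH] zs0; first by exists (fun=> 0%N).
  have [|e0 He0] := IH; first by move=> w wz; apply: zs0; rewrite inE wz orbT.
  have [|e [H [k [T0 T1 hH ek Hz]]]] := T_imm (q := z); first by rewrite zs0 ?mem_head.
  exists (fun i => e i + e0 i)%N => w; rewrite inE => /orP[/eqP->|/He0].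
    by exists e, k, H; split=> // i; apply: leq_addr.
  move=> [e' [k' [H' [UH' le' H'w]]]]; exists e', k', H'; split=> // i.
  exact: leq_trans (le' i) (leq_addl _ _).
have key e e' k H (q : 'rV[K]_2) : U e k H -> (forall i, e i <= e' i)%N -> q != 0 -> H.@[q 0] != 0 ->
    exists2 H', U e' (deg e').-1 H' & H'.@[q 0] != 0.
  move=> UH le q0 Hq; have [A TA Aq] := T_bpf (fun i => e' i - e i)%N q0.
  exists (H * A); last by rewrite mevalM mulf_neq0.
  have [h0 h1 h2 h3] := U_mul UH TA.
  have ee : (fun i => e i + (e' i - e i))%N =1 e' by move=> i; rewrite subnKC.
  have dd : deg e' = (k + deg (fun i => e' i - e i)%N).+1.
    by rewrite -h3; apply: eq_bigr => i _; rewrite subnKC.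
  split; [exact: T_ext ee h0|exact: T_ext ee h1| |by rewrite dd].
  by rewrite dd.
exists (fun i => e1 i + e0 i)%N => e le_e; exists (deg e).-1 => q q0.
have [e0q|H1q] := eqVneq (H1.@[q 0]) 0; last first.
  by apply: (key e1 e k1 H1) => // i; apply: leq_trans (le_e i); apply: leq_addr.
have [z zz qz] := Hzs q q0 e0q; have [e' [k' [H' [UH' le' H'z]]]] := He0 z zz.
apply: (key e' e k' H') => //.
  by move=> i; apply: leq_trans (le_e i); apply: leq_trans (le' i) (leq_addl _ _).
by case: UH' => _ _ hH' _; rewrite (meval_proj hH' qz).
Qed.

(** Two members [h1], [h2] of the system [U e k] have no common zero, so A is a sum of terms h1^a
    h2^b C with a + b = x. Since deg e = k + 1, the form C has degree x: its x linear factors are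
    paired with the x factors h, and each X_l h_r lifts. *)
Lemma ample_full : exists e0, forall e, (forall i, e0 i <= e i)%N ->
  exists x0, forall x, (x0 <= x)%N ->
  forall A, A \is (x * deg e)%N.-homog -> T (fun i => x * e i)%N A.
Proof.
have [e0 He0] := ample_bpf; exists e0 => e /He0 [k bpf].
have [h1 [h2 [Uh1 Uh2 h12]]] := form2_coprime_pair (@U_lin e k) (fun A => fun UA : U e k A => let: And4 _ _ h _ := UA in h) bpf.
have [T10 T11 hh1 ek] := Uh1; have [T20 T21 hh2 _] := Uh2.
have TA c A B : T c A -> T c B -> T c (A + B).
  by move=> hA hB; rewrite -[B]scale1r; apply: T_lin.
have T0 c A : T c A -> T c 0.
  by move=> hA; rewrite -(subrr A) -scaleN1r; apply: T_lin.
have TZ c x A : T c A -> T c (x *: A).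
  by move=> hA; rewrite -[x *: A]add0r; apply: T_lin (hA); apply: T0 hA.
have Tab n : forall a b C, (a + b = n)%N -> C \is n.-homog -> T (fun i => n * e i)%N (h1 ^+ a * h2 ^+ b * C).
  elim: n => [|n IH] a b C.
    case: a b => [|a] [|b] // _ hC; rewrite !mul1r (homog_eq0C hC) -[_%:MP]mulr1 mul_mpolyC.
    have := TZ _ C@_0%MM _ T_one. by apply: T_ext => i; rewrite mul0n.
  move=> eab /form2_split [C0 [C1 [hC0 hC1 ->]]].
  have ext A : T (fun i => e i + n * e i)%N A -> T (fun i => n.+1 * e i)%N A.
    by apply: T_ext => i; rewrite mulSn.
  case: a eab => [|a] eab.
    case: b eab => // b [eb]; have {eb} eb : (0 + b = n)%N by [].
    rewrite mulrDr; apply: (TA _ _ _); apply: ext.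
      have -> : h1 ^+ 0 * h2 ^+ b.+1 * ('X_0 * C0) = ('X_0 * h2) * (h1 ^+ 0 * h2 ^+ b * C0) by rewrite exprS; ring.
      exact/T_mul/IH.
    have -> : h1 ^+ 0 * h2 ^+ b.+1 * ('X_1 * C1) = ('X_1 * h2) * (h1 ^+ 0 * h2 ^+ b * C1) by rewrite exprS; ring.
    exact/T_mul/IH.
  have {}eab : (a + b = n)%N by move: eab; rewrite addSn => -[].
  rewrite mulrDr; apply: (TA _ _ _); apply: ext.
    have -> : h1 ^+ a.+1 * h2 ^+ b * ('X_0 * C0) = ('X_0 * h1) * (h1 ^+ a * h2 ^+ b * C0) by rewrite exprS; ring.
    exact/T_mul/IH.
  have -> : h1 ^+ a.+1 * h2 ^+ b * ('X_1 * C1) = ('X_1 * h1) * (h1 ^+ a * h2 ^+ b * C1) by rewrite exprS; ring.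
  exact/T_mul/IH.
exists k => x le_x A hA; apply: (form2_bezout_pow (k := x) hh1 hh2 h12 hA) => //.
- by rewrite ek; move: le_x; clear; nia.
- exact: TA.
- by move=> a b C eab hC; apply: Tab => //; move: hC; congr (_ \is _.-homog); rewrite ek; clear; lia.
Qed.

End VeryAmple.

(** * Multiplicities of plane curves at the points *)

Definition cross (A : comNzRingType) (u v : 'I_3 -> A) : 'I_3 -> A :=
  fun k => u (k + 1) * v (k + 2) - u (k + 2) * v (k + 1).

Definition dot (A : comNzRingType) (N : nat) (u v : 'I_N -> A) : A :=
  \sum_i u i * v i.

Section Cross.
Variable A : comNzRingType.
Implicit Types u v w : 'I_3 -> A.

Lemma ord3_eqs : ((0 : 'I_3) + 1 = 1) * ((0 : 'I_3) + 2 = 2%:R) * ((1 : 'I_3) + 1 = 2%:R) *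
  ((1 : 'I_3) + 2 = 0) * ((2%:R : 'I_3) + 1 = 0) * ((2%:R : 'I_3) + 2 = 1).
Proof. by do !split; apply: val_inj. Qed.

Lemma sum3E (F : 'I_3 -> A) : \sum_i F i = F 0 + F 1 + F 2%:R.
Proof.
rewrite !big_ord_recl big_ord0 addr0 addrA; congr (F _ + F _ + F _); exact: val_inj.
Qed.

Lemma crossE u v : (cross u v 0 = u 1 * v 2%:R - u 2%:R * v 1) *
  (cross u v 1 = u 2%:R * v 0 - u 0 * v 2%:R) *
  (cross u v 2%:R = u 0 * v 1 - u 1 * v 0).
Proof. by rewrite /cross !ord3_eqs. Qed.

Lemma dotC N (u v : 'I_N -> A) : dot u v = dot v u.
Proof. by apply: eq_bigr => i _; rewrite mulrC. Qed.

Lemma crossr v u : dot v (cross u v) = 0.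
Proof. by rewrite /dot sum3E !crossE; ring. Qed.

Lemma crossl v u : dot u (cross u v) = 0.
Proof. by rewrite /dot sum3E !crossE; ring. Qed.

Lemma cross_crossr u v w k :
  cross w (cross u v) k = u k * dot v w - v k * dot u w.
Proof. by case: (ord3P k) => ->; rewrite /dot !sum3E !crossE; ring. Qed.

End Cross.

Section Graded.
Variable K : comNzRingType.
Local Notation S := {mpoly K[2]}.

Definition graded (p : {poly S}) := forall l, p`_l \is l.-homog.

Lemma gradedD p q : graded p -> graded q -> graded (p + q).
Proof. by move=> hp hq a; rewrite coefD; apply: rpredD. Qed.

Lemma gradedM p q : graded p -> graded q -> graded (p * q).
Proof.
move=> hp hq a; rewrite coefM; apply: rpred_sum => i _.
have := dhomogM (hp i) (hq (a - i)%N); rewrite subnKC //.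
exact: leq_ord.
Qed.

Lemma gradedC c : graded (c%:MP)%:P.
Proof.
move=> a; rewrite coefC; case: eqP => [->|_]; last exact: dhomog0.
by rewrite -[_%:MP]mulr1 mul_mpolyC; apply/rpredZ/dhomog1.
Qed.

Lemma gradedXn A k : A \is k.-homog -> graded (A *: 'X^k).
Proof.
move=> hA a; rewrite coefZ coefXn; case: eqP => [->|_]; first by rewrite mulr1.
by rewrite mulr0; apply: dhomog0.
Qed.

Lemma graded_mmap (N : nat) (h : 'I_N -> {poly S}) (p : {mpoly K[N]}) :
  (forall i, graded (h i)) -> graded (mmap (polyC \o @mpolyC 2 K) h p).
Proof.
move=> hh; rewrite /mmap; elim/big_rec: _ => [a|m q _ hq].
  by rewrite coef0; apply: dhomog0.
apply: gradedD => //; apply: gradedM; first exact: gradedC.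
rewrite /mmap1; elim/big_rec: _ => [|i r _ hr]; first exact: (gradedC 1).
apply: gradedM => //; elim: (m i) => [|e IH]; first exact: (gradedC 1).
by rewrite exprS; apply: gradedM.
Qed.

End Graded.

(* With [P], [a], [b] the rows of [M], [jet M A] is A(P + x (s a + t b)), a
   polynomial in x whose coefficients are forms in s, t: the Taylor expansion
   of [A] at [P].  The multiplicity at [P] is the order of vanishing in x. *)
Definition jet_arg (K : closedFieldType) (M : 'M[K]_3) (k : 'I_3) : {poly {mpoly K[2]}} :=
  (M 0 k)%:MP%:P + (M 1 k *: 'X_0 + M 2%:R k *: 'X_1) *: 'X.

HB.lock Definition jet (K : closedFieldType) (M : 'M[K]_3) (A : {mpoly K[3]}) : {poly {mpoly K[2]}} :=
  mmap (polyC \o @mpolyC 2 K) (jet_arg M) A.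

HB.lock Definition linsub (K : closedFieldType) (M : 'M[K]_3) (A : {mpoly K[3]}) : {mpoly K[3]} :=
  mmap (@mpolyC 3 K) (fun k => \sum_i M i k *: 'X_i) A.

(** Binary forms as forms in X_1, X_2, the local coordinates at (1 : 0 : 0), which is the point of
    the frame [1%:M]. *)
HB.lock Definition emb12 (K : closedFieldType) (B : {mpoly K[2]}) : {mpoly K[3]} :=
  mmap (@mpolyC 3 K) (fun i => if i == 0 then 'X_1 else 'X_2%:R) B.

Section LockedMorphisms.
Variables (K : closedFieldType) (M : 'M[K]_3).

Lemma jet_zmod : zmod_morphism (jet M).
Proof. by move=> A B; rewrite jet.unlock; apply: raddfB. Qed.
Lemma jet_monoid : monoid_morphism (jet M).
Proof. by split=> [|A B]; rewrite jet.unlock; [apply: rmorph1|apply: rmorphM]. Qed.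
HB.instance Definition _ := GRing.isZmodMorphism.Build _ _ (jet M) jet_zmod.
HB.instance Definition _ := GRing.isMonoidMorphism.Build _ _ (jet M) jet_monoid.

Lemma linsub_zmod : zmod_morphism (linsub M).
Proof. by move=> A B; rewrite linsub.unlock; apply: raddfB. Qed.
Lemma linsub_monoid : monoid_morphism (linsub M).
Proof. by split=> [|A B]; rewrite linsub.unlock; [apply: rmorph1|apply: rmorphM]. Qed.
HB.instance Definition _ := GRing.isZmodMorphism.Build _ _ (linsub M) linsub_zmod.
HB.instance Definition _ := GRing.isMonoidMorphism.Build _ _ (linsub M) linsub_monoid.

Lemma emb12_zmod : zmod_morphism (@emb12 K).
Proof. by move=> A B; rewrite emb12.unlock; apply: raddfB. Qed.
Lemma emb12_monoid : monoid_morphism (@emb12 K).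
Proof. by split=> [|A B]; rewrite emb12.unlock; [apply: rmorph1|apply: rmorphM]. Qed.
HB.instance Definition _ := GRing.isZmodMorphism.Build _ _ (@emb12 K) emb12_zmod.
HB.instance Definition _ := GRing.isMonoidMorphism.Build _ _ (@emb12 K) emb12_monoid.

Lemma jetC c : jet M c%:MP = c%:MP%:P.
Proof. by rewrite jet.unlock mmapC. Qed.
Lemma jetXi k : jet M 'X_k = jet_arg M k.
Proof. by rewrite jet.unlock; apply: (mmapXU (polyC \o @mpolyC 2 K : {rmorphism K -> {poly {mpoly K[2]}}})). Qed.
Lemma linsubC c : linsub M c%:MP = c%:MP.
Proof. by rewrite linsub.unlock mmapC. Qed.
Lemma linsubXi k : linsub M 'X_k = \sum_i M i k *: 'X_i.
Proof. by rewrite linsub.unlock mmapXU. Qed.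
Lemma emb12C c : emb12 c%:MP = c%:MP :> {mpoly K[3]}.
Proof. by rewrite emb12.unlock mmapC. Qed.
Lemma emb12Xi i : emb12 'X_i = (if i == 0 then 'X_1 else 'X_2%:R) :> {mpoly K[3]}.
Proof. by rewrite emb12.unlock mmapXU. Qed.

End LockedMorphisms.

Lemma coef_scaleX_mul (A : comNzRingType) (u v : A) i j l :
  ((u *: 'X) ^+ i * (v *: 'X) ^+ j)`_l = u ^+ i * v ^+ j *+ (i + j == l)%N.
Proof.
rewrite !exprZn -scalerAl -scalerAr scalerA -exprD coefZ coefXn eq_sym.
by rewrite mulr_natr.
Qed.

Section Jets.
Variable K : closedFieldType.
Local Notation S := {mpoly K[2]}.
Local Notation R := {mpoly K[3]}.
Implicit Types (M N : 'M[K]_3) (A B : R).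

Definition ordge M (c : nat) A := forall a, (a < c)%N -> (jet M A)`_a = 0.

Lemma jet_graded M A : graded (jet M A).
Proof.
rewrite jet.unlock; apply: graded_mmap => k; apply: gradedD; first exact: gradedC.
by rewrite -['X]expr1; apply: gradedXn; apply: rpredD; apply: rpredZ; apply: dhomogXi.
Qed.

Lemma jetZ M c A : jet M (c *: A) = c%:MP *: jet M A.
Proof. by rewrite -mul_mpolyC rmorphM /= jetC mul_polyC. Qed.

Lemma ordge0 M A : ordge M 0 A. Proof. by []. Qed.

Lemma ordge_le M c c' A : (c' <= c)%N -> ordge M c A -> ordge M c' A.
Proof. by move=> le hA a lt; apply: hA; apply: leq_trans le. Qed.

Lemma ordge_zero M c : ordge M c 0.
Proof. by move=> a _; rewrite rmorph0 coef0. Qed.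

Lemma ordgeD M c A B : ordge M c A -> ordge M c B -> ordge M c (A + B).
Proof. by move=> hA hB a lt; rewrite rmorphD coefD (hA _ lt) (hB _ lt) addr0. Qed.

Lemma ordgeZ M c x A : ordge M c A -> ordge M c (x *: A).
Proof. by move=> hA a lt; rewrite jetZ coefZ (hA _ lt) mulr0. Qed.

Lemma ordgeM M c c' A B : ordge M c A -> ordge M c' B -> ordge M (c + c') (A * B).
Proof.
move=> hA hB a lt; rewrite rmorphM coefM big1 // => i _.
have [lt_ic|le_ci] := ltnP i c; first by rewrite (hA _ lt_ic) mul0r.
by rewrite (hB (a - i)%N) ?mulr0 //; have := ltn_ord i; move: lt le_ci; clear; lia.
Qed.

Lemma ordge_sum M c (I : Type) (r : seq I) (P : pred I) F :
  (forall i, P i -> ordge M c (F i)) -> ordge M c (\sum_(i <- r | P i) F i).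
Proof.
move=> h; elim/big_ind: _ => [|A B|]; [exact: ordge_zero|exact: ordgeD|exact: h].
Qed.

(** Lowest coefficients in x multiply without cancellation, because the coefficient ring is a
    domain. *)
Lemma ordge_cancel M c m A B : ordge M m A -> (jet M A)`_m != 0 ->
  ordge M (c + m) (A * B) -> ordge M c B.
Proof.
move=> hA Am hAB a; elim/ltn_ind: a => a IH lt_ac.
have := hAB (m + a)%N; rewrite addnC ltn_add2r => /(_ lt_ac).
rewrite rmorphM coefM; have lt_m : (m < (a + m).+1)%N by rewrite ltnS leq_addl.
rewrite (bigD1 (Ordinal lt_m)) //= addnK big1 ?addr0 => [/eqP|i ne].
  by rewrite mulf_eq0 (negPf Am) => /eqP.
have [lt_im|gt_im|e] := ltngtP (i : nat) m; first by rewrite (hA _ lt_im) mul0r.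
  rewrite (IH (a + m - i)%N) ?mulr0 //; have := ltn_ord i; move: gt_im lt_ac; clear; lia.
by case/eqP: ne; apply: val_inj.
Qed.

Lemma linsubZ M c A : linsub M (c *: A) = c *: linsub M A.
Proof. by rewrite -!mul_mpolyC rmorphM /= linsubC. Qed.

Lemma linsub_comp M N A : linsub N (linsub M A) = linsub (N *m M) A.
Proof.
apply: (@mpoly_rmorph_eq _ _ _ (linsub N \o linsub M) (linsub (N *m M))) => [c|k] /=.
  by rewrite !linsubC.
rewrite linsubXi rmorph_sum linsubXi /=.
transitivity (\sum_i \sum_l (N l i * M i k) *: 'X_l : R).
  apply: eq_bigr => i _; rewrite linsubZ linsubXi scaler_sumr; apply: eq_bigr => l _.
  by rewrite scalerA mulrC.
rewrite exchange_big; apply: eq_bigr => l _ /=.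
by rewrite -scaler_suml mxE.
Qed.

Lemma linsub1 A : linsub 1%:M A = A.
Proof.
apply: (@mpoly_rmorph_eq _ _ _ (linsub 1%:M) idfun) => [c|k] /=; first exact: linsubC.
rewrite linsubXi (bigD1 k) //= mxE eqxx scale1r big1 ?addr0 // => i ne.
by rewrite mxE (negPf ne) scale0r.
Qed.

Lemma linsub_homog M k A : A \is k.-homog -> linsub M A \is k.-homog.
Proof.
move=> hA; rewrite linsub.unlock -[k]mul1n; apply: mmap_dhomog hA => i.
by apply: rpred_sum => l _; apply/rpredZ/dhomogXi.
Qed.

Lemma jet_arg1 : (jet_arg (1%:M : 'M[K]_3) 0 = 1) * (jet_arg (1%:M : 'M[K]_3) 1 = 'X_0 *: 'X) *
  (jet_arg (1%:M : 'M[K]_3) 2%:R = 'X_1 *: 'X).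
Proof.
by rewrite /jet_arg !mxE /= !scale1r !scale0r ?addr0 ?add0r ?mpolyC0 ?mpolyC1 ?polyC0 ?polyC1
  ?scale0r ?addr0 ?add0r.
Qed.

Lemma jet_linsub M A : jet M A = jet 1%:M (linsub M A).
Proof.
pose f : {rmorphism R -> {poly S}} := jet M.
pose g : {rmorphism R -> {poly S}} := jet 1%:M \o linsub M.
suff H : f =1 g by exact: H.
apply: mpoly_rmorph_eq => [c|k]; rewrite /f /g /=.
  by rewrite linsubC !jetC.
rewrite linsubXi rmorph_sum /= sum3E !jetZ !jetXi !jet_arg1 /jet_arg.
by rewrite alg_polyC scalerDl !scalerA !mul_mpolyC addrA.
Qed.

Lemma emb12Z c (B : S) : emb12 (c *: B) = c *: emb12 B.
Proof. by rewrite -!mul_mpolyC rmorphM /= emb12C. Qed.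

Lemma emb12_homog k (B : S) : B \is k.-homog -> emb12 B \is k.-homog.
Proof.
move=> hA; rewrite emb12.unlock -[k]mul1n; apply: mmap_dhomog hA => i.
by case: eqP => _; apply/dhomogXi.
Qed.

Lemma jet1_emb12 k (B : S) : B \is k.-homog -> jet 1%:M (emb12 B) = B *: 'X^k.
Proof.
move=> hB; rewrite emb12.unlock (@rmorph_mmap K _ _ 2 (@mpolyC 3 K) _ (jet 1%:M)).
transitivity (mmap (polyC \o @mpolyC 2 K) (fun i => 'X * ('X_i)%:P) B).
  apply: eq_mmap => [c|i] /=; first exact: jetC.
  by case: (ord2P i) => -> /=; rewrite jetXi !jet_arg1 -mul_polyC mulrC.
rewrite (@mmap_scale _ _ _ (polyC \o @mpolyC 2 K : {rmorphism K -> {poly S}}) _ _ k) //.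
rewrite mulrC -mul_polyC; congr (_ * _).
have -> : mmap (polyC \o @mpolyC 2 K) (fun i => ('X_i)%:P) B
        = (mmap (@mpolyC 2 K) (fun i => 'X_i) B)%:P by rewrite rmorph_mmap.
congr _%:P; apply: (@mpoly_rmorph_eq _ _ _ (mmap (@mpolyC 2 K) (fun i => 'X_i)) idfun) => [c|i] /=.
  exact: mmapC.
exact: mmapXU.
Qed.

(** In the standard frame the jet is A(1, xs, xt): its coefficients are the parts of A by degree in
    X_1, X_2, and powers of X_0 homogenize them again. *)
Lemma jet1_expand k A : A \is k.-homog ->
  A = \sum_(a < k.+1) 'X_0 ^+ (k - a) * emb12 (jet 1%:M A)`_a.
Proof.
move=> hA; rewrite {1}(mpolyE A).
have E a : (jet 1%:M A)`_a = \sum_(m <- msupp A) A@_m *: ('X_0 ^+ m 1 * 'X_1 ^+ m 2%:R *+ (m 1%R + m (2%:R)%R == a)%N).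
  rewrite jet.unlock /mmap coef_sum; apply: eq_bigr => m _; rewrite coefCM mul_mpolyC; congr (_ *: _).
  rewrite /mmap1 !big_ord_recl big_ord0 mulr1.
  have -> : lift ord0 (ord0 : 'I_2) = 1 :> 'I_3 by apply: val_inj.
  have -> : lift ord0 (lift ord0 (ord0 : 'I_1)) = 2%:R :> 'I_3 by apply: val_inj.
  rewrite -[ord0]/(0 : 'I_3) !jet_arg1 expr1n mul1r.
  exact: coef_scaleX_mul.
transitivity (\sum_(m <- msupp A) \sum_(a < k.+1) 'X_0 ^+ (k - a) * emb12 (A@_m *: ('X_0 ^+ m 1 * 'X_1 ^+ m 2%:R *+ (m 1%R + m (2%:R)%R == a)%N))).
  rewrite big_seq [RHS]big_seq; apply: eq_bigr => m mA.
  have mk : (m 0%R + m 1%R + m (2%:R)%R = k)%N.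
    rewrite -(dhomog_mf hA mA) /= mdegE; apply/eqP; rewrite -eqz_nat; apply/eqP.
    by rewrite -!natz natr_sum sum3E !natrD.
  have lt : (m 1%R + m (2%:R)%R < k.+1)%N by rewrite ltnS -mk -addnA leq_addl.
  rewrite (bigD1 (Ordinal lt)) //= eqxx mulr1n big1 ?addr0.
    rewrite emb12Z -scalerAr; congr (_ *: _).
    rewrite rmorphM !rmorphXn /= !emb12Xi /= mpolyXE_id !big_ord_recl big_ord0 mulr1.
    have -> : lift ord0 (ord0 : 'I_2) = 1 :> 'I_3 by apply: val_inj.
    have -> : lift ord0 (lift ord0 (ord0 : 'I_1)) = 2%:R :> 'I_3 by apply: val_inj.
    by congr ('X_0 ^+ _ * _); rewrite -mk -addnA addnK.
  move=> a ne; case: eqP => [e|_]; last by rewrite mulr0n scaler0 rmorph0 mulr0.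
  by case/eqP: ne; apply: val_inj.
rewrite exchange_big; apply: eq_bigr => a _ /=.
by rewrite E rmorph_sum -mulr_sumr.
Qed.

Lemma linsubK M A : M \in unitmx -> linsub (invmx M) (linsub M A) = A.
Proof. by move=> uM; rewrite linsub_comp mulVmx // linsub1. Qed.

Lemma ordge_linsub M c A : ordge M c A <-> ordge 1%:M c (linsub M A).
Proof. by rewrite /ordge jet_linsub. Qed.

Lemma ordge_eq0 M k c A : M \in unitmx -> A \is k.-homog -> ordge M c A -> (k < c)%N -> A = 0.
Proof.
move=> uM hA; rewrite ordge_linsub => oA lt.
rewrite -(linsubK A uM) (jet1_expand (linsub_homog M hA)) big1 ?rmorph0 // => i _.
by rewrite oA ?rmorph0 ?mulr0 //; apply: leq_trans lt; rewrite ltn_ord.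
Qed.

(** Each coefficient of the jet is split as s u + t v. The coefficients of order at most c vanish
    and are split as zero, which keeps the order of both parts at least c. *)
Lemma jet1_decomp k c B : B \is k.+1.-homog -> ordge 1%:M c.+1 B ->
  exists B1 B2, [/\ B1 \is k.-homog, B2 \is k.-homog, ordge 1%:M c B1, ordge 1%:M c B2
                  & B = 'X_1 * B1 + 'X_2%:R * B2].
Proof.
move=> hB oB.
have split_p (a : 'I_k.+2) : exists uv : S * S,
    [/\ uv.1 \is (a.-1).-homog, uv.2 \is (a.-1).-homog,
        (jet 1%:M B)`_a = 'X_0 * uv.1 + 'X_1 * uv.2 & (a < c.+1)%N -> uv = (0, 0)].
  have [lt|le] := ltnP a c.+1.
    by exists (0, 0); split; rewrite ?dhomog0 // !mulr0 addr0 oB.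
  case: a le => -[//|a] lta le; have [u [v [hu hv e]]] := form2_split (jet_graded 1%:M B a.+1).
  by exists (u, v); split.
have [f Hf] := fin_all_exists split_p.
pose G (g : S * S -> S) : R := \sum_(a < k.+2) 'X_0 ^+ (k.+1 - a) * emb12 (g (f a)).
have GP g : (forall a, g (f a) \is (a.-1).-homog) -> (forall a : 'I_k.+2, (a < c.+1)%N -> g (f a) = 0) ->
    G g \is k.-homog /\ ordge 1%:M c (G g).
  move=> hg g0; split.
    apply: rpred_sum => a _; have := hg a; have := g0 a; case: a => -[|a] lta /= g0a hga.
      by rewrite g0a // rmorph0 mulr0 dhomog0.
    have := dhomogM (@dhomogXin K 3 (k.+1 - a.+1) 0) (emb12_homog hga).
    by rewrite subSS subnK.
  apply: ordge_sum => a _ l lt_lc.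
  rewrite rmorphM rmorphXn /= jetXi !jet_arg1 expr1n mul1r (jet1_emb12 (hg a)) coefZ coefXn.
  case: eqP => [e|_]; last by rewrite mulr0.
  rewrite g0 ?mul0r //; case: (a : nat) e => [|l'] //= e; by rewrite ltnS -e.
have [h1 o1] : G fst \is k.-homog /\ ordge 1%:M c (G fst).
  by apply: GP => a; [case: (Hf a)|move=> lt; case: (Hf a) => _ _ _ ->].
have [h2 o2] : G snd \is k.-homog /\ ordge 1%:M c (G snd).
  by apply: GP => a; [case: (Hf a)|move=> lt; case: (Hf a) => _ _ _ ->].
exists (G fst), (G snd); split=> //.
rewrite {1}(jet1_expand hB) /G !mulr_sumr -big_split /=; apply: eq_bigr => a _.
have [_ _ -> _] := Hf a; rewrite rmorphD !rmorphM /= !emb12Xi /=; ring.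
Qed.

(** This is the identity (w x c).(P x X) = (w.P)(c.X) - (w.X)(c.P). A line through P is thus a
    combination of the coordinates of the line joining P to X. *)
Lemma linear_in_cross (P c w : 'I_3 -> K) : dot w P = 1 -> dot c P = 0 ->
  \sum_i c i *: 'X_i = \sum_k cross w c k *: cross (fun i => (P i)%:MP) (fun i => 'X_i) k :> R.
Proof.
move=> wP cP; rewrite !sum3E !crossE -!mul_mpolyC !mpolyCB !mpolyCM.
have {}wP : (w 0)%:MP * (P 0)%:MP + (w 1)%:MP * (P 1)%:MP + (w 2%:R)%:MP * (P 2%:R)%:MP = 1 :> R.
  by rewrite -!mpolyCM -!mpolyCD -mpolyC1 -wP /dot sum3E.
have {}cP : (c 0)%:MP * (P 0)%:MP + (c 1)%:MP * (P 1)%:MP + (c 2%:R)%:MP * (P 2%:R)%:MP = 0 :> R.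
  by rewrite -!mpolyCM -!mpolyCD -mpolyC0 -cP /dot sum3E.
rewrite -[LHS]mul1r -wP; apply/eqP; rewrite -subr_eq0; apply/eqP.
transitivity (((c 0)%:MP * (P 0)%:MP + (c 1)%:MP * (P 1)%:MP + (c 2%:R)%:MP * (P 2%:R)%:MP) *
  ((w 0)%:MP * 'X_0 + (w 1)%:MP * 'X_1 + (w 2%:R)%:MP * 'X_2%:R) : R); last by rewrite cP mul0r.
ring.
Qed.

(** The factors [cross P X] are the coordinates of the line l_j at the generic point of X, so each
    unit of multiplicity is traded for one degree in the j-th dual plane. *)
Lemma ordge_decomp M k c A : M \in unitmx -> A \is k.+1.-homog -> ordge M c.+1 A ->
  exists A' : 'I_3 -> R,
    (forall l, A' l \is k.-homog /\ ordge M c (A' l)) /\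
    A = \sum_l cross (fun i => (M 0 i)%:MP) (fun i => 'X_i) l * A' l.
Proof.
move=> uM hA oA.
have [B1 [B2 [h1 h2 o1 o2 BE]]] := jet1_decomp (linsub_homog M hA) (proj1 (ordge_linsub _ _ _) oA).
pose N := invmx M.
have MN : M *m N = 1%:M by rewrite mulmxV.
have dotN j : dot (fun i => N i j) (fun i => M 0 i) = (0 == j)%:R.
  have := congr1 (fun X : 'M_3 => X 0 j) MN; rewrite !mxE => <-.
  by apply: eq_bigr => i _; rewrite mulrC.
have key c' B : B \is k.-homog -> ordge 1%:M c' B ->
    linsub N B \is k.-homog /\ ordge M c' (linsub N B).
  move=> hB oB; split; first exact: linsub_homog.
  by apply/ordge_linsub; rewrite linsub_comp MN linsub1.
have [h1' o1'] := key _ _ h1 o1; have [h2' o2'] := key _ _ h2 o2.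
pose y j := cross (fun i => N i 0) (fun i => N i j).
exists (fun l => y 1 l *: linsub N B1 + y 2%:R l *: linsub N B2); split.
  move=> l; split; first by apply: rpredD; apply: rpredZ.
  by apply: ordgeD; apply: ordgeZ.
rewrite -{1}(linsubK A uM) BE rmorphD !rmorphM /= !linsubXi.
rewrite (linear_in_cross (dotN 0) (dotN 1)) (linear_in_cross (dotN 0) (dotN 2%:R)) !mulr_suml -big_split /=.
apply: eq_bigr => l _; rewrite -!mul_mpolyC; ring.
Qed.

End Jets.

(** * Local sections of line bundles on X *)

Section Multihomog.
Variables (K : fieldType) (n : nat).
Local Notation T := {mpoly K[n.+1 * 3]}.
Implicit Types (e : 'I_n.+1 -> nat) (G H : T).

Lemma mh_ext e e' G : e =1 e' -> multihomog e G -> multihomog e' G.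
Proof. by move=> ee hG m mG i; rewrite -ee; apply: hG. Qed.

Lemma mh0 e : multihomog e (0 : T).
Proof. by move=> m; rewrite msupp0. Qed.

Lemma mhD e G H : multihomog e G -> multihomog e H -> multihomog e (G + H).
Proof.
by move=> hG hH m /msuppD_le; rewrite mem_cat => /orP[/hG|/hH].
Qed.

Lemma mhZ e c G : multihomog e G -> multihomog e (c *: G).
Proof. by move=> hG m /msuppZ_le/hG. Qed.

Lemma mhM e e' G H : multihomog e G -> multihomog e' H ->
  multihomog (fun i => e i + e' i)%N (G * H).
Proof.
move=> hG hH m /msuppM_le/allpairsP[[m1 m2] /= [m1G m2H ->]] i.
by rewrite -(hG _ m1G) -(hH _ m2H) -big_split; apply: eq_bigr => k _; rewrite mnmDE.
Qed.

Lemma mh1 : multihomog (fun=> 0%N) (1 : T).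
Proof.
move=> m; rewrite msupp1 inE => /eqP-> i.
by rewrite big1 // => k _; rewrite mnm0E.
Qed.

Lemma mhX i k : multihomog (fun l => (l == i) : nat) ('X_(mxvec_index i k) : T).
Proof.
move=> m; rewrite msuppX inE => /eqP-> l; have [->|ne] := eqVneq l i.
  rewrite (bigD1 k) //= mnm1E eqxx big1 ?addn0 // => k' ne.
  rewrite mnm1E; case: eqP => // /(congr1 (fun x => (vec_mx (delta_mx 0 x) : 'M[nat]_(n.+1,3)) )).
  by rewrite !vec_mx_delta => /matrixP/(_ i k'); rewrite !mxE !eqxx (negPf ne).
rewrite big1 // => k' _; rewrite mnm1E; case: eqP => // /(congr1 (fun x => (vec_mx (delta_mx 0 x) : 'M[nat]_(n.+1,3)) )).
by rewrite !vec_mx_delta => /matrixP/(_ l k'); rewrite !mxE !eqxx (negPf ne).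
Qed.

Lemma mh_sum (I : Type) (r : seq I) (p : pred I) e (F : I -> T) :
  (forall i, p i -> multihomog e (F i)) -> multihomog e (\sum_(i <- r | p i) F i).
Proof.
by move=> h; elim/big_ind: _ => [|A B|]; [apply: mh0|apply: mhD|apply: h].
Qed.

Lemma mhXn e G k : multihomog e G -> multihomog (fun i => k * e i)%N (G ^+ k).
Proof.
move=> hG; elim: k => [|k IH]; first exact: mh1.
by rewrite exprS; apply: mh_ext (mhM hG IH) => i; rewrite mulSn.
Qed.

Lemma mh_prod (I : Type) (r : seq I) (e : I -> 'I_n.+1 -> nat) (F : I -> T) :
  (forall x, multihomog (e x) (F x)) ->
  multihomog (fun i => \sum_(x <- r) e x i)%N (\prod_(x <- r) F x).
Proof.
move=> h; elim: r => [|x r IH].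
  by rewrite big_nil; apply: mh_ext mh1 => i; rewrite big_nil.
by rewrite big_cons; apply: mh_ext (mhM (h x) IH) => i; rewrite big_cons.
Qed.

Lemma mh_lin i (c : 'I_3 -> K) :
  multihomog (fun l => (l == i) : nat) (\sum_k c k *: 'X_(mxvec_index i k) : T).
Proof. by apply: mh_sum => k _; apply/mhZ/mhX. Qed.

Lemma prod_mxvec (A : comNzRingType) (F : 'I_(n.+1 * 3) -> A) :
  \prod_x F x = \prod_i \prod_k F (mxvec_index i k).
Proof.
rewrite pair_bigA /= (reindex _ (curry_mxvec_bij _ _)).
by apply: eq_bigr => -[i k].
Qed.

Lemma mmap_rowscale (A : comNzRingType) (f : {rmorphism K -> A})
    (Z Z' : 'M[A]_(n.+1, 3)) (c : 'I_n.+1 -> A) e G :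
  multihomog e G -> (forall i k, Z' i k = c i * Z i k) ->
  mmap f (mxvec Z' 0) G = (\prod_i c i ^+ e i) * mmap f (mxvec Z 0) G.
Proof.
move=> hG ZZ'; rewrite /mmap big_distrr /= big_seq [RHS]big_seq; apply: eq_bigr => m mG.
rewrite mulrCA; congr (_ * _); rewrite /mmap1 !prod_mxvec -big_split /=.
apply: eq_bigr => i _; rewrite -(hG m mG i) -prodrXr -big_split; apply: eq_bigr => k _ /=.
by rewrite !mxvecE ZZ' exprMn.
Qed.

End Multihomog.

(* The restrictions to the generic point of X and to the curve, and the pullback
   to P^1 of forms on the plane.  They are locked: otherwise conversion problems
   in fraction fields unfold [mmap]. *)
HB.lock Definition sg (K : closedFieldType) (n : nat) (P : 'I_n -> 'rV[K]_3)
  (G : {mpoly K[n.+1 * 3]}) : {mpoly K[3]} := subst (generic_pt P) G.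

HB.lock Definition sp (K : closedFieldType) (n : nat) (phi : 'M[{mpoly K[2]}]_(n.+1, 3))
  (G : {mpoly K[n.+1 * 3]}) : {mpoly K[2]} := subst phi G.

HB.lock Definition pb (K : closedFieldType) (f : 'I_3 -> {mpoly K[2]}) (A : {mpoly K[3]}) :
  {mpoly K[2]} := mmap (@mpolyC 2 K) f A.

Section Restrictions.
Variables (K : closedFieldType) (n : nat) (P : 'I_n -> 'rV[K]_3)
  (phi : 'M[{mpoly K[2]}]_(n.+1, 3)) (f : 'I_3 -> {mpoly K[2]}).

Lemma sg_zmod : zmod_morphism (sg P).
Proof. by move=> A B; rewrite sg.unlock; apply: raddfB. Qed.
Lemma sg_monoid : monoid_morphism (sg P).
Proof. by split=> [|A B]; rewrite sg.unlock; [apply: rmorph1|apply: rmorphM]. Qed.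
HB.instance Definition _ := GRing.isZmodMorphism.Build _ _ (sg P) sg_zmod.
HB.instance Definition _ := GRing.isMonoidMorphism.Build _ _ (sg P) sg_monoid.

Lemma sp_zmod : zmod_morphism (sp phi).
Proof. by move=> A B; rewrite sp.unlock; apply: raddfB. Qed.
Lemma sp_monoid : monoid_morphism (sp phi).
Proof. by split=> [|A B]; rewrite sp.unlock; [apply: rmorph1|apply: rmorphM]. Qed.
HB.instance Definition _ := GRing.isZmodMorphism.Build _ _ (sp phi) sp_zmod.
HB.instance Definition _ := GRing.isMonoidMorphism.Build _ _ (sp phi) sp_monoid.

Lemma pb_zmod : zmod_morphism (pb f).
Proof. by move=> A B; rewrite pb.unlock; apply: raddfB. Qed.
Lemma pb_monoid : monoid_morphism (pb f).
Proof. by split=> [|A B]; rewrite pb.unlock; [apply: rmorph1|apply: rmorphM]. Qed.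
HB.instance Definition _ := GRing.isZmodMorphism.Build _ _ (pb f) pb_zmod.
HB.instance Definition _ := GRing.isMonoidMorphism.Build _ _ (pb f) pb_monoid.

Lemma sgC c : sg P c%:MP = c%:MP.
Proof. by rewrite sg.unlock /subst mmapC. Qed.
Lemma spC c : sp phi c%:MP = c%:MP.
Proof. by rewrite sp.unlock /subst mmapC. Qed.
Lemma pbC c : pb f c%:MP = c%:MP.
Proof. by rewrite pb.unlock mmapC. Qed.
Lemma sgX i k : sg P 'X_(mxvec_index i k) = generic_pt P i k.
Proof. by rewrite sg.unlock /subst mmapXU mxvecE. Qed.
Lemma spX i k : sp phi 'X_(mxvec_index i k) = phi i k.
Proof. by rewrite sp.unlock /subst mmapXU mxvecE. Qed.
Lemma pbX i : pb f 'X_i = f i.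
Proof. by rewrite pb.unlock mmapXU. Qed.
Lemma sgZ c G : sg P (c *: G) = c *: sg P G.
Proof. by rewrite -!mul_mpolyC rmorphM /= sgC. Qed.
Lemma spZ c G : sp phi (c *: G) = c *: sp phi G.
Proof. by rewrite -!mul_mpolyC rmorphM /= spC. Qed.
Lemma pbZ c G : pb f (c *: G) = c *: pb f G.
Proof. by rewrite -!mul_mpolyC rmorphM /= pbC. Qed.

Lemma pb_homog d k A : (forall i, f i \is d.-homog) -> A \is k.-homog -> pb f A \is (d * k)%N.-homog.
Proof. by move=> hf hA; rewrite pb.unlock; apply: mmap_dhomog. Qed.

Lemma sp_homog (dg e : 'I_n.+1 -> nat) G : (forall i k, phi i k \is (dg i).-homog) ->
  multihomog e G -> sp phi G \is (\sum_i e i * dg i)%N.-homog.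
Proof.
move=> hphi hG; rewrite sp.unlock /subst /mmap big_seq; apply: rpred_sum => m mG.
rewrite mul_mpolyC; apply: rpredZ; rewrite /mmap1 prod_mxvec.
elim/big_rec2: _ => [|i x y _ IH]; first exact: dhomog1.
apply: dhomogM => //; rewrite -(hG m mG i) big_distrl /=.
elim/big_rec2: _ => [|k u v _ IH']; first exact: dhomog1.
by apply: dhomogM => //; rewrite mxvecE; have := dhomogMn (m (mxvec_index i k)) (hphi i k); rewrite [(dg i * _)%N]mulnC.
Qed.

End Restrictions.

Section GenericPoint.
Variables (K : closedFieldType) (n : nat) (P : 'I_n -> 'rV[K]_3).
Local Notation T := {mpoly K[n.+1 * 3]}.
Local Notation R := {mpoly K[3]}.
Local Notation S := {mpoly K[2]}.
Implicit Types (e : 'I_n.+1 -> nat) (G H : T) (z : 'M[K]_(n.+1, 3)).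

Definition genm (A : comNzRingType) (f : K -> A) (v : 'I_3 -> A) : 'M[A]_(n.+1, 3) :=
  \matrix_(i, k) if unlift ord0 i is Some j then cross (fun l => f (P j 0 l)) v k else v k.

Lemma genm0 (A : comNzRingType) (f : K -> A) v k : genm f v ord0 k = v k.
Proof. by rewrite mxE unlift_none. Qed.

Lemma genmS (A : comNzRingType) (f : K -> A) v j k :
  genm f v (lift ord0 j) k = cross (fun l => f (P j 0 l)) v k.
Proof. by rewrite mxE liftK. Qed.

Lemma generic_ptE : generic_pt P = genm (@mpolyC 3 K) (fun k => 'X_k).
Proof.
apply/matrixP => i k; rewrite !mxE; case: (unlift ord0 i) => // j.
by rewrite /cross !mul_mpolyC; congr (_ - _ *: 'X_ _); rewrite mul_mpolyC.
Qed.

Lemma genm_map (A B : comNzRingType) (f : K -> A) (v : 'I_3 -> A) (g : {rmorphism A -> B}) i k :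
  g (genm f v i k) = genm (g \o f) (g \o v) i k.
Proof.
rewrite !mxE; case: (unlift ord0 i) => // j.
by rewrite /cross rmorphB !rmorphM.
Qed.

Lemma rmorph_sg (A : comNzRingType) (g : {rmorphism R -> A}) G :
  g (sg P G) = mmap (g \o @mpolyC 3 K) (mxvec (genm (g \o @mpolyC 3 K) (fun k => g 'X_k)) 0) G.
Proof.
rewrite sg.unlock /subst rmorph_mmap; apply: eq_mmap => // x /=.
case/mxvec_indexP: x => i k; rewrite !mxvecE generic_ptE.
exact: (genm_map (@mpolyC 3 K) (fun k => 'X_k) g).
Qed.

Lemma meval_sg (x : 'I_3 -> K) G : (sg P G).@[x] = evpt (genm idfun x) G.
Proof.
rewrite (rmorph_sg (meval x)) /evpt /meval; apply: eq_mmap => [c|l] /=; first exact: mevalC.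
case/mxvec_indexP: l => i k; rewrite !mxvecE !mxE; case: (unlift ord0 i) => [j|].
  by rewrite /cross /= !mevalXU !mevalC.
by rewrite mevalXU.
Qed.

(** The line computed from the plane point f is P_j x f, which is row j of [phi] times [g j]; every
    degree of [G] in that row therefore contributes a factor [g j]. *)
Lemma pb_sg (phi : 'M[S]_(n.+1, 3)) (g : 'I_n -> S) e G : multihomog e G ->
  (forall j k, cross (fun l => (P j 0 l)%:MP) (phi ord0) k = g j * phi (lift ord0 j) k) ->
  pb (phi ord0) (sg P G) = (\prod_j g j ^+ e (lift ord0 j)) * sp phi G.
Proof.
move=> hG hg; rewrite (rmorph_sg (pb (phi ord0))) sp.unlock /subst.
rewrite (mmap_rowscale _ (Z := phi) (c := fun i => if unlift ord0 i is Some j then g j else 1) hG).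
  rewrite big_ord_recl unlift_none expr1n mul1r; congr (_ * _).
    by apply: eq_bigr => j _; rewrite liftK.
  by apply: eq_mmap => // c /=; apply: pbC.
move=> i k; rewrite mxE; case: (unliftP ord0 i) => [j|] -> /=; last by rewrite pbX mul1r.
by rewrite -hg /cross /= !pbX !pbC.
Qed.

End GenericPoint.

(** * Points of X away from and over the blown-up points *)

Section Points.
Variables (K : closedFieldType) (n : nat) (P : 'I_n -> 'rV[K]_3).
Hypothesis P_neq0 : forall j, P j != 0.
Hypothesis P_distinct : forall j j', proj_eq (P j) (P j') -> j = j'.
Local Notation T := {mpoly K[n.+1 * 3]}.
Local Notation R := {mpoly K[3]}.
Local Notation S := {mpoly K[2]}.
Implicit Types (e : 'I_n.+1 -> nat) (G H : T) (z : 'M[K]_(n.+1, 3)).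

Lemma row_dot m (z : 'M[K]_(m, 3)) i (v : 'rV[K]_3) :
  row i z *m v^T = 0 -> dot (z i) (v 0) = 0.
Proof.
move=> /matrixP/(_ 0 0); rewrite !mxE => h; rewrite -[RHS]h /dot; apply: eq_bigr => k _.
by rewrite !mxE.
Qed.

Lemma dot_row m (z : 'M[K]_(m, 3)) i (v : 'rV[K]_3) :
  dot (z i) (v 0) = 0 -> row i z *m v^T = 0.
Proof.
move=> h; apply/matrixP => a b; rewrite !ord1 [LHS]mxE [RHS]mxE -[RHS]h /dot; apply: eq_bigr => k _.
by rewrite !mxE.
Qed.

Lemma row_neq0 m (z : 'M[K]_(m, 3)) i : row i z != 0 -> exists k, z i k != 0.
Proof.
move=> zi; apply/existsP; rewrite -negb_forall; apply: contraNN zi => /forallP h.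
by apply/eqP/rowP => k; rewrite !mxE; apply/eqP/h.
Qed.

Lemma prop_cross (u v w : 'I_3 -> K) k0 l0 : dot u w = 0 -> dot v w = 0 ->
  w k0 != 0 -> cross u v l0 != 0 -> exists c, c != 0 /\ forall k, w k = c * cross u v k.
Proof.
move=> uw vw wk cl.
have E k : cross w (cross u v) k = 0 by rewrite cross_crossr uw vw !mulr0 subrr.
have EE k l : w k * cross u v l = w l * cross u v k.
  have := (E 0, E 1, E 2%:R); rewrite !crossE => -[[/eqP]].
  rewrite subr_eq0 => /eqP e0 /eqP; rewrite subr_eq0 => /eqP e1 /eqP; rewrite subr_eq0 => /eqP e2.
  by case: (ord3P k) (ord3P l) => -> [] ->; rewrite !crossE ?e0 ?e1 ?e2.
have wE k : w k = w l0 / cross u v l0 * cross u v k by rewrite mulrAC -EE mulfK.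
exists (w l0 / cross u v l0); split=> //.
by apply: contraNneq wk => e; rewrite wE e mul0r.
Qed.

Lemma cross_eq0_prop (u v : 'I_3 -> K) k0 l0 : (forall k, cross u v k = 0) ->
  u k0 != 0 -> v l0 != 0 -> exists c, c != 0 /\ forall k, v k = c * u k.
Proof.
move=> E uk vl.
have EE k l : u k * v l = u l * v k.
  have := (E 0, E 1, E 2%:R); rewrite !crossE => -[[/eqP]].
  rewrite subr_eq0 => /eqP e0 /eqP; rewrite subr_eq0 => /eqP e1 /eqP; rewrite subr_eq0 => /eqP e2.
  by case: (ord3P k) (ord3P l) => -> [] ->; rewrite ?e0 ?e1 ?e2.
have vE k : v k = v k0 / u k0 * u k by rewrite mulrAC [v k0 * _]mulrC EE mulrAC divff ?mul1r.
exists (v k0 / u k0); split=> //.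
by apply: contraNneq vl => e; rewrite vE e mul0r.
Qed.

Lemma not_over z j : blowup_pt P z -> ~ proj_eq (row ord0 z) (P j) ->
  exists k, cross (P j 0) (z ord0) k != 0.
Proof.
move=> [z0 _] np; apply/existsP; rewrite -negb_forall; apply/negP => /forallP E.
have [k0 pk] : exists k, P j 0 k != 0.
  by apply: (@row_neq0 _ (P j) 0); apply: contraNneq (P_neq0 j) => /rowP h; apply/eqP/rowP => k; have := h k; rewrite !mxE.
have [l0 zl] := row_neq0 (z0 ord0).
have [c [c0 cE]] := cross_eq0_prop (fun k => eqP (E k)) pk zl.
by apply: np; exists c; split=> //; apply/rowP => k; rewrite !mxE cE.
Qed.

Lemma line_away z j k : blowup_pt P z -> cross (P j 0) (z ord0) k != 0 ->
  exists c, c != 0 /\ forall k, z (lift ord0 j) k = c * cross (P j 0) (z ord0) k.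
Proof.
move=> [z0 zl] ck; have [k0 zk] := row_neq0 (z0 (lift ord0 j)).
have [/row_dot d1 d2] := zl j; have {}d2 : dot (z (lift ord0 j)) (z ord0) = 0.
  by rewrite -[RHS](row_dot d2) /dot; apply: eq_bigr => i _; rewrite mxE.
by apply: (prop_cross _ _ zk ck); rewrite dotC.
Qed.

Lemma evpt_away z e G : blowup_pt P z -> multihomog e G ->
  (forall j, ~ proj_eq (row ord0 z) (P j)) ->
  (evpt z G == 0) = ((sg P G).@[z ord0] == 0).
Proof.
move=> zX hG aw; rewrite meval_sg.
have [c Hc] : exists c : 'I_n -> K, forall j, c j != 0 /\ forall k, z (lift ord0 j) k = c j * cross (P j 0) (z ord0) k.
  apply: (fin_all_exists (P := fun j c => c != 0 /\ forall k, z (lift ord0 j) k = c * cross (P j 0) (z ord0) k)) => j; have [k ck] := not_over zX (aw j).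
  exact: line_away zX ck.
rewrite /evpt /meval (mmap_rowscale _ (Z := genm P idfun (z ord0)) (c := fun i => if unlift ord0 i is Some j then c j else 1) hG).
  rewrite mulf_eq0 [X in X || _](_ : _ = false) //; apply/negP => /eqP.
  rewrite big_ord_recl unlift_none expr1n mul1r => /eqP; apply/negP/prodf_neq0 => j _.
  by rewrite liftK expf_neq0 //; case: (Hc j).
move=> i k; rewrite mxE; case: (unliftP ord0 i) => [j|] -> /=; last by rewrite mul1r.
by case: (Hc j) => _ ->.
Qed.

End Points.

Section OverPoint.
Variables (K : closedFieldType) (n : nat) (P : 'I_n -> 'rV[K]_3).
Hypothesis P_neq0 : forall j, P j != 0.
Hypothesis P_distinct : forall j j', proj_eq (P j) (P j') -> j = j'.
Variable M : 'I_n -> 'M[K]_3.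
Hypothesis M_unit : forall j, M j \in unitmx.
Hypothesis M_row : forall j, M j 0 = P j 0 :> ('I_3 -> K).
Local Notation T := {mpoly K[n.+1 * 3]}.
Local Notation R := {mpoly K[3]}.
Local Notation S := {mpoly K[2]}.
Implicit Types (e : 'I_n.+1 -> nat) (G H : T) (z : 'M[K]_(n.+1, 3)).

Definition tangent j (q : 'rV[K]_2) : 'I_3 -> K :=
  fun k => q 0 0 * M j 1 k + q 0 1 * M j 2%:R k.

(** The point of E_j with tangent direction [q]: its j-th line is the tangent line, and the other
    lines join P_j' to P_j. *)
Definition over_pt j (q : 'rV[K]_2) : 'M[K]_(n.+1, 3) :=
  \matrix_(i, k) if unlift ord0 i is Some j' then
     if j' == j then cross (P j 0) (tangent j q) k else cross (P j' 0) (P j 0) k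
   else P j 0 k.

(** Substituting P_j + x v turns the j-th line into P_j x (P_j + x v) = x (P_j x v), so a power of x
    with exponent the j-th degree splits off. Setting x = 0 in the rest evaluates [G] on E_j: the
    jet coefficient of that order is the restriction of [G] to E_j. *)
Lemma jet_sg_over j e G (q : 'rV[K]_2) : multihomog e G ->
  ordge (M j) (e (lift ord0 j)) (sg P G) /\
  ((jet (M j) (sg P G))`_(e (lift ord0 j))).@[q 0] = evpt (over_pt j q) G.
Proof.
move=> hG.
pose D k : S := cross (fun l => (P j 0 l)%:MP) (fun l => M j 1 l *: 'X_0 + M j 2%:R l *: 'X_1) k.
pose CC : {rmorphism K -> {poly S}} := polyC \o @mpolyC 2 K.
pose Z : 'M[{poly S}]_(n.+1, 3) := genm P CC (jet_arg (M j)).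
pose Z' : 'M[{poly S}]_(n.+1, 3) :=
  \matrix_(i, k) if i == lift ord0 j then (D k)%:P else Z i k.
pose Y := mmap CC (mxvec Z' 0) G.
have E : jet (M j) (sg P G) = 'X^(e (lift ord0 j)) * Y.
  rewrite (rmorph_sg P (jet (M j))).
  transitivity (mmap CC (mxvec Z 0) G).
    apply: eq_mmap => [c|x]; first exact: jetC.
    case/mxvec_indexP: x => i k; rewrite !mxvecE !mxE; case: (unlift ord0 i) => [j'|].
      by rewrite /cross /= !jetC !jetXi.
    exact: jetXi.
  rewrite (mmap_rowscale CC (Z := Z') (c := fun i => if i == lift ord0 j then 'X else 1) hG).
    congr (_ * _); rewrite (bigD1 (lift ord0 j)) //= eqxx big1 ?mulr1 // => i /negPf ->.
    by rewrite expr1n.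
  move=> i k; rewrite [Z' i k]mxE; case: eqP => [->|_]; last by rewrite mul1r.
  rewrite genmS /jet_arg /D /cross /CC /= M_row rmorphB !rmorphM /= -!mul_polyC; ring.
split=> [a lt|]; rewrite E coefXnM ?lt // ltnn subnn.
rewrite -horner_coef0 -/(horner_eval 0 Y) /Y rmorph_mmap rmorph_mmap.
apply: eq_mmap => [c|x] /=; first by rewrite /horner_eval hornerC mevalC.
case/mxvec_indexP: x => i k; rewrite !mxvecE !mxE.
case: (unliftP ord0 i) => [j'|] ->; last first.
  rewrite (negPf (neq_lift _ _)).
  by rewrite /= /jet_arg /horner_eval !hornerE ?mulr0 ?addr0 mevalC M_row.
have -> : (lift ord0 j' == lift ord0 j) = (j' == j) by exact: (inj_eq lift_inj).
case: eqP => _.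
  rewrite /horner_eval hornerC /D /cross /tangent mevalB !mevalM !mevalC !mevalD !mevalZ !mevalXU.
  by rewrite ![M j _ _ * q 0 _]mulrC.
rewrite /cross /jet_arg /CC /horner_eval /= !hornerE ?mulr0 ?addr0.
by rewrite mevalB !mevalM !mevalC M_row.
Qed.

Lemma frame_indep j (q : 'rV[K]_2) (x : K) :
  (forall k, x * P j 0 k + tangent j q k = 0) -> q = 0.
Proof.
move=> h; have : (\row_i (if i == 0 then x else if i == 1 then q 0 0 else q 0 1)) *m M j = 0.
  apply/rowP => k; rewrite !mxE sum3E !mxE /= -[RHS](h k) /tangent -M_row; ring.
move/(congr1 (mulmx^~ (invmx (M j)))); rewrite mulmxK // mul0mx => /rowP e.
apply/rowP => i; rewrite mxE; have := e 1; have := e 2%:R; rewrite !mxE /= => e2 e1.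
by case: (ord2P i) => ->.
Qed.

Lemma cross_PP j j' : j' != j -> exists k, cross (P j' 0) (P j 0) k != 0.
Proof.
move=> ne; apply/existsP; rewrite -negb_forall; apply/negP => /forallP E.
have nz i : exists k, P i 0 k != 0.
  apply/existsP; rewrite -negb_forall; apply: contraNN (P_neq0 i) => /forallP h.
  by apply/eqP/rowP => k; rewrite !mxE; apply/eqP/h.
have [k0 pk] := nz j'; have [l0 pl] := nz j.
have [c [c0 cE]] := cross_eq0_prop (fun k => eqP (E k)) pk pl.
case/eqP: ne; apply/esym/P_distinct; exists c; split=> //.
by apply/rowP => k; rewrite !mxE cE.
Qed.

Lemma cross_tangent j (q : 'rV[K]_2) : q != 0 -> exists k, cross (P j 0) (tangent j q) k != 0.
Proof.
move=> q0; apply/existsP; rewrite -negb_forall; apply/negP => /forallP E.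
have [k0 pk] : exists k, P j 0 k != 0.
  apply/existsP; rewrite -negb_forall; apply: contraNN (P_neq0 j) => /forallP h.
  by apply/eqP/rowP => k; rewrite !mxE; apply/eqP/h.
have [l0 tl] : exists l, tangent j q l != 0.
  apply/existsP; rewrite -negb_forall; apply: contraNN q0 => /forallP h.
  by apply/eqP; apply: (@frame_indep j q 0) => k; rewrite mul0r add0r; apply/eqP/h.
have [c [c0 cE]] := cross_eq0_prop (fun k => eqP (E k)) pk tl.
case/eqP: q0; apply: (@frame_indep j q (- c)) => k; rewrite cE; ring.
Qed.

Lemma over_pt_blowup j (q : 'rV[K]_2) : q != 0 -> blowup_pt P (over_pt j q).
Proof.
move=> q0; have nzrow m (z : 'M[K]_(m, 3)) i k : z i k != 0 -> row i z != 0.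
  by apply: contraNneq => /rowP/(_ k); rewrite !mxE => ->.
split=> [i|j'].
  case: (unliftP ord0 i) => [j'|] ->; last first.
    apply: contraNneq (P_neq0 j) => /rowP h; apply/eqP/rowP => k; have := h k.
    by rewrite !mxE unlift_none.
  have [->|ne] := eqVneq j' j.
    by have [k hk] := cross_tangent j q0; apply: (nzrow _ _ _ k); rewrite mxE liftK eqxx.
  by have [k hk] := cross_PP ne; apply: (nzrow _ _ _ k); rewrite mxE liftK (negPf ne).
have E k : over_pt j q ord0 k = P j 0 k by rewrite mxE unlift_none.
have dE v w : (forall k, over_pt j q (lift ord0 j') k = cross v w k) ->
   dot (over_pt j q (lift ord0 j')) v = 0 /\ dot (over_pt j q (lift ord0 j')) w = 0.
  move=> h; split.
    transitivity (dot v (cross v w)); last exact: crossl.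
    by rewrite dotC; apply: eq_bigr => k _; rewrite h.
  transitivity (dot w (cross v w)); last exact: crossr.
  by rewrite dotC; apply: eq_bigr => k _; rewrite h.
have rowE : dot (over_pt j q (lift ord0 j')) (row ord0 (over_pt j q) 0)
    = dot (over_pt j q (lift ord0 j')) (P j 0).
  by apply: eq_bigr => k _; rewrite [row _ _ _ _]mxE E.
have [ejj|ne] := eqVneq j' j.
  have [|d1 _] := dE (P j 0) (tangent j q).
    by move=> k; rewrite mxE liftK ejj eqxx.
  split; apply: dot_row; last by rewrite rowE.
  by have -> : P j' = P j by rewrite ejj.
have [|d1 d2] := dE (P j' 0) (P j 0).
  by move=> k; rewrite mxE liftK (negPf ne).
by split; apply: dot_row; rewrite ?rowE.
Qed.

Lemma over_ptP z j : blowup_pt P z -> proj_eq (row ord0 z) (P j) ->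
  exists2 q : 'rV[K]_2, q != 0 & exists c : 'I_n.+1 -> K,
    (forall i, c i != 0) /\ forall i k, z i k = c i * over_pt j q i k.
Proof.
move=> zX [c0 [c0n z0E]].
have zE k : z ord0 k = c0 * P j 0 k by have /rowP/(_ k) := z0E; rewrite !mxE.
have [zn zl] := zX; have [/row_dot djP _] := zl j.
have [k0 pk] : exists k, P j 0 k != 0.
  apply/existsP; rewrite -negb_forall; apply: contraNN (P_neq0 j) => /forallP h.
  by apply/eqP/rowP => k; rewrite !mxE; apply/eqP/h.
pose u l : K := (l == k0)%:R / P j 0 k0.
have dPu : dot (P j 0) u = 1.
  rewrite /dot (bigD1 k0) //= /u eqxx mul1r divff // big1 ?addr0 // => l /negPf ->.
  by rewrite mul0r mulr0.
(* As u.P_j = 1 and the line passes through P_j, P_j x (l x u) = l: [w] is a second point of the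
   line, and its coordinates in the frame give the tangent direction. *)
pose w := cross (z (lift ord0 j)) u.
pose v : 'rV[K]_3 := (\row_k w k) *m invmx (M j).
pose q := pt2 (v 0 1) (v 0 2%:R).
have wE k : w k = v 0 0 * P j 0 k + tangent j q k.
  have : v *m M j = \row_k w k by rewrite mulmxKV.
  move=> /rowP/(_ k); rewrite !mxE sum3E => <-; rewrite -M_row /tangent /q !mxE /=; ring.
have crE k : z (lift ord0 j) k = cross (P j 0) (tangent j q) k.
  have : cross (P j 0) w k = z (lift ord0 j) k.
    by rewrite /w cross_crossr dotC dPu djP mulr1 mulr0 subr0.
  move=> <-; rewrite /cross !wE; ring.
have q0 : q != 0.
  have [l zl0] := row_neq0 (zn (lift ord0 j)); apply: contraNneq zl0 => e.
  by rewrite crE /cross /tangent e !mxE !mul0r !addr0 !mulr0 subrr.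
exists q => //.
have Hc j' : exists c, c != 0 /\ forall k, z (lift ord0 j') k = c * over_pt j q (lift ord0 j') k.
  have [->|ne] := eqVneq j' j.
    by exists 1; split=> [|k]; rewrite ?oner_eq0 // mul1r mxE liftK eqxx crE.
  have [k hk] := cross_PP ne.
  have ck : cross (P j' 0) (z ord0) k != 0.
    have -> : cross (P j' 0) (z ord0) k = c0 * cross (P j' 0) (P j 0) k.
      by rewrite /cross !zE; ring.
    by rewrite mulf_neq0.
  have [c [cn cE]] := line_away zX ck; exists (c * c0); split=> [|l]; first by rewrite mulf_neq0.
  rewrite cE mxE liftK (negPf ne) /cross !zE; ring.
have [c cE] := fin_all_exists Hc.
exists (fun i => if unlift ord0 i is Some j' then c j' else c0); split=> [i|i k].
  by case: (unlift ord0 i) => // j'; case: (cE j').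
case: (unliftP ord0 i) => [j'|] ->; first by rewrite (proj2 (cE j')).
by rewrite zE mxE unlift_none.
Qed.

Lemma evpt_scale z z' (c : 'I_n.+1 -> K) e G : multihomog e G -> (forall i, c i != 0) ->
  (forall i k, z i k = c i * z' i k) -> (evpt z G == 0) = (evpt z' G == 0).
Proof.
move=> hG cn zE; rewrite /evpt /meval (mmap_rowscale _ hG zE) mulf_eq0.
by rewrite [X in X || _](_ : _ = false) //; apply/negbTE/prodf_neq0 => i _; rewrite expf_neq0.
Qed.

Lemma over_dec z : blowup_pt P z ->
  (exists j, proj_eq (row ord0 z) (P j)) \/ (forall j, ~ proj_eq (row ord0 z) (P j)).
Proof.
move=> [z0 _].
have [/existsP [j /forallP E]|/existsPn E] := boolP [exists j, [forall k, cross (P j 0) (z ord0) k == 0]].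
  left; exists j; have [l0 zl] := row_neq0 (z0 ord0).
  have [k0 pk] : exists k, P j 0 k != 0.
    apply/existsP; rewrite -negb_forall; apply: contraNN (P_neq0 j) => /forallP h.
    by apply/eqP/rowP => k; rewrite !mxE; apply/eqP/h.
  have [c [c0 cE]] := cross_eq0_prop (fun k => eqP (E k)) pk zl.
  by exists c; split=> //; apply/rowP => k; rewrite !mxE cE.
right=> j [c [c0 /rowP zE]]; have /forallPn [k /negP] := E j; apply; apply/eqP.
have {}zE l : z ord0 l = c * P j 0 l by have := zE l; rewrite !mxE.
rewrite /cross !zE; ring.
Qed.

(** A [G] that vanishes at the generic point vanishes on all of X, which is the closure of a graph:
    off the E_j by evaluation in the plane, and on E_j because [G] restricts there to a coefficient
    of a zero jet. Hence denominators never vanish identically. *)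
Lemma evpt_sg_neq0 z e G : blowup_pt P z -> multihomog e G -> evpt z G != 0 -> sg P G != 0.
Proof.
move=> zX hG; apply: contraNneq => sG.
have [[j zj]|away] := over_dec zX; last first.
  by rewrite (evpt_away P_neq0 zX hG away) sG meval0.
have [q q0 [c [cn zE]]] := over_ptP zX zj.
rewrite (evpt_scale hG cn zE); have [_ <-] := jet_sg_over j q hG.
by rewrite sG rmorph0 coef0 meval0.
Qed.

Lemma evpt_eq z e G H : blowup_pt P z -> multihomog e G -> multihomog e H ->
  sg P G = sg P H -> evpt z G = evpt z H.
Proof.
move=> zX hG hH GH; apply/eqP; rewrite -subr_eq0 -mevalB -/(evpt z _).
apply/negPn/negP => ne; have hGH : multihomog e (G - H).
  by rewrite -scaleN1r; apply: mhD => //; apply: mhZ.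
by have := evpt_sg_neq0 zX hGH ne; rewrite rmorphB /= GH subrr eqxx.
Qed.

Lemma evptM z G H : evpt z (G * H) = evpt z G * evpt z H.
Proof. exact: mevalM. Qed.

Lemma evpt_lin z i (c : 'I_3 -> K) :
  evpt z (\sum_k c k *: 'X_(mxvec_index i k)) = \sum_k c k * z i k.
Proof.
rewrite /evpt rmorph_sum; apply: eq_bigr => k _ /=.
by rewrite mevalZ mevalXU mxvecE.
Qed.

Lemma sg_lin0 (c : 'I_3 -> K) :
  sg P (\sum_k c k *: 'X_(mxvec_index ord0 k)) = \sum_k c k *: 'X_k.
Proof.
by rewrite rmorph_sum; apply: eq_bigr => k _ /=; rewrite sgZ sgX generic_ptE genm0.
Qed.

Lemma sg_linS j (c : 'I_3 -> K) :
  sg P (\sum_k c k *: 'X_(mxvec_index (lift ord0 j) k))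
  = \sum_k c k *: cross (fun l => (P j 0 l)%:MP) (fun l => 'X_l) k.
Proof.
by rewrite rmorph_sum; apply: eq_bigr => k _ /=; rewrite sgZ sgX generic_ptE genmS.
Qed.

(* The linear form c . (P_j x X) in the coordinates of the plane. *)
Definition crossform j (c : 'I_3 -> K) : 'I_3 -> K := fun l => - cross (P j 0) c l.

Lemma crossformE j (c : 'I_3 -> K) (A : comNzRingType) (f : {rmorphism K -> A}) (v : 'I_3 -> A) :
  \sum_k f (crossform j c k) * v k = \sum_k f (c k) * cross (fun l => f (P j 0 l)) v k.
Proof.
rewrite !sum3E /crossform !crossE !rmorphN !rmorphB !rmorphM; ring.
Qed.

Lemma sg_crossform j (c : 'I_3 -> K) :
  sg P (\sum_k crossform j c k *: 'X_(mxvec_index ord0 k))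
  = sg P (\sum_k c k *: 'X_(mxvec_index (lift ord0 j) k)).
Proof.
rewrite sg_lin0 sg_linS; have := @crossformE j c R (@mpolyC 3 K) (fun k => 'X_k).
by under eq_bigr do rewrite mul_mpolyC; under [X in _ = X -> _]eq_bigr do rewrite mul_mpolyC.
Qed.

Lemma sg_coords k A : A \is k.-homog ->
  exists2 G, multihomog (fun i => if i == ord0 then k else 0%N) G & sg P G = A.
Proof.
move=> hA; exists (\sum_(m <- msupp A) A@_m *: \prod_l 'X_(mxvec_index ord0 l) ^+ m l).
  rewrite big_seq; apply: mh_sum => m mA; apply: mhZ.
  have := mh_prod (r := index_enum 'I_3) (fun l => @mhXn K n _ _ (m l) (@mhX K n ord0 l)).
  apply: mh_ext => i; case: eqP => _; last by rewrite big1 // => l _; rewrite muln0.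
  by under eq_bigr do rewrite muln1; rewrite -mdegE; apply: (dhomog_mf hA).
rewrite rmorph_sum [RHS](mpolyE A); apply: eq_bigr => m _ /=; rewrite sgZ; congr (_ *: _).
rewrite rmorph_prod mpolyXE_id; apply: eq_bigr => l _ /=.
by rewrite rmorphXn /= sgX generic_ptE genm0.
Qed.

(** Iterating [ordge_decomp] replaces c units of multiplicity by degree c in the coordinates of l_j:
    the form becomes a section of kL + c(L - E_j). *)
Lemma ordge_multihomog j c k A : A \is (k + c)%N.-homog -> ordge (M j) c A ->
  exists2 G, multihomog (fun i => if i == ord0 then k else if i == lift ord0 j then c else 0)%N G
           & sg P G = A.
Proof.
elim: c A => [|c IH] A hA oA.
  have [G hG GA] := sg_coords hA; exists G => //.
  by apply: mh_ext hG => i; rewrite addn0; case: (i == ord0) => //; case: (i == _).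
rewrite addnS in hA; have [A' [hA' ->]] := ordge_decomp (M_unit j) hA oA.
have HG l : exists G, multihomog (fun i => if i == ord0 then k else if i == lift ord0 j then c else 0)%N G
           /\ sg P G = A' l.
  by have [h1 h2] := hA' l; have [G hG GA] := IH _ h1 h2; exists G.
have [G HG'] := fin_all_exists HG.
exists (\sum_l 'X_(mxvec_index (lift ord0 j) l) * G l).
  apply: mh_sum => l _; have [hG _] := HG' l; apply: mh_ext (mhM (@mhX K n (lift ord0 j) l) hG) => i.
  case: (unliftP ord0 i) => [j'|] ->; last by rewrite eqxx (negPf (neq_lift _ _)).
  by rewrite [lift ord0 j' == ord0]eq_sym (negPf (neq_lift _ _)) (inj_eq lift_inj); case: eqP.
rewrite rmorph_sum; apply: eq_bigr => l _ /=; rewrite rmorphM /= sgX generic_ptE genmS.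
by rewrite M_row (proj2 (HG' l)).
Qed.

End OverPoint.

(** * Line bundles on X by their multidegrees *)

Section LocalSections.
Variables (K : closedFieldType) (n : nat) (P : 'I_n -> 'rV[K]_3).
Hypothesis P_neq0 : forall j, P j != 0.
Hypothesis P_distinct : forall j j', proj_eq (P j) (P j') -> j = j'.
Variable M : 'I_n -> 'M[K]_3.
Hypothesis M_unit : forall j, M j \in unitmx.
Hypothesis M_row : forall j, M j 0 = P j 0 :> ('I_3 -> K).
Local Notation T := {mpoly K[n.+1 * 3]}.
Local Notation R := {mpoly K[3]}.
Local Notation S := {mpoly K[2]}.
Implicit Types (G H : T) (z : 'M[K]_(n.+1, 3)) (e : 'I_n.+1 -> int) (f : ratfun K 3).

(* The stalk at [z] of the line bundle of multidegree [e] on X, i.e. of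
   O_X(e_0 L + \sum_j e_j (L - E_j)). *)
Definition sec e z f := exists u v G H,
  [/\ multihomog u G, multihomog v H, forall i, (u i)%:Z - (v i)%:Z = e i,
      evpt z H != 0 & f = (sg P G)%:F / (sg P H)%:F].

(** The local generators at [z] of the line bundle of multidegree [e]. *)
Definition sunit e z f := exists u v G H,
  [/\ multihomog u G, multihomog v H, forall i, (u i)%:Z - (v i)%:Z = e i,
      evpt z G != 0 /\ evpt z H != 0 & f = (sg P G)%:F / (sg P H)%:F].

Lemma sunit_sec e z f : sunit e z f -> sec e z f.
Proof. by move=> [u [v [G [H [hG hH uv [G0 H0] fE]]]]]; exists u, v, G, H. Qed.

Lemma sec_ext e e' z f : e =1 e' -> sec e z f -> sec e' z f.
Proof. by move=> ee [u [v [G [H [hG hH uv H0 fE]]]]]; exists u, v, G, H; split=> // i; rewrite -ee. Qed.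

Lemma sunit_ext e e' z f : e =1 e' -> sunit e z f -> sunit e' z f.
Proof. by move=> ee [u [v [G [H [hG hH uv H0 fE]]]]]; exists u, v, G, H; split=> // i; rewrite -ee. Qed.

Lemma sec_mul e e' z f f' : sec e z f -> sec e' z f' -> sec (fun i => e i + e' i) z (f * f').
Proof.
move=> [u [v [G [H [hG hH uv H0 ->]]]]] [u' [v' [G' [H' [hG' hH' uv' H0' ->]]]]].
exists (fun i => u i + u' i)%N, (fun i => v i + v' i)%N, (G * G'), (H * H'); split.
- exact: mhM.
- exact: mhM.
- by move=> i; rewrite -uv -uv' !PoszD; ring.
- by rewrite evptM mulf_neq0.
- by rewrite tofrac_divM !rmorphM.
Qed.

Lemma sunit_mul e e' z f f' : sunit e z f -> sunit e' z f' -> sunit (fun i => e i + e' i) z (f * f').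
Proof.
move=> [u [v [G [H [hG hH uv [G0 H0] ->]]]]] [u' [v' [G' [H' [hG' hH' uv' [G0' H0'] ->]]]]].
exists (fun i => u i + u' i)%N, (fun i => v i + v' i)%N, (G * G'), (H * H'); split.
- exact: mhM.
- exact: mhM.
- by move=> i; rewrite -uv -uv' !PoszD; ring.
- by rewrite !evptM !mulf_neq0.
- by rewrite tofrac_divM !rmorphM.
Qed.

Lemma sunit_inv e z f : sunit e z f -> sunit (fun i => - e i) z f^-1.
Proof.
move=> [u [v [G [H [hG hH uv [G0 H0] ->]]]]]; exists v, u, H, G; split=> //.
- by move=> i; rewrite -uv opprB.
- by rewrite invf_div.
Qed.

Lemma evpt1 z : evpt z 1 = 1. Proof. exact: meval1. Qed.

Lemma sunit1 z : sunit (fun=> 0) z 1.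
Proof.
exists (fun=> 0%N), (fun=> 0%N), 1, 1; split; rewrite ?evpt1 ?oner_eq0 //; try exact: mh1.
by rewrite rmorph1 tofrac1 divr1.
Qed.

Lemma sunit_poly u z G : multihomog u G -> evpt z G != 0 -> sunit (fun i => (u i)%:Z) z (sg P G)%:F.
Proof.
move=> hG G0; exists u, (fun=> 0%N), G, 1; split; rewrite ?evpt1 ?oner_eq0 //; try exact: mh1.
  by move=> i; rewrite subr0.
by rewrite rmorph1 tofrac1 divr1.
Qed.

Lemma sunit_exp e z f k : sunit e z f -> sunit (fun i => k%:Z * e i) z (f ^+ k).
Proof.
move=> hf; elim: k => [|k IH].
  by apply: sunit_ext (sunit1 z) => i; rewrite mul0r.
rewrite exprS; apply: sunit_ext (sunit_mul hf IH) => i; rewrite -addn1 PoszD; ring.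
Qed.

Lemma sec_exp e z f k : sec e z f -> sec (fun i => k%:Z * e i) z (f ^+ k).
Proof.
move=> hf; elim: k => [|k IH].
  by apply: sec_ext (sunit_sec (sunit1 z)) => i; rewrite mul0r.
rewrite exprS; apply: sec_ext (sec_mul hf IH) => i; rewrite -addn1 PoszD; ring.
Qed.

Lemma row_lin_neq0 z i : blowup_pt P z -> exists c : 'I_3 -> K, \sum_k c k * z i k != 0.
Proof.
move=> [z0 _]; have [k0 zk] := row_neq0 (z0 i); exists (fun k => (k == k0)%:R).
rewrite (bigD1 k0) //= eqxx mul1r big1 ?addr0 // => k /negPf ->.
by rewrite mul0r.
Qed.

Lemma sunit_row z i : blowup_pt P z -> exists f, sunit (fun l => ((l == i) : nat)%:Z) z f.
Proof.
move=> zX; have [c hc] := row_lin_neq0 i zX; eexists; apply: sunit_poly; first exact: mh_lin.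
by rewrite evpt_lin; exact: hc.
Qed.

Lemma sunit_exists z e : blowup_pt P z -> exists f, sunit e z f.
Proof.
move=> zX.
have Hi i : exists f, sunit (fun l => e i * ((l == i) : nat)%:Z) z f.
  have [f hf] := sunit_row i zX; case: (e i) => k.
    by exists (f ^+ k); apply: sunit_exp.
  exists (f ^+ k.+1)^-1; apply: sunit_ext (sunit_inv (sunit_exp k.+1 hf)) => l.
  by rewrite NegzE mulNr.
have [F HF] := fin_all_exists Hi.
suff [g hg] : exists g, sunit (fun l => \sum_i e i * ((l == i) : nat)%:Z) z g.
  exists g; apply: sunit_ext hg => l; rewrite (bigD1 l) //= eqxx mulr1 big1 ?addr0 // => i ne.
  by rewrite eq_sym (negPf ne) mulr0.
elim: (index_enum _) => [|i r [g IH]].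
  by exists 1; apply: sunit_ext (sunit1 z) => l; rewrite big_nil.
by exists (F i * g); apply: sunit_ext (sunit_mul (HF i) IH) => l; rewrite big_cons.
Qed.

Lemma sunit_neq0 e z f : blowup_pt P z -> sunit e z f -> f != 0.
Proof.
move=> zX [u [v [G [H [hG hH _ [G0 H0] ->]]]]].
have sG := evpt_sg_neq0 P_neq0 P_distinct M_unit M_row zX hG G0.
have sH := evpt_sg_neq0 P_neq0 P_distinct M_unit M_row zX hH H0.
by apply: mulf_neq0; rewrite ?invr_eq0 tofrac_eq0.
Qed.

Lemma sec0 e z : blowup_pt P z -> sec e z 0.
Proof.
move=> zX; have [f hf] := sunit_exists e zX.
have h0 : sec (fun=> 0) z 0.
  exists (fun=> 0%N), (fun=> 0%N), 0, 1; split; rewrite ?evpt1 ?oner_eq0 //; try exact: mh1.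
    exact: mh0.
  by rewrite rmorph0 tofrac0 mul0r.
by have := sec_mul h0 (sunit_sec hf); rewrite mul0r; apply: sec_ext => i; rewrite add0r.
Qed.

(** The multidegree of -E_j, written as (L - E_j) - L. *)
Definition dv (j : 'I_n) (i : 'I_n.+1) : int := ((i == lift ord0 j) : nat)%:Z - ((i == ord0) : nat)%:Z.

(** The constant 1 is the section of O_X(E_j) with divisor E_j. As a quotient it is c.(P_j x X) over
    c.l_j, which have the same image at the generic point. *)
Lemma sec_dvN z j : blowup_pt P z -> sec (fun i => - dv j i) z 1.
Proof.
move=> zX; have [c hc] := row_lin_neq0 (lift ord0 j) zX.
pose G : T := \sum_k crossform P j c k *: 'X_(mxvec_index ord0 k).
pose H : T := \sum_k c k *: 'X_(mxvec_index (lift ord0 j) k).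
have eH : evpt z H != 0 by rewrite evpt_lin.
exists (fun l => (l == ord0) : nat), (fun l => (l == lift ord0 j) : nat), G, H; split=> //.
- exact: mh_lin.
- exact: mh_lin.
- by move=> i; rewrite opprB.
- rewrite /G sg_crossform divff // tofrac_eq0.
  exact: (evpt_sg_neq0 P_neq0 P_distinct M_unit M_row zX (@mh_lin K n _ _) eH).
Qed.

Lemma sec_dvP z j : blowup_pt P z -> ~ proj_eq (row ord0 z) (P j) -> sec (dv j) z 1.
Proof.
move=> zX nov; have [k0 ck] := not_over P_neq0 zX nov.
pose c (k : 'I_3) : K := (k == k0)%:R.
pose G : T := \sum_k c k *: 'X_(mxvec_index (lift ord0 j) k).
pose H : T := \sum_k crossform P j c k *: 'X_(mxvec_index ord0 k).
have eH : evpt z H != 0.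
  rewrite evpt_lin (@crossformE _ _ P j c K idfun (z ord0)) /= (bigD1 k0) //= {1}/c eqxx mul1r.
  rewrite big1 ?addr0 // => k /negPf; rewrite /c => ->; exact: mul0r.
exists (fun l => (l == lift ord0 j) : nat), (fun l => (l == ord0) : nat), G, H; split=> //.
- exact: mh_lin.
- exact: mh_lin.
- have sgH := evpt_sg_neq0 P_neq0 P_distinct M_unit M_row zX (@mh_lin K n _ _) eH.
  by rewrite /G -sg_crossform -/H divff // tofrac_eq0.
Qed.

Lemma sec_dvNn z j k : blowup_pt P z -> sec (fun i => - k%:Z * dv j i) z 1.
Proof.
by move=> zX; have := sec_exp k (sec_dvN j zX); rewrite expr1n; apply: sec_ext => i; rewrite mulrN mulNr.
Qed.

Lemma sec_dv z j (c : int) : blowup_pt P z -> ~ proj_eq (row ord0 z) (P j) ->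
  sec (fun i => c * dv j i) z 1.
Proof.
move=> zX nov; case: c => k.
  by have := sec_exp k (sec_dvP zX nov); rewrite expr1n.
by rewrite NegzE; apply: sec_dvNn.
Qed.

Lemma sec_sum1 z (p : pred 'I_n) (F : 'I_n -> 'I_n.+1 -> int) :
  (forall j, p j -> sec (F j) z 1) -> sec (fun i => \sum_(j | p j) F j i) z 1.
Proof.
move=> h; elim: (index_enum _) => [|j r IH].
  by apply: sec_ext (sunit_sec (sunit1 z)) => l; rewrite big_nil.
have [pj|pj] := boolP (p j).
  have := sec_mul (h j pj) IH; rewrite mulr1; apply: sec_ext => l.
  by rewrite big_cons pj.
by apply: sec_ext IH => l; rewrite big_cons (negPf pj).
Qed.

(* The multidegree of O_X(kL - \sum_j c_j E_j). *)
Definition tw (k : int) (c : 'I_n -> int) (i : 'I_n.+1) : int :=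
  if unlift ord0 i is Some j then c j else k - \sum_j c j.

Lemma twE k c i : tw k c i = k * ((i == ord0) : nat)%:Z + \sum_j c j * dv j i.
Proof.
rewrite /tw /dv; case: (unliftP ord0 i) => [j|] ->.
  have -> : (lift ord0 j == ord0) = false by rewrite eq_sym (negPf (neq_lift _ _)).
  rewrite mulr0 add0r (bigD1 j) //= eqxx subr0 mulr1 big1 ?addr0 // => j' ne.
  by rewrite (inj_eq lift_inj) eq_sym (negPf ne) subrr mulr0.
rewrite eqxx mulr1; congr (_ + _); rewrite -sumrN; apply: eq_bigr => j _.
by rewrite (negPf (neq_lift _ _)) sub0r mulrN1.
Qed.

(** Near a point over P_j the other exceptional curves are absent and 1 is a section of every
    multiple of them, so only the condition at P_j matters. For negative c_j the multiple -c_j E_j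
    is effective, and 1 is a section of it. *)
Lemma sec_loc z (k : nat) (c : 'I_n -> int) (A : R) : A \is k.-homog ->
  (forall j (c' : nat), c j = c' -> ordge (M j) c' A) -> blowup_pt P z ->
  sec (tw k c) z A%:F.
Proof.
move=> hA oA zX.
have A0 : sec (fun i => k%:Z * ((i == ord0) : nat)%:Z) z A%:F.
  have [G hG <-] := sg_coords P hA; exists (fun i => if i == ord0 then k else 0%N), (fun=> 0%N), G, 1.
  split; rewrite ?evpt1 ?oner_eq0 //; try exact: mh1.
    by move=> i; rewrite subr0; case: eqP => _; rewrite ?mulr1 ?mulr0.
  by rewrite rmorph1 tofrac1 divr1.
have [[j zj]|away] := over_dec P_neq0 zX; last first.
  have := sec_mul A0 (sec_sum1 (p := xpredT) (fun j _ => sec_dv (c j) zX (away j))).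
  by rewrite mulr1; apply: sec_ext => i; rewrite twE.
have nov j' : j' != j -> ~ proj_eq (row ord0 z) (P j').
  move=> ne [x [x0 zE']]; case: zj => y [y0 zE]; case/eqP: ne; apply: P_distinct.
  exists (x^-1 * y); split; first by rewrite mulf_neq0 ?invr_eq0.
  by rewrite -scalerA -zE zE' scalerA mulVf // scale1r.
suff Aj : sec (fun i => k%:Z * ((i == ord0) : nat)%:Z + c j * dv j i) z A%:F.
  have := sec_mul Aj (sec_sum1 (p := [pred j' | j' != j]) (fun j' ne => sec_dv (c j') zX (nov j' ne))).
  by rewrite mulr1; apply: sec_ext => i; rewrite twE [X in _ = _ + X](bigD1 j) //= addrA.
case ec : (c j) => [c'|c'].
  have o := oA j c' ec; have [lt|le] := ltnP k c'.
    by rewrite (ordge_eq0 (M_unit j) hA o lt) tofrac0; apply: sec0.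
  have hA' : A \is (k - c' + c')%N.-homog by rewrite subnK.
  have [G hG <-] := ordge_multihomog (P := P) M_unit M_row hA' o.
  exists (fun i => if i == ord0 then (k - c')%N else if i == lift ord0 j then c' else 0%N), (fun=> 0%N), G, 1.
  split; rewrite ?evpt1 ?oner_eq0 //; try exact: mh1; last by rewrite rmorph1 tofrac1 divr1.
  move=> i; rewrite subr0 /dv; case: (unliftP ord0 i) => [j'|] ->.
    have -> : (lift ord0 j' == ord0) = false by rewrite eq_sym (negPf (neq_lift _ _)).
    by rewrite mulr0 add0r subr0; case: eqP => _; rewrite ?mulr1 ?mulr0.
  by rewrite eqxx (negPf (neq_lift _ _)) mulr1 sub0r mulrN1 subzn.
have := sec_mul A0 (sec_dvNn j c'.+1 zX); rewrite mulr1; apply: sec_ext => i.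
by rewrite NegzE.
Qed.

Lemma generic_homog i k : generic_pt P i k \is 1.-homog.
Proof.
rewrite mxE; case: (unlift ord0 i) => [j|]; last exact: dhomogXi.
by apply: rpredB; apply/rpredZ/dhomogXi.
Qed.

Lemma sg_homog (u : 'I_n.+1 -> nat) G : multihomog u G -> sg P G \is (\sum_i u i)%N.-homog.
Proof.
move=> hG; rewrite sg.unlock /subst /mmap big_seq; apply: rpred_sum => m mG.
rewrite mul_mpolyC; apply: rpredZ; rewrite /mmap1 prod_mxvec.
elim/big_rec2: _ => [|i x y _ IH]; first exact: dhomog1.
apply: dhomogM => //; rewrite -(hG m mG i).
elim/big_rec2: _ => [|k a b _ IH']; first exact: dhomog1.
apply: dhomogM => //; rewrite mxvecE.
by have := dhomogMn (m (mxvec_index i k)) (generic_homog i k); rewrite mul1n.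
Qed.

End LocalSections.

(** * Global sections of line bundles on X *)

(** Ternary polynomials as polynomials in X_2 over K[X_0, X_1], that is, projection from (0 : 0 :
    1). *)
HB.lock Definition vw (K : closedFieldType) (A : {mpoly K[3]}) : {poly {mpoly K[2]}} := muni A.

HB.lock Definition embS (K : closedFieldType) (B : {mpoly K[2]}) : {mpoly K[3]} :=
  mmap (@mpolyC 3 K) (fun i => if i == 0 then 'X_0 else 'X_1) B.

Section Views.
Variable K : closedFieldType.
Local Notation R := {mpoly K[3]}.
Local Notation S := {mpoly K[2]}.

Lemma vw_zmod : zmod_morphism (@vw K).
Proof. by move=> A B; rewrite vw.unlock; apply: raddfB. Qed.
Lemma vw_monoid : monoid_morphism (@vw K).
Proof. by split=> [|A B]; rewrite vw.unlock; [apply: rmorph1|apply: rmorphM]. Qed.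
HB.instance Definition _ := GRing.isZmodMorphism.Build _ _ (@vw K) vw_zmod.
HB.instance Definition _ := GRing.isMonoidMorphism.Build _ _ (@vw K) vw_monoid.

Lemma embS_zmod : zmod_morphism (@embS K).
Proof. by move=> A B; rewrite embS.unlock; apply: raddfB. Qed.
Lemma embS_monoid : monoid_morphism (@embS K).
Proof. by split=> [|A B]; rewrite embS.unlock; [apply: rmorph1|apply: rmorphM]. Qed.
HB.instance Definition _ := GRing.isZmodMorphism.Build _ _ (@embS K) embS_zmod.
HB.instance Definition _ := GRing.isMonoidMorphism.Build _ _ (@embS K) embS_monoid.

Lemma vwC c : vw c%:MP = c%:MP%:P :> {poly S}.
Proof. by rewrite vw.unlock muniC. Qed.
Lemma embSC c : embS c%:MP = c%:MP :> R.
Proof. by rewrite embS.unlock mmapC. Qed.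
Lemma embSXi i : embS 'X_i = (if i == 0 then 'X_0 else 'X_1) :> R.
Proof. by rewrite embS.unlock mmapXU. Qed.
Lemma embSZ c B : embS (c *: B) = c *: embS B :> R.
Proof. by rewrite -!mul_mpolyC rmorphM /= embSC. Qed.

Lemma embS_homog k (B : S) : B \is k.-homog -> embS B \is k.-homog.
Proof.
move=> hA; rewrite embS.unlock -[k]mul1n; apply: mmap_dhomog hA => i.
by case: eqP => _; apply/dhomogXi.
Qed.

Lemma vwX : (vw ('X_0 : R) = ('X_0)%:P) * (vw ('X_1 : R) = ('X_1)%:P) * (vw ('X_2%:R : R) = 'X).
Proof.
have E i : vw ('X_i : R) = 'X_[[multinom (U_(i)%MM : 'X_{1..3}) (widen_ord (leqnSn 2) l) | l < 2]] *: 'X^((U_(i)%MM : 'X_{1..3}) ord_max).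
  by rewrite vw.unlock muniE msuppX big_seq1 mcoeffX eqxx scale1r.
rewrite !E !mnm1E /= !expr0 expr1.
have -> : [multinom (U_(0%R)%MM : 'X_{1..3}) (widen_ord (leqnSn 2) l) | l < 2] = U_(0%R)%MM.
  by apply/mnmP => l; rewrite mnmE !mnm1E; case: (ord2P l) => ->.
have -> : [multinom (U_(1%R)%MM : 'X_{1..3}) (widen_ord (leqnSn 2) l) | l < 2] = U_(1%R)%MM.
  by apply/mnmP => l; rewrite mnmE !mnm1E; case: (ord2P l) => ->.
have -> : [multinom (U_(2%:R)%MM : 'X_{1..3}) (widen_ord (leqnSn 2) l) | l < 2] = 0%MM.
  by apply/mnmP => l; rewrite mnmE !mnm1E mnm0E; case: (ord2P l) => ->.
by rewrite mpolyX0 scale1r !alg_polyC.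
Qed.

Lemma vw_embS (B : S) : vw (embS B) = B%:P.
Proof.
pose f : {rmorphism S -> {poly S}} := @vw K \o @embS K.
pose g : {rmorphism S -> {poly S}} := @polyC S.
suff H : f =1 g by exact: H.
apply: mpoly_rmorph_eq => [c|i]; rewrite /f /g /=; first by rewrite embSC vwC.
by rewrite embSXi; case: (ord2P i) => -> /=; rewrite vwX.
Qed.

Definition unv (p : {poly S}) : R := (map_poly (@embS K) p).['X_2%:R].

Lemma unv_vw A : unv (vw A) = A.
Proof.
pose f : {rmorphism R -> R} := (horner_eval ('X_2%:R : R) \o map_poly (@embS K)) \o @vw K.
suff H : f =1 idfun by exact: H.
apply: mpoly_rmorph_eq => [c|i]; rewrite /f /= /horner_eval.
  by rewrite vwC map_polyC /= hornerC embSC.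
by case: (ord3P i) => ->; rewrite vwX ?map_polyC ?map_polyX /= ?hornerC ?hornerX ?embSXi.
Qed.

Lemma vwK p : vw (unv p) = p.
Proof.
rewrite /unv -[vw _]/((@vw K : {rmorphism R -> {poly S}}) _) -horner_map /= vwX.
rewrite -map_poly_comp.
have -> : map_poly (@vw K \o @embS K) p = map_poly polyC p.
  by apply: eq_map_poly => B; rewrite /= vw_embS.
exact: comp_polyXr.
Qed.

Lemma vw_inj : injective (@vw K).
Proof. exact: (can_inj unv_vw). Qed.

Definition pt3 (q : 'rV[K]_2) (x : K) : 'I_3 -> K :=
  fun i => if i == 0 then q 0 0 else if i == 1 then q 0 1 else x.

(** Restriction to the line through (0 : 0 : 1) and (q_0 : q_1 : 0), with X_2 as affine
    coordinate. *)
Definition spec (q : 'rV[K]_2) (A : R) : {poly K} := map_poly (meval (q 0)) (vw A).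

Lemma horner_spec q x A : (spec q A).[x] = A.@[pt3 q x].
Proof.
pose f : {rmorphism R -> K} := (horner_eval x \o map_poly (meval (q 0))) \o @vw K.
pose g : {rmorphism R -> K} := meval (pt3 q x).
suff H : f =1 g by exact: H.
apply: mpoly_rmorph_eq => [c|i]; rewrite /f /g /= /horner_eval.
  by rewrite vwC map_polyC /= hornerC !mevalC.
case: (ord3P i) => ->; rewrite vwX ?map_polyC ?map_polyX /= ?hornerC ?hornerX !mevalXU //.
Qed.

Lemma specM q A B : spec q (A * B) = spec q A * spec q B.
Proof. by rewrite /spec !rmorphM. Qed.

Lemma spec_eq0 q A : spec q A = 0 <-> forall x, A.@[pt3 q x] = 0.
Proof.
split=> [e x|h]; first by rewrite -horner_spec e horner0.
by apply: poly_eq0_closed => x; rewrite horner_spec.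
Qed.

Lemma embS_eval q x (B : S) : (embS B).@[pt3 q x] = B.@[q 0].
Proof. by rewrite -horner_spec /spec vw_embS map_polyC hornerC. Qed.

Lemma embS_inj : injective (@embS K).
Proof. by move=> A B /(congr1 (@vw K)); rewrite !vw_embS => /polyC_inj. Qed.

Lemma embS_eq0 (B : S) : (embS B == 0) = (B == 0).
Proof. by rewrite -(inj_eq embS_inj) rmorph0. Qed.

(** As for binary forms: modulo the equation of the line, q_i^k A is congruent to A restricted to
    the line, which is zero. *)
Lemma form3_factor A k q : A \is k.-homog -> q != 0 -> spec q A = 0 ->
  exists A', A' \is (k.-1).-homog /\ A = embS (lam q) * A'.
Proof.
move=> hA q0 /spec_eq0 Aq; have [i qi] := rV2P q0.
have l0 : embS (lam q) != 0 by rewrite embS_eq0 lam_neq0.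
pose xi : 'I_3 := if i == 0 then 0 else 1.
pose h' (j : 'I_3) : R := if j == 2%:R then (q 0 i)%:MP * 'X_2%:R else 'X_xi * (pt3 q 0 j)%:MP.
have h'0 : mmap (@mpolyC 3 K) h' A = 0.
  suff /eqP : mmap (@mpolyC 3 K) h' A * 'X_xi = 0.
    by rewrite mulf_eq0 (negPf (mpolyXU_neq0 _ _)) orbF => /eqP.
  apply: mpoly_eq0_closed => v; rewrite mevalM mevalXU meval_mmap.
  have [->|vi] := eqVneq (v xi) 0; first by rewrite mulr0.
  have -> : A.@[fun j => (h' j).@[v]] = v xi ^+ k * A.@[pt3 q (q 0 i * v 2%:R / v xi)].
    rewrite -(meval_scale _ _ hA); apply: meval_eq => j; rewrite /h' /pt3.
    by case: (ord3P j) => -> /=; rewrite mevalM mevalC mevalXU // [RHS]mulrC divfK.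
  by rewrite Aq mulr0 mul0r.
have [b] : exists b, mmap (@mpolyC 3 K) (fun j => (q 0 i)%:MP * 'X_j) A
                   = mmap (@mpolyC 3 K) h' A + embS (lam q) * b.
  apply: mmap_cong => j; rewrite /h' /lam rmorphB /= !embSZ !embSXi /= -!mul_mpolyC /pt3 /xi.
  case: (ord2P i) (ord3P j) => -> [] -> /=.
  - by exists 0; rewrite mulr0 addr0 mulrC.
  - by exists (-1); ring.
  - by exists 0; rewrite mulr0 addr0.
  - by exists 1; ring.
  - by exists 0; rewrite mulr0 addr0 mulrC.
  - by exists 0; rewrite mulr0 addr0.
rewrite (mmap_scale _ _ _ hA) h'0 add0r => e.
have mmX : mmap (@mpolyC 3 K) (fun j => 'X_j) A = A.
  by apply: (@mpoly_rmorph_eq _ _ _ _ idfun) => [c|j] /=; rewrite ?mmapC ?mmapXU.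
rewrite mmX in e.
have E : A = embS (lam q) * ((q 0 i ^- k)%:MP * b).
  rewrite mulrCA -e mulrA -rmorphXn -rmorphM /= mulVf ?expf_neq0 // mpolyC1 mul1r //.
have hl : embS (lam q) \is 1.-homog by apply/embS_homog/lam_homog.
exists ((q 0 i ^- k)%:MP * b); split=> //.
have [A0|A0] := eqVneq A 0.
  have /eqP := E; rewrite A0 eq_sym mulf_eq0 (negPf l0) /= => /eqP ->.
  exact: dhomog0.
case: k hA {e h'0} E => [|k] hA E /=.
  set B := _ * b in E *; have B0 : B = 0.
    by apply: (homog_cofactor_lt l0 hl _ (ltn0Sn 0)); rewrite -E.
  by rewrite B0 dhomog0.
by apply: (homog_cofactor l0 hl); rewrite -E.
Qed.

Lemma vw_pihomog d (A : R) i : (vw A)`_i = 0 -> (vw (pihomog mdeg d A))`_i = 0.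
Proof.
rewrite vw.unlock => e; apply/mpolyP => m; rewrite mcoeff0 mcoeff_muni.
have := mcoeff_muni A i m; rewrite e mcoeff0 => e'.
rewrite pihomogE raddf_sum /= big_seq_cond big1 // => m' /andP [m'A _].
rewrite mcoeffZ mcoeffX; case: eqP => [->|_]; last by rewrite mulr0.
by rewrite -e' mul0r.
Qed.

Lemma size_vw_pihomog d (A : R) : (size (vw (pihomog mdeg d A)) <= size (vw A))%N.
Proof. by apply/leq_sizeP => i le; apply: vw_pihomog; move/leq_sizeP: (leqnn (size (vw A))); apply. Qed.

Lemma coef_vw_homog k (A : R) i : A \is k.-homog -> (vw A)`_i \is (k - i)%N.-homog.
Proof.
move=> hA; apply/dhomogP => m; rewrite mcoeff_msupp vw.unlock mcoeff_muni => ne.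
have := dhomog_mf hA; move/(_ [multinom of rcons m i]); rewrite mcoeff_msupp => /(_ ne) /= <-.
by rewrite /mdeg /= -cats1 big_cat /= big_seq1 addnK.
Qed.

Lemma mul_embS_vw (B : S) (A : R) : vw (embS B * A) = B *: vw A.
Proof. by rewrite rmorphM /= vw_embS mul_polyC. Qed.

Lemma pihomog_neq0 (N : nat) (A : {mpoly K[N]}) : A != 0 -> exists d, pihomog mdeg d A != 0.
Proof.
move=> A0.
have [/existsP [d hd]|/existsPn h] := boolP [exists d : 'I_(msize A), pihomog mdeg d A != 0].
  by exists d.
case/eqP: A0; rewrite (pihomog_partitionE (leqnn (msize A))) big1 // => d _.
by apply/eqP; have := h d; rewrite negbK.
Qed.

Lemma pseudo_div (A B : R) : B != 0 -> exists c U C,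
  [/\ c != 0, embS c * A = B * U + C, (size (vw C) < size (vw B))%N
    & exists N, c = lead_coef (vw B) ^+ N].
Proof.
move=> B0; have vB0 : vw B != 0 by rewrite -(inj_eq vw_inj) rmorph0 in B0.
exists (lead_coef (vw B) ^+ scalp (vw A) (vw B)), (unv (vw A %/ vw B)), (unv (vw A %% vw B)).
split; last by exists (scalp (vw A) (vw B)).
- by rewrite expf_neq0 // lead_coef_eq0.
- apply: vw_inj; rewrite mul_embS_vw rmorphD rmorphM /= !vwK Pdiv.Idomain.divp_eq mulrC //.
- by rewrite vwK ltn_modp.
Qed.

End Views.

Section GlobalSections.
Variables (K : closedFieldType) (n : nat) (P : 'I_n -> 'rV[K]_3).
Hypothesis P_neq0 : forall j, P j != 0.
Local Notation R := {mpoly K[3]}.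
Local Notation S := {mpoly K[2]}.
Local Notation away x := (forall j, exists l, cross (P j 0) x l != 0).

Lemma row1_neq0 (v : 'rV[K]_3) : v != 0 -> exists k, v 0 k != 0.
Proof.
move=> v0; apply/existsP; rewrite -negb_forall; apply: contraNN v0 => /forallP h.
by apply/eqP/rowP => k; rewrite !mxE; apply/eqP/h.
Qed.

Lemma generic_line (b : S) : b != 0 ->
  exists q : 'rV[K]_2, [/\ q != 0, b.@[q 0] != 0 & forall x, away (pt3 q x)].
Proof.
move=> b0.
pose mu0 j : S := P j 0 0 *: 'X_1 - P j 0 1 *: 'X_0.
(* The form [mu0 j] is zero exactly when P_j = (0 : 0 : 1), a point that is never proportional to
   [pt3 q x] for nonzero q; such a P_j excludes no line. *)
pose mu j : S := if mu0 j == 0 then 1 else mu0 j.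
have mu0E j v : (mu0 j).@[v] = P j 0 0 * v 1 - P j 0 1 * v 0.
  by rewrite mevalB !mevalZ !mevalXU.
have : b * 'X_0 * \prod_j mu j != 0.
  rewrite !mulf_neq0 ?mpolyXU_neq0 //; apply/prodf_neq0 => j _.
  by rewrite /mu; case: (eqVneq (mu0 j) 0) => // _; apply: oner_neq0.
move=> /mpoly_nonroot [v]; rewrite !mevalM mevalXU rmorph_prod.
rewrite !mulf_eq0 !negb_or => /andP[/andP[bv v0] /prodf_neq0 hmu].
pose q : 'rV[K]_2 := \row_i v i.
have qv : q 0 =1 v by move=> i; rewrite mxE.
exists q; split.
- by apply: contraNneq v0 => e; rewrite -qv e mxE.
- by rewrite (meval_eq _ qv).
move=> x j; have := hmu j isT; rewrite /mu; case: (eqVneq (mu0 j) 0) => [e _|_]; last first.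
  by rewrite /= mu0E => h; exists 2%:R; rewrite crossE /pt3 /= !qv.
exists 1; rewrite crossE /pt3 /= qv.
have P0 : P j 0 0 = 0.
  by have := mu0E j (fun i => (i == 1)%:R); rewrite e meval0 /= mulr1 mulr0 subr0.
have P1 : P j 0 1 = 0.
  have := mu0E j (fun i => (i == 0)%:R); rewrite e meval0 /= mulr1 mulr0 sub0r => /esym/eqP.
  by rewrite oppr_eq0 => /eqP.
rewrite P0 mul0r subr0 mulf_neq0 //.
have [k] := row1_neq0 (P_neq0 j); case: (ord3P k) => -> //; rewrite ?P0 ?P1 eqxx //.
Qed.

Lemma line_poly (q : 'rV[K]_2) : q != 0 ->
  exists p : {poly K}, p != 0 /\ forall x, p.[x] != 0 -> away (pt3 q x).
Proof.
move=> q0.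
have Hj j : exists p : {poly K}, p != 0 /\ forall x, p.[x] != 0 -> exists l, cross (P j 0) (pt3 q x) l != 0.
  have [P1|P1] := eqVneq (P j 0 1) 0; last first.
    exists (P j 0 1 *: 'X - (P j 0 2%:R * q 0 1)%:P); split.
      apply: contraNneq P1 => /polyP/(_ 1%N); rewrite coefB coefZ coefX coefC coef0 /= subr0 mulr1.
      by move=> ->.
    by move=> x h; exists 0; rewrite crossE /pt3 /=; move: h; rewrite !hornerE.
  have [P0|P0] := eqVneq (P j 0 0) 0; last first.
    exists ((P j 0 2%:R * q 0 0)%:P - P j 0 0 *: 'X); split.
      apply: contraNneq P0 => /polyP/(_ 1%N); rewrite coefB coefZ coefX coefC coef0 /= sub0r mulr1.
      by move=> /eqP; rewrite oppr_eq0.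
    by move=> x h; exists 1; rewrite crossE /pt3 /=; move: h; rewrite !hornerE.
  have P2 : P j 0 2%:R != 0.
    have [k] := row1_neq0 (P_neq0 j); case: (ord3P k) => -> //; rewrite ?P0 ?P1 eqxx //.
  exists 1; split=> [|x _]; first exact: oner_neq0.
  have [i qi] := rV2P q0; case: (ord2P i) qi => -> qi.
    by exists 1; rewrite crossE /pt3 /= P0 mul0r subr0 mulf_neq0.
  by exists 0; rewrite crossE /pt3 /= P1 mul0r sub0r oppr_eq0 mulf_neq0.
have [p Hp] := fin_all_exists Hj.
exists (\prod_j p j); split; first by apply/prodf_neq0 => j _; case: (Hp j).
move=> x; rewrite horner_prod => /prodf_neq0 h j; have [_] := Hp j; apply.
exact: h.
Qed.

(* A rational function of degree k on the plane that is regular outside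
   finitely many points is a form: the denominators form an ideal that
   contains, by pseudo-division, a binary form; its linear factors can be
   removed one by one. *)
Lemma plane_global (f : ratfun K 3) (k : nat) :
  (forall x : 'I_3 -> K, (exists l, x l != 0) -> away x ->
     exists u A B, [/\ A \is (u + k)%N.-homog, B \is u.-homog, B.@[x] != 0 & f = A%:F / B%:F]) ->
  exists A, A \is k.-homog /\ f = A%:F.
Proof.
move=> H.
have pt3n0 (q : 'rV[K]_2) x : q != 0 -> exists l, pt3 q x l != 0.
  move=> /rV2P [i qi]; case: (ord2P i) qi => -> qi; first by exists 0.
  by exists 1.
have [q1 [q10 _ aw1]] := generic_line (oner_neq0 S).
have [u [A0 [B0 [hA0 hB0 B0x fE]]]] := H _ (pt3n0 _ 0 q10) (aw1 0).
have B00 : B0 != 0 by apply: contraNneq B0x => ->; rewrite meval0.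
pose J (B : R) := exists C, B * A0 = C * B0.
have JH x : (exists l, x l != 0) -> away x -> exists A B, [/\ B.@[x] != 0 & A * B0 = A0 * B].
  move=> x0 ax; have [u' [A [B [_ _ Bx fE']]]] := H x x0 ax; exists A, B; split=> //.
  apply: tofrac_divK; rewrite -?fE' //.
  by apply: contraNneq Bx => ->; rewrite meval0.
(* At a root x of B on a line with nonzero leading coefficient, some [B1] in J does not vanish. Its
   pseudo-remainder modulo B is then nonzero at x, stays in J and has smaller degree in X_2. *)
have stepA N : forall B, B != 0 -> J B -> (size (vw B) <= N.+1)%N ->
    exists B', [/\ B' != 0, J B' & (size (vw B') <= 1)%N].
  elim: N => [|N IH] B Bn0 JB sB; first by exists B.
  have [le1|gt1] := leqP (size (vw B)) 1; first by exists B.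
  have vB0 : vw B != 0 by rewrite -(inj_eq (@vw_inj K)) rmorph0 in Bn0.
  have lc0 : lead_coef (vw B) != 0 by rewrite lead_coef_eq0.
  have [q [q0 lcq aw]] := generic_line lc0.
  have sz : size (spec q B) = size (vw B) by rewrite /spec size_map_poly_id0.
  have [x] : exists x, root (spec q B) x by apply/closed_rootP; rewrite sz; case: (size _) gt1 => // -[].
  rewrite /root horner_spec => /eqP Bx.
  have [A1 [B1 [B1x E1]]] := JH _ (pt3n0 _ x q0) (aw x).
  have [c [U [C [c0 cE sC [e eE]]]]] := pseudo_div B1 Bn0.
  have Cx : C.@[pt3 q x] != 0.
    have := congr1 (meval (pt3 q x)) cE; rewrite mevalM embS_eval mevalD mevalM Bx mul0r add0r => <-.
    by rewrite mulf_neq0 // eE rmorphXn expf_neq0.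
  apply: (IH C); first by apply: contraNneq Cx => ->; rewrite meval0.
    have [D DE] := JB; exists (embS c * A1 - U * D).
    have -> : C = embS c * B1 - B * U by rewrite cE addrC addKr.
    rewrite mulrBl mulrBl -[embS c * A1 * B0]mulrA E1 -[U * D * B0]mulrA -DE; ring.
  by rewrite -ltnS (leq_trans sC).
have key : forall d (b : S), b \is d.-homog -> b != 0 -> J (embS b) -> exists C, A0 = C * B0.
  elim=> [|d IH] b hb b0 [C CE].
    have c0 : b@_0%MM != 0 by apply: contraNneq b0 => e; rewrite (homog_eq0C hb) e mpolyC0.
    exists ((b@_0%MM)^-1 *: C); rewrite -scalerAl -CE (homog_eq0C hb) embSC mul_mpolyC scalerA.
    by rewrite mpolyCK mulVf // scale1r.
  have [q q0 bq] := form2_root hb isT.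
  have [b' [hb' bE]] := form2_factor hb q0 bq.
  have b'0 : b' != 0 by apply: contraNneq b0 => e; rewrite bE e mulr0.
  have hC : C \is (d.+1 + k)%N.-homog.
    apply: (homog_cofactor B00 hB0); rewrite mulrC -CE addnCA.
    by apply: dhomogM hA0; apply: embS_homog.
  have [p [p0 hp]] := line_poly q0.
  have sC : spec q C = 0.
    (* Away from the zeros of [p] the line avoids the P_j; f is regular there, so C vanishes
       together with b. *)
    suff /eqP : spec q C * p = 0 by rewrite mulf_eq0 (negPf p0) orbF => /eqP.
    apply: poly_eq0_closed => x; rewrite hornerM horner_spec.
    have [->|px] := eqVneq p.[x] 0; first by rewrite mulr0.
    have [A1 [B1 [B1x E1]]] := JH _ (pt3n0 _ x q0) (hp x px).
    have E : B1 * C = embS b * A1.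
      apply: (mulIf B00); rewrite -mulrA -CE -[RHS]mulrA E1; ring.
    have /eqP := congr1 (meval (pt3 q x)) E.
    rewrite !mevalM embS_eval bq mul0r mulf_eq0 (negPf B1x) /= => /eqP ->.
    by rewrite mul0r.
  have [C' [_ C'E]] := form3_factor hC q0 sC.
  apply: (IH b' hb' b'0); exists C'.
  have l0 : embS (lam q) != 0 by rewrite embS_eq0 lam_neq0.
  by apply: (mulfI l0); rewrite !mulrA -C'E -CE bE rmorphM.
have [B1 [B10 JB1 sB1]] : exists B', [/\ B' != 0, J B' & (size (vw B') <= 1)%N].
  apply: (stepA (size (vw B0)) B0) => //; first by exists A0; rewrite mulrC.
(* Since [A0] and [B0] are homogeneous, so is the ideal J, and a nonzero homogeneous component can
   replace [B1]. *)
have [d pB] := pihomog_neq0 B10.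
pose B2 := pihomog mdeg d B1; have hB2 : B2 \is d.-homog by apply: pihomogP.
have JB2 : J B2.
  have [C CE] := JB1; exists (pihomog mdeg (d + k) C); rewrite mulrC -(pihomogM d B1 hA0).
  rewrite [A0 * _]mulrC CE mulrC [RHS]mulrC -(pihomogM (d + k) C hB0); congr (pihomog _ _ _).
  by rewrite addnAC addnA.
have sB2 : (size (vw B2) <= 1)%N := leq_trans (size_vw_pihomog d B1) sB1.
pose b := (vw B2)`_0.
have B2E : B2 = embS b by apply: (@vw_inj K); rewrite vw_embS; apply: size1_polyC.
have hb : b \is d.-homog by have := coef_vw_homog 0 hB2; rewrite subn0.
have b0 : b != 0 by rewrite -embS_eq0 -B2E.
have {}JB2 : J (embS b) by rewrite -B2E.
have [C CE] := key d b hb b0 JB2.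
exists C; split; last by rewrite fE; apply: tofrac_eq_div.
by apply: (homog_cofactor B00 hB0); rewrite mulrC -CE.
Qed.

End GlobalSections.

Section RegularSections.
Variables (K : closedFieldType) (n : nat) (P : 'I_n -> 'rV[K]_3).
Hypothesis P_neq0 : forall j, P j != 0.
Hypothesis P_distinct : forall j j', proj_eq (P j) (P j') -> j = j'.
Variable M : 'I_n -> 'M[K]_3.
Hypothesis M_unit : forall j, M j \in unitmx.
Hypothesis M_row : forall j, M j 0 = P j 0 :> ('I_3 -> K).
Local Notation R := {mpoly K[3]}.
Local Notation S := {mpoly K[2]}.

Lemma genm_blowup (x : 'I_3 -> K) : (exists l, x l != 0) ->
  (forall j, exists l, cross (P j 0) x l != 0) -> blowup_pt P (genm P idfun x).
Proof.
move=> [l0 xl] aw; have nzrow m (z : 'M[K]_(m, 3)) i k : z i k != 0 -> row i z != 0.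
  by apply: contraNneq => /rowP/(_ k); rewrite !mxE => ->.
split=> [i|j].
  case: (unliftP ord0 i) => [j|] ->; last by apply: (nzrow _ _ _ l0); rewrite genm0.
  by have [l hl] := aw j; apply: (nzrow _ _ _ l); rewrite genmS.
have E k : genm P idfun x ord0 k = x k by rewrite genm0.
have dE : forall k, genm P idfun x (lift ord0 j) k = cross (P j 0) x k by move=> k; rewrite genmS.
split; apply: dot_row.
  transitivity (dot (P j 0) (cross (P j 0) x)); last exact: crossl.
  by rewrite dotC; apply: eq_bigr => k _; rewrite dE.
transitivity (dot x (cross (P j 0) x)); last exact: crossr.
by rewrite dotC; apply: eq_bigr => k _; rewrite dE [row _ _ _ _]mxE E.
Qed.

Lemma sum_tw (k : int) c : \sum_i tw (n := n) k c i = k.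
Proof.
rewrite big_ord_recl /tw unlift_none -[RHS](subrK (\sum_j c j)); congr (_ + _).
by apply: eq_bigr => j _; rewrite liftK.
Qed.

(** In the plane only finitely many points are lost, so the section is a form. One point of each E_j
    then gives the multiplicity: the denominator does not vanish there, so its order at P_j equals
    its j-th degree, and the order of the numerator is at least its own. *)
Lemma sec_global (k : nat) (c : 'I_n -> int) (f : ratfun K 3) :
  (forall z, blowup_pt P z -> sec P (tw k c) z f) ->
  exists A, [/\ A \is k.-homog, f = A%:F & forall j (c' : nat), c j = c' -> ordge (M j) c' A].
Proof.
move=> H; have [|A [hA fE]] := @plane_global K n P P_neq0 f k.
  move=> x x0 aw; have [u [v [G [H' [hG hH uv H0 fE]]]]] := H _ (genm_blowup x0 aw).
  exists (\sum_i v i)%N, (sg P G), (sg P H'); split=> //.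
  - have -> : (\sum_i v i + k = \sum_i u i)%N; last exact: sg_homog.
    apply/eqP; rewrite -eqz_nat PoszD; apply/eqP.
    rewrite -[k%:Z](sum_tw k c) !(big_morph Posz PoszD (erefl _)) -big_split.
    by apply: eq_bigr => i _; rewrite -uv /= addrC subrK.
  - exact: sg_homog.
  - by rewrite meval_sg.
exists A; split=> // j c' cj.
pose q : 'rV[K]_2 := pt2 1 0; have q0 : q != 0 by apply: pt2_neq0; rewrite oner_eq0.
have zX := over_pt_blowup P_neq0 P_distinct M_unit M_row j q0.
have [u [v [G [H' [hG hH uv H0 fE']]]]] := H _ zX.
have sH0 := evpt_sg_neq0 P_neq0 P_distinct M_unit M_row zX hH H0.
have E : sg P H' * A = sg P G by rewrite mulrC; apply/esym/(tofrac_div_eqE sH0); rewrite -fE' fE.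
have [oG _] := jet_sg_over M_row j q hG.
have [oH Hq] := jet_sg_over M_row j q hH.
apply: (ordge_cancel oH); last first.
  rewrite E; apply: ordge_le oG; have := uv (lift ord0 j); rewrite /tw liftK cj.
  by clear; lia.
by apply: contraNneq H0 => e; rewrite -Hq e meval0.
Qed.

End RegularSections.

Lemma ex_min_nat (Q : nat -> Prop) : (exists m, Q m) -> exists2 m, Q m & forall m', Q m' -> (m <= m')%N.
Proof.
move=> [m Qm]; apply: NNPP => no.
elim/ltn_ind: m Qm => m IH Qm; apply: no; exists m => // m' Qm'.
by rewrite leqNgt; apply/negP => lt; apply: IH lt Qm'.
Qed.

Lemma pihomogM_lt (K : comNzRingType) (N l e : nat) (p B : {mpoly K[N]}) :
  p \is l.-homog -> (e < l)%N -> pihomog mdeg e (p * B) = 0.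
Proof.
move=> hp lt; rewrite (pihomog_partitionE (leqnn (msize B))) big_distrr raddf_sum big1 //= => i _.
apply: (@pihomog_ne0 _ _ _ (l + i)%N); last by apply: dhomogM => //; apply: pihomogP.
by apply: contraTneq lt => <-; rewrite -leqNgt leq_addr.
Qed.

(** * The equation of a rational curve *)

Section PrincipalKernel.
Variables (K : closedFieldType).
Local Notation R := {mpoly K[3]}.
Local Notation S := {mpoly K[2]}.
Implicit Types (f : 'I_3 -> S).

Definition indep_pair (u v : S) := forall a b : K, a *: u + b *: v = 0 -> a = 0 /\ b = 0.

Lemma pb_lam_neq0 f q : indep_pair (f 0) (f 1) -> q != 0 -> pb f (embS (lam q)) != 0.
Proof.
move=> ind q0; apply: contraNneq q0; rewrite /lam rmorphB /= !embSZ !embSXi /= rmorphB /= !pbZ !pbX.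
rewrite -scaleNr => /ind [q1 /eqP]; rewrite oppr_eq0 => /eqP q00.
by apply/eqP/rowP => i; rewrite mxE; case: (ord2P i) => ->.
Qed.

(* The kernel is prime and meets K[X_0, X_1] trivially.  Pseudo-division by an
   element Q of minimal degree in X_2 gives c A = Q U with c a binary form;
   the linear factors of c do not divide Q if Q also has minimal total degree,
   so they divide U. *)
Lemma ker_principal01 f : indep_pair (f 0) (f 1) ->
  (exists B D, [/\ B \is D.-homog, B != 0 & pb f B = 0]) ->
  exists Q D, [/\ Q \is D.-homog, Q != 0, pb f Q = 0 &
    forall A k, A \is k.-homog -> pb f A = 0 -> exists A', A = Q * A'].
Proof.
move=> ind [B0 [D0 [hB0 B00 pB0]]].
have [r [Br [Dr [hBr Br0 pBr sBr]]] rmin] := @ex_min_nat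
  (fun r => exists B D, [/\ B \is D.-homog, B != 0, pb f B = 0 & size (vw B) = r])
  (ex_intro _ _ (ex_intro _ B0 (ex_intro _ D0 (And4 hB0 B00 pB0 erefl)))).
have [D [Q [hQ Q0 pQ sQ]] Dmin] := @ex_min_nat
  (fun D => exists B, [/\ B \is D.-homog, B != 0, pb f B = 0 & size (vw B) = r])
  (ex_intro _ Dr (ex_intro _ Br (And4 hBr Br0 pBr sBr))).
exists Q, D; split=> // A k hA pA.
have [A0|A0] := eqVneq A 0; first by exists 0; rewrite mulr0.
have Qline q : q != 0 -> spec q Q != 0.
  move=> q0; apply/negP => /eqP sp0; have [Q' [hQ' QE]] := form3_factor hQ q0 sp0.
  have Q'0 : Q' != 0 by apply: contraNneq Q0 => e; rewrite QE e mulr0.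
  have pQ' : pb f Q' = 0.
    apply/eqP; have /eqP := pQ; rewrite QE rmorphM mulf_eq0 (negPf (pb_lam_neq0 ind q0)) //.
  have sQ' : size (vw Q') = r.
    by rewrite -sQ QE mul_embS_vw size_scale // lam_neq0.
  case: D hQ Dmin hQ' => [|D] hQ Dmin hQ'.
    by move: sp0; rewrite (homog_eq0C hQ) /spec vwC map_polyC /= mevalC => /eqP;
       rewrite polyC_eq0 => /eqP e; move: Q0; rewrite (homog_eq0C hQ) e mpolyC0 eqxx.
  by have := Dmin D (ex_intro _ Q' (And4 hQ' Q'0 pQ' sQ')); rewrite ltnn.
have key : forall g c U, c \is g.-homog -> c != 0 -> embS c * A = Q * U -> exists A', A = Q * A'.
  elim=> [|g IH] c U hc c0 cE.
    have cc : c@_0%MM != 0 by apply: contraNneq c0 => e; rewrite (homog_eq0C hc) e mpolyC0.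
    exists ((c@_0%MM)^-1 *: U); rewrite -scalerAr -cE (homog_eq0C hc) embSC mul_mpolyC scalerA.
    by rewrite mpolyCK mulVf // scale1r.
  have [q q0 cq] := form2_root hc isT.
  have [c' [hc' c'E]] := form2_factor hc q0 cq.
  have c'0 : c' != 0 by apply: contraNneq c0 => e; rewrite c'E e mulr0.
  have l0 : embS (lam q) != 0 by rewrite embS_eq0 lam_neq0.
  have hQU : Q * U \is (g.+1 + k)%N.-homog by rewrite -cE; apply: dhomogM => //; apply: embS_homog.
  have [lt|le] := ltnP (g.+1 + k) D.
    have U0 := homog_cofactor_lt Q0 hQ hQU lt.
    by move/eqP: cE; rewrite U0 mulr0 mulf_eq0 embS_eq0 (negPf c0) (negPf A0).
  have hU : U \is (g.+1 + k - D)%N.-homog by apply: (homog_cofactor Q0 hQ); rewrite subnKC.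
  have sU : spec q U = 0.
    have /eqP := congr1 (spec q) cE; rewrite !specM {1}/spec vw_embS map_polyC /= cq mul0r eq_sym.
    by rewrite mulf_eq0 (negPf (Qline q q0)) => /eqP.
  have [U' [_ U'E]] := form3_factor hU q0 sU.
  apply: (IH c' U' hc' c'0); apply: (mulfI l0).
  by rewrite mulrA -rmorphM -c'E cE U'E mulrCA.
have [c [U [C [c0 cE sC [N cN]]]]] := pseudo_div A Q0.
pose l := lead_coef (vw Q).
have hl : l \is (D - (size (vw Q)).-1)%N.-homog by apply: coef_vw_homog.
have hc : c \is ((D - (size (vw Q)).-1) * N)%N.-homog by rewrite cN; apply: dhomogMn.
pose g := ((D - (size (vw Q)).-1) * N)%N; rewrite -/g in hc.
have hcA : embS c * A \is (g + k)%N.-homog by apply: dhomogM => //; apply: embS_homog.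
have [U' U'E] : exists U', pihomog mdeg (g + k) (Q * U) = Q * U'.
  have [lt|le] := ltnP (g + k) D; first by exists 0; rewrite mulr0; apply: pihomogM_lt lt.
  by exists (pihomog mdeg (g + k - D) U); rewrite -{1}(subnKC le); apply: pihomogM.
pose C' := pihomog mdeg (g + k) C.
have C'E : embS c * A = Q * U' + C'.
  by rewrite -(pihomog_dE hcA) cE raddfD /= U'E.
apply: (key g c U' hc c0); rewrite C'E.
have [->|C'0] := eqVneq C' 0; first by rewrite addr0.
have pC' : pb f C' = 0.
  have : pb f (embS c * A) = 0 by rewrite rmorphM /= pA mulr0.
  by rewrite C'E rmorphD rmorphM /= pQ mul0r add0r.
have := rmin _ (ex_intro _ C' (ex_intro _ (g + k)%N (And4 (pihomogP _ _ _) C'0 pC' erefl))).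
rewrite leqNgt -sQ => /negP; case.
exact: leq_ltn_trans (size_vw_pihomog _ _) sC.
Qed.

Lemma pb_linsub f (N : 'M[K]_3) A :
  pb f (linsub N A) = pb (fun k => \sum_i N i k *: f i) A.
Proof.
pose g1 : {rmorphism R -> S} := pb f \o linsub N.
pose g2 : {rmorphism R -> S} := pb (fun k => \sum_i N i k *: f i).
suff H : g1 =1 g2 by exact: H.
apply: mpoly_rmorph_eq => [c|i]; rewrite /g1 /g2 /=; first by rewrite linsubC !pbC.
by rewrite linsubXi rmorph_sum pbX; apply: eq_bigr => l _; rewrite /= pbZ pbX.
Qed.

Lemma eq_pb f f' A : f =1 f' -> pb f A = pb f' A.
Proof. by move=> e; rewrite !pb.unlock; apply: eq_mmap. Qed.

Lemma ker_principal f k0 l0 : k0 != l0 -> indep_pair (f k0) (f l0) ->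
  (exists B D, [/\ B \is D.-homog, B != 0 & pb f B = 0]) ->
  exists Q D, [/\ Q \is D.-homog, Q != 0, pb f Q = 0 &
    forall A k, A \is k.-homog -> pb f A = 0 -> exists A', A = Q * A'].
Proof.
move=> kl ind [B [D [hB B0 pB]]].
(* In Z/3 the indices add up to 0, so -(k0 + l0) is the third index. The permutation moves the
   independent pair to the coordinates 0 and 1. *)
pose t (i : 'I_3) : 'I_3 := if i == 0 then k0 else if i == 1 then l0 else - (k0 + l0).
have tinj : injective t.
  move=> i j; rewrite /t.
  by case: (ord3P k0) (ord3P l0) (ord3P i) (ord3P j) kl => -> [] -> [] -> [] ->.
pose s := perm tinj; pose N : 'M[K]_3 := (perm_mx s)^T.
have uN : N \in unitmx by rewrite unitmx_tr unitmx_perm.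
pose f' k := f (t k).
have pbN A : pb f (linsub N A) = pb f' A.
  rewrite pb_linsub; apply: eq_pb => k; rewrite (bigD1 (t k)) //= !mxE permE eqxx scale1r.
  rewrite big1 ?addr0 // => i ne; rewrite !mxE permE eq_sym (negPf ne); exact: scale0r.
have NK A : linsub N (linsub (invmx N) A) = A by rewrite linsub_comp mulmxV // linsub1.
have [|Q [D' [hQ Q0 pQ HQ]]] := @ker_principal01 f' ind.
  exists (linsub (invmx N) B), D; split; first exact: linsub_homog.
    by apply: contraNneq B0 => e; rewrite -(NK B) e rmorph0.
  by rewrite -pbN NK.
exists (linsub N Q), D'; split; first exact: linsub_homog.
- by apply: contraNneq Q0 => e; rewrite -(linsubK Q uN) e rmorph0.
- by rewrite pbN.
move=> A k hA pA; have [|A' A'E] := HQ (linsub (invmx N) A) k (linsub_homog _ hA).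
  by rewrite -pbN NK.
by exists (linsub N A'); rewrite -rmorphM /= -A'E NK.
Qed.

Lemma exists_indep f d : (forall i, f i \is d.-homog) -> (0 < d)%N ->
  (forall q : 'rV[K]_2, q != 0 -> exists i, (f i).@[q 0] != 0) ->
  exists k l, k != l /\ indep_pair (f k) (f l).
Proof.
move=> hf d0 bpf; have p0 : pt2 1 0 != 0 :> 'rV[K]_2 by apply: pt2_neq0; rewrite oner_eq0.
have [k fk] := bpf _ p0; have fk0 : f k != 0 by apply: contraNneq fk => ->; rewrite meval0.
have [q q0 fq] := form2_root (hf k) d0; have [l fl] := bpf q q0.
exists k, l; split; first by apply: contraNneq fl => <-; rewrite fq.
move=> a b e; have /eqP := congr1 (meval (q 0)) e.
rewrite mevalD !mevalZ fq mulr0 add0r meval0 mulf_eq0 (negPf fl) orbF => /eqP b0.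
split=> //; move/eqP: e; rewrite b0 scale0r addr0 mscalerI (negPf fk0) orbF.
by move/eqP.
Qed.

End PrincipalKernel.

(** * Dimension counts *)

Section FiniteDim.
Variable K : fieldType.

Definition closed_lin (L : lmodType K) (V : L -> Prop) :=
  V 0 /\ forall a u v, V u -> V v -> V (a *: u + v).

Definition comb (L : lmodType K) r (b : 'I_r -> L) (c : 'rV[K]_r) : L :=
  \sum_i c 0 i *: b i.

(** Spaces of forms are predicates on the polynomial ring, which has infinite dimension; a finite
    basis with unique coordinates replaces a vector space type. *)
Definition fdim (L : lmodType K) (V : L -> Prop) r :=
  exists b : 'I_r -> L, (forall i, V (b i)) /\
    forall v, V v -> exists! c, v = comb b c.

Section Dimension.
Variable L : lmodType K.
Implicit Types (U V : L -> Prop).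

Lemma comb_lin r (b : 'I_r -> L) a c d : comb b (a *: c + d) = a *: comb b c + comb b d.
Proof.
rewrite /comb scaler_sumr -big_split; apply: eq_bigr => i _ /=.
by rewrite !mxE scalerDl scalerA.
Qed.

Lemma combB r (b : 'I_r -> L) c d : comb b (c - d) = comb b c - comb b d.
Proof. have -> : c - d = (-1) *: d + c by rewrite scaleN1r addrC.
by rewrite comb_lin scaleN1r addrC. Qed.

Lemma comb0 r (b : 'I_r -> L) : comb b 0 = 0.
Proof. by rewrite -(subrr 0) combB subrr. Qed.

Lemma comb_mul r s (b : 'I_r -> L) (c : 'rV_s) (A : 'M_(s, r)) :
  comb b (c *m A) = comb (fun i => comb b (row i A)) c.
Proof.
rewrite /comb; transitivity (\sum_i \sum_l (c 0 l * A l i) *: b i).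
  by apply: eq_bigr => i _; rewrite mxE scaler_suml.
rewrite exchange_big; apply: eq_bigr => l _ /=; rewrite scaler_sumr.
by apply: eq_bigr => i _; rewrite scalerA mxE.
Qed.

Lemma comb_delta r (b : 'I_r -> L) i : comb b (delta_mx 0 i) = b i.
Proof.
rewrite /comb (bigD1 i) //= mxE !eqxx scale1r big1 ?addr0 // => j ne.
by rewrite mxE (negPf ne) andbF scale0r.
Qed.

Lemma closed_comb V r (b : 'I_r -> L) c : closed_lin V -> (forall i, V (b i)) -> V (comb b c).
Proof.
move=> [V0 Vl] Vb; rewrite /comb; elim: (index_enum _) => [|i s IH]; first by rewrite big_nil.
by rewrite big_cons; apply: Vl.
Qed.

Lemma closedD V u v : closed_lin V -> V u -> V v -> V (u + v).
Proof. by move=> [_ Vl] Vu Vv; rewrite -[u]scale1r; apply: Vl. Qed.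

Lemma closedZ V a u : closed_lin V -> V u -> V (a *: u).
Proof. by move=> [V0 Vl] Vu; rewrite -[_ *: _]addr0; apply: Vl. Qed.

Lemma closedB V u v : closed_lin V -> V u -> V v -> V (u - v).
Proof. by move=> [V0 Vl] Vu Vv; rewrite addrC -scaleN1r; apply: Vl. Qed.

Lemma fdim_ext U V r : (forall v, U v <-> V v) -> fdim U r -> fdim V r.
Proof.
move=> UV [b [Vb Hb]]; exists b; split=> [i|v /UV]; first exact/UV.
exact: Hb.
Qed.

Lemma comb_inj V r (b : 'I_r -> L) : closed_lin V -> (forall i, V (b i)) ->
  (forall v, V v -> exists! c, v = comb b c) -> injective (comb b).
Proof.
move=> lV Vb Hb c d e; have [x [_ ux]] := Hb _ (closed_comb c lV Vb).
by rewrite -(ux c) // -(ux d).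
Qed.

End Dimension.

(** Among the matrices whose row space lies in [U] one of maximal rank is chosen; a vector of [U]
    outside its row space would increase the rank. *)
Lemma rowspace r (U : 'rV[K]_r -> Prop) : closed_lin U ->
  exists A : 'M[K]_r, forall v, U v <-> (v <= A)%MS.
Proof.
move=> lU; pose Q s := exists A : 'M[K]_r, (forall v : 'rV_r, (v <= A)%MS -> U v) /\ s = (r - \rank A)%N.
have [|s [A [AU sA]] smin] := @ex_min_nat Q.
  by pose Z : 'M[K]_r := 0; exists (r - \rank Z)%N, Z; split=> // v; rewrite submx0 => /eqP->; case: lU.
exists A => v; split=> [Uv|]; last exact: AU.
apply/negPn/negP => vA.
have /smin : Q (r - \rank (A + v)%MS)%N.
  exists (A + v)%MS; split=> // w /sub_addsmxP [[w1 w2] /= ->].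
  apply: closedD => //; first by apply: AU; apply: submxMl.
  have -> : w2 *m v = w2 0 0 *: v by rewrite [w2]mx11_scalar mul_scalar_mx mxE eqxx.
  exact: closedZ.
rewrite sA; have lt : (\rank A < \rank (A + v)%MS)%N.
  by apply: rank_ltmx; rewrite ltmxE addsmxSl addsmx_sub submx_refl.
have := rank_leq_row (A + v)%MS; move: lt; clear; lia.
Qed.

Lemma fdim_quotient (L : lmodType K) (V U : L -> Prop) r :
  closed_lin V -> closed_lin U -> (forall v, U v -> V v) -> fdim V r ->
  exists s t (b : 'I_t -> L), [/\ (s + t = r)%N, fdim U s, (forall i, V (b i)) &
    forall v, V v -> exists! c, U (v - comb b c)].
Proof.
move=> lV lU UV [v [Vv Hv]]; have vinj := comb_inj lV Vv Hv.
have [|A HA] := @rowspace r (fun c => U (comb v c)).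
  split; first by rewrite comb0; case: lU.
  by move=> a c d Uc Ud; rewrite comb_lin; case: lU => _; apply.
exists (\rank A), (\rank A^C%MS), (fun i => comb v (row i (row_base A^C%MS))); split.
- by rewrite mxrank_compl subnKC // rank_leq_row.
- exists (fun i => comb v (row i (row_base A))); split=> [i|u Uu].
    by apply/HA; apply: submx_trans (row_sub _ _) _; rewrite eq_row_base.
  have [c [uc _]] := Hv u (UV _ Uu); have : (c <= row_base A)%MS.
    by rewrite eq_row_base; apply/HA; rewrite -uc.
  move=> /submxP [d dE]; exists d; split=> [|d']; first by rewrite -comb_mul -dE.
  rewrite -comb_mul uc dE => /vinj /(row_free_inj (row_base_free A)) //.
- by move=> i; apply: closed_comb.
move=> u Vu; have [c [uc _]] := Hv u Vu.
have : (c <= A + A^C)%MS by rewrite submx_full // addsmx_compl_full.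
move=> /sub_addsmxP [[c1 c2] /= cE].
have /submxP [d dE] : (c2 *m A^C <= row_base A^C)%MS by rewrite eq_row_base submxMl.
have E x : u - comb (fun i => comb v (row i (row_base A^C%MS))) x = comb v (c - x *m row_base A^C%MS).
  by rewrite -comb_mul uc combB.
exists d; split=> [|d']; rewrite E.
  by apply/HA; rewrite -dE cE addrK submxMl.
rewrite HA => h; apply: (row_free_inj (row_base_free A^C%MS)); apply/eqP.
rewrite -subr_eq0 -submx0 -(capmx_compl A) sub_capmx; apply/andP; split.
  rewrite -dE; have -> : c2 *m A^C%MS - d' *m row_base A^C%MS = (c - d' *m row_base A^C%MS) - c1 *m A.
    by rewrite cE addrAC [c1 *m A + _]addrC addrK.
  by rewrite addmx_sub // eqmx_opp submxMl.
by rewrite -mulmxBl (submx_trans (submxMl _ _)) // eq_row_base.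
Qed.

Lemma fdim_le (L : lmodType K) (V U : L -> Prop) r s :
  closed_lin V -> closed_lin U -> (forall v, U v -> V v) -> fdim U s -> fdim V r -> (s <= r)%N.
Proof.
move=> lV lU UV [u [Uu Hu]] [v [Vv Hv]].
have Hc i : exists c, u i = comb v c by have [c [uc _]] := Hv _ (UV _ (Uu i)); exists c.
have [c cE] := fin_all_exists Hc; pose C : 'M[K]_(s, r) := \matrix_i c i.
have uE x : comb u x = comb v (x *m C).
  by rewrite comb_mul; apply: eq_bigr => i _; rewrite cE rowK.
have : row_free C.
  apply/row_freeP; exists (pinvmx C); apply/row_matrixP => i; rewrite !rowE mulmx1 mulmxA.
  apply: (comb_inj lU Uu Hu); rewrite !uE; congr comb.
  by rewrite -[delta_mx 0 i *m C *m _]/(_) mulmxKpV // submxMl.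
by rewrite /row_free => /eqP <-; apply: rank_leq_col.
Qed.

Lemma fdim_uniq (L : lmodType K) (V : L -> Prop) r s :
  closed_lin V -> fdim V r -> fdim V s -> r = s.
Proof. by move=> lV hr hs; apply/eqP; rewrite eqn_leq !(@fdim_le _ V V). Qed.

Lemma fdim_sub (L : lmodType K) (V U : L -> Prop) r :
  closed_lin V -> closed_lin U -> (forall v, U v -> V v) -> fdim V r ->
  exists s, [/\ (s <= r)%N, fdim U s & s = r -> forall v, V v -> U v].
Proof.
move=> lV lU UV dV; have [s [t [b [st dU _ Hb]]]] := fdim_quotient lV lU UV dV.
exists s; split=> //; first by rewrite -st leq_addr.
move=> sr v /Hb [c [Uc _]]; have t0 : t = 0%N by move: st sr; clear; lia.
by move: Uc; rewrite /comb big1 ?subr0 // => i; have := ltn_ord i; rewrite [X in (_ < X)%N]t0.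
Qed.

Lemma fdim_pos (L : lmodType K) (V : L -> Prop) r :
  closed_lin V -> fdim V r -> (0 < r)%N -> exists2 v, V v & v != 0.
Proof.
case: r => // r lV [b [Vb Hb]] _; exists (b ord0) => //; apply/eqP => b0.
have /(comb_inj lV Vb Hb)/rowP/(_ ord0) : comb b (delta_mx 0 ord0) = comb b 0.
  by rewrite comb_delta comb0.
by rewrite !mxE !eqxx => /eqP; rewrite oner_eq0.
Qed.

Section RankNullity.
Variables (L L' : lmodType K) (F : L -> L').
Hypothesis F_lin : forall a u v, F (a *: u + v) = a *: F u + F v.

Let F0 : F 0 = 0.
Proof. by have := F_lin (-1) 0 0; rewrite scaler0 addr0 scaleN1r addNr. Qed.

Let FB u v : F (u - v) = F u - F v.
Proof. by rewrite [u - v]addrC -scaleN1r F_lin scaleN1r addrC. Qed.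

Let F_comb r (b : 'I_r -> L) c : F (comb b c) = comb (fun i => F (b i)) c.
Proof.
rewrite /comb; elim: (index_enum _) => [|i s IH]; first by rewrite !big_nil.
by rewrite !big_cons F_lin IH.
Qed.

Lemma closed_ker (V : L -> Prop) : closed_lin V -> closed_lin (fun v => V v /\ F v = 0).
Proof.
move=> [V0 Vl]; split=> [|a u v [Vu Fu] [Vv Fv]]; first by [].
by split; [apply: Vl|rewrite F_lin Fu Fv scaler0 addr0].
Qed.

Lemma closed_im (V : L -> Prop) : closed_lin V -> closed_lin (fun w => exists2 v, V v & F v = w).
Proof.
move=> [V0 Vl]; split=> [|a u v [u' Vu <-] [v' Vv <-]]; first by exists 0.
by exists (a *: u' + v'); [apply: Vl|rewrite F_lin].
Qed.

Lemma rank_nullity (V : L -> Prop) r : closed_lin V -> fdim V r ->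
  exists s t, [/\ (s + t = r)%N, fdim (fun v => V v /\ F v = 0) s
                & fdim (fun w => exists2 v, V v & F v = w) t].
Proof.
move=> lV dV.
have [s [t [b [st dU Vb Hb]]]] := fdim_quotient lV (closed_ker lV) (fun v h => proj1 h) dV.
exists s, t; split=> //; exists (fun i => F (b i)); split=> [i|_ [v Vv <-]]; first by exists (b i).
have [c [[_ Uc] uc]] := Hb v Vv; exists c; split=> [|c' e].
  by apply/eqP; rewrite -subr_eq0 -F_comb -FB Uc.
apply: uc; split; first by apply: closedB => //; apply: closed_comb.
by rewrite FB F_comb e subrr.
Qed.

Lemma fdim_inj_im (V : L -> Prop) r : closed_lin V -> (forall v, V v -> F v = 0 -> v = 0) ->
  fdim V r -> fdim (fun w => exists2 v, V v & F v = w) r.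
Proof.
move=> lV Finj [b [Vb Hb]]; exists (fun i => F (b i)); split=> [i|_ [v Vv <-]]; first by exists (b i).
have [c [vc uc]] := Hb v Vv; exists c; split=> [|c' e]; first by rewrite -F_comb -vc.
apply: uc; apply/eqP; rewrite -subr_eq0; apply/eqP/Finj.
  by apply: closedB => //; apply: closed_comb.
by rewrite FB F_comb e subrr.
Qed.

End RankNullity.

Lemma fdim_prod (L L' : lmodType K) (V : L -> Prop) (V' : L' -> Prop) r s :
  closed_lin V -> closed_lin V' -> fdim V r -> fdim V' s ->
  fdim (fun w : L * L' => V w.1 /\ V' w.2) (r + s).
Proof.
move=> [V0 _] [V'0 _] [b [Vb Hb]] [b' [Vb' Hb']].
pose B (i : 'I_(r + s)) : L * L' := match fintype.split i with inl i => (b i, 0) | inr i => (0, b' i) end.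
have fst_sum (I : Type) (l : seq I) (f : I -> L * L') : (\sum_(i <- l) f i).1 = \sum_(i <- l) (f i).1.
  by elim: l => [|i l IH]; rewrite ?big_nil // !big_cons -IH.
have snd_sum (I : Type) (l : seq I) (f : I -> L * L') : (\sum_(i <- l) f i).2 = \sum_(i <- l) (f i).2.
  by elim: l => [|i l IH]; rewrite ?big_nil // !big_cons -IH.
have BE c : comb B c = (comb b (lsubmx c), comb b' (rsubmx c)).
  rewrite [LHS]surjective_pairing /comb fst_sum snd_sum; congr (_, _); rewrite big_split_ord /=.
    rewrite [X in _ + X]big1 ?addr0 => [|i _]; last by rewrite /B (unsplitK (inr i)) scaler0.
    by apply: eq_bigr => i _; rewrite /B (unsplitK (inl i)) mxE.
  rewrite [X in X + _]big1 ?add0r => [|i _]; last by rewrite /B (unsplitK (inl i)) scaler0.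
  by apply: eq_bigr => i _; rewrite /B (unsplitK (inr i)) mxE.
exists B; split=> [i|[v v'] /= [/Hb [c [vc uc]] /Hb' [c' [vc' uc']]]].
  by rewrite /B; case: (fintype.split i) => a /=; split.
exists (row_mx c c'); split=> [|d]; first by rewrite BE row_mxKl row_mxKr -vc -vc'.
rewrite BE => -[e e']; rewrite -[d]hsubmxK; congr row_mx; [exact: uc|exact: uc'].
Qed.

End FiniteDim.

Lemma homog_closed (K : fieldType) (N k : nat) :
  closed_lin (fun A : {mpoly K[N]} => A \is k.-homog).
Proof. by split=> [|a u v hu hv]; [apply: dhomog0|apply: rpredD; rewrite ?rpredZ]. Qed.

Lemma fdim_homog (K : fieldType) (N k : nat) :
  fdim (fun A : {mpoly K[N.+1]} => A \is k.-homog) 'C(k + N, k).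
Proof.
have [v2r lv [r2v vK rK]] := @dhomog_vecaxiom N K k.
pose v2l : {linear _ -> _} := HB.pack v2r (GRing.isLinear.Build _ _ _ _ v2r lv).
exists (fun i => mpoly_of_dhomog (r2v (delta_mx 0 i))); split=> [i|A hA]; first exact: dhomog_is_dhomog.
have E c : comb (fun i => mpoly_of_dhomog (r2v (delta_mx 0 i))) c = mpoly_of_dhomog (r2v c).
  rewrite /comb; transitivity (mpoly_of_dhomog (\sum_i c 0 i *: r2v (delta_mx 0 i))).
    by rewrite raddf_sum; apply: eq_bigr.
  congr mpoly_of_dhomog; apply: (can_inj vK); rewrite rK -[v2r]/(v2l : _ -> _) linear_sum.
  rewrite [RHS]row_sum_delta; apply: eq_bigr => i _; rewrite linearZ /=; congr (_ *: _); exact: rK.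
exists (v2r (DHomog hA)); split=> [|c]; first by rewrite E vK.
by rewrite E => e; rewrite -[c]rK; congr v2r; apply: val_inj.
Qed.

Lemma fdim_form2 (K : fieldType) (k : nat) :
  fdim (fun A : {mpoly K[2]} => A \is k.-homog) k.+1.
Proof. by have := @fdim_homog K 1 k; rewrite addn1 binSn. Qed.

Lemma fdim_form3 (K : fieldType) (k : nat) :
  fdim (fun A : {mpoly K[3]} => A \is k.-homog) 'C(k.+2, 2).
Proof. by have := @fdim_homog K 2 k; rewrite -[X in 'C(_, X)](addnK 2 k) bin_sub ?leq_addl // addn2. Qed.

Lemma binZ n : 2%:Z * ('C(n.+1, 2))%:Z = (n%:Z + 1) * n%:Z.
Proof. by have := mul_bin_diag n.+1 1; rewrite bin1 /=; clear; lia. Qed.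

(** Riemann-Roch will hold for all large multiples x of a class with both sides affine in x; two
    consecutive values separate the coefficient from the constant. *)
Lemma affine_int_eq0 x (F C : int) :
  2%:Z * x.+1%:Z * F = C -> 2%:Z * x.+2%:Z * F = C -> F = 0 /\ C = 0.
Proof.
move=> <-; rewrite !intS => h; have F0 : F = 0 by move: h; clear; lia.
by rewrite F0 mulr0.
Qed.

Section JetValues.
Variable K : closedFieldType.
Implicit Types (M : 'M[K]_3) (A B : {mpoly K[3]}).

Lemma jet_coef0 M A : (jet M A)`_0 = (A.@[M 0])%:MP.
Proof.
rewrite -horner_coef0.
pose g1 : {rmorphism {mpoly K[3]} -> {mpoly K[2]}} := horner_eval 0 \o jet M.
pose g2 : {rmorphism {mpoly K[3]} -> {mpoly K[2]}} := @mpolyC 2 K \o meval (M 0).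
suff H : g1 =1 g2 by exact: H.
apply: mpoly_rmorph_eq => [c|i]; rewrite /g1 /g2 /= /horner_eval.
  by rewrite jetC hornerC mevalC.
by rewrite jetXi mevalXU /jet_arg !hornerE ?mulr0 ?addr0.
Qed.

Lemma ordge_mulr M c A B : ordge M c A -> ordge M c (A * B).
Proof. by move=> hA; rewrite -[c]addn0; apply: ordgeM. Qed.

Lemma ordge_exp M c A : ordge M 1 A -> ordge M c (A ^+ c).
Proof.
move=> hA; elim: c => [|c IH]; first exact: ordge0.
by rewrite exprS -add1n; apply: ordgeM.
Qed.

End JetValues.

(** * Linear systems with assigned multiplicities *)

Section Multiplicities.
Variables (K : closedFieldType) (n : nat) (P : 'I_n -> 'rV[K]_3).
Hypothesis P_neq0 : forall j, P j != 0.
Hypothesis P_distinct : forall j j', proj_eq (P j) (P j') -> j = j'.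
Variable M : 'I_n -> 'M[K]_3.
Hypothesis M_unit : forall j, M j \in unitmx.
Hypothesis M_row : forall j, M j 0 = P j 0 :> ('I_3 -> K).
Local Notation R := {mpoly K[3]}.
Local Notation S := {mpoly K[2]}.
Implicit Types (c : 'I_n -> nat) (A : R).

(* H^0(X, kL - \sum_j c_j E_j). *)
Definition W k c A := A \is k.-homog /\ forall j, ordge (M j) (c j) A.

Lemma W_closed k c : closed_lin (W k c).
Proof.
split=> [|a u v [hu ou] [hv ov]].
  by split=> [|j]; [apply: dhomog0|apply: ordge_zero].
split=> [|j]; first by case: (homog_closed K 3 k) => _; apply.
by apply: ordgeD => //; apply: ordgeZ.
Qed.

Lemma W_M k k' c c' A B : W k c A -> W k' c' B -> W (k + k') (fun j => c j + c' j)%N (A * B).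
Proof. by move=> [hA oA] [hB oB]; split=> [|j]; [apply: dhomogM|apply: ordgeM]. Qed.

Lemma W_ext k c c' A : c =1 c' -> W k c A -> W k c' A.
Proof. by move=> cc' [hA oA]; split=> // j; rewrite -cc'. Qed.

Lemma W_le k c c' A : (forall j, c' j <= c j)%N -> W k c A -> W k c' A.
Proof. by move=> cc' [hA oA]; split=> // j; apply: ordge_le (cc' j) (oA j). Qed.

Definition lead_jet j a A : S := (jet (M j) A)`_a.

Lemma lead_jet_lin j a x A B : lead_jet j a (x *: A + B) = x *: lead_jet j a A + lead_jet j a B.
Proof. by rewrite /lead_jet rmorphD /= jetZ coefD coefZ mul_mpolyC. Qed.

Lemma ordgeS j a A : ordge (M j) a.+1 A <-> ordge (M j) a A /\ lead_jet j a A = 0.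
Proof.
split=> [h|[h h0] b]; first by split=> [b lt|]; apply: h => //; apply: ltnW.
by rewrite ltnS leq_eqVlt => /orP[/eqP->|/h].
Qed.

Let bump c j0 j := (c j + (j == j0))%N.

Lemma W_bump k c j0 A : W k (bump c j0) A <-> W k c A /\ lead_jet j0 (c j0) A = 0.
Proof.
rewrite /bump; split=> [[hA oA]|[[hA oA] l0]].
  split; first by split=> // j; apply: ordge_le (oA j); apply: leq_addr.
  by have := oA j0; rewrite eqxx addn1 => /ordgeS [].
split=> // j; case: (eqVneq j j0) => [->|_]; last by rewrite addn0.
by rewrite addn1; apply/ordgeS.
Qed.

Lemma lead_jet_homog j e A : lead_jet j e A \is e.-homog.
Proof. exact: jet_graded. Qed.

(** Raising c_j0 by one kills the leading coefficient of the jet, a binary form of degree c_j0; this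
    is at most c_j0 + 1 linear conditions. *)
Lemma fdim_W_step k c j0 r : fdim (W k c) r ->
  exists s t, [/\ (s + t = r)%N, fdim (W k (bump c j0)) s, (t <= (c j0).+1)%N &
   (forall B : S, B \is (c j0).-homog -> exists2 A, W k c A & lead_jet j0 (c j0) A = B) -> t = (c j0).+1].
Proof.
move=> dW; have ll := @lead_jet_lin j0 (c j0).
have [s [t [st ds dt]]] := rank_nullity ll (W_closed k c) dW.
have cim := closed_im ll (W_closed k c).
have him w : (exists2 v, W k c v & lead_jet j0 (c j0) v = w) -> w \is (c j0).-homog.
  by move=> [A _ <-]; apply: lead_jet_homog.
have le := fdim_le (homog_closed K 2 (c j0)) cim him dt (fdim_form2 K (c j0)).
exists s, t; split=> //.
  by apply: fdim_ext ds => A; rewrite W_bump.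
move=> surj; apply/eqP; rewrite eqn_leq le /=.
exact: (fdim_le cim (homog_closed K 2 (c j0)) surj (fdim_form2 K (c j0)) dt).
Qed.

(* Multiply a form in two variables that has the prescribed leading term at
   P_j0 by lines through the other P_j that avoid P_j0. *)
Lemma lead_jet_surj k c j0 (B : S) : (\sum_j c j <= k)%N -> B \is (c j0).-homog ->
  exists2 A, W k c A & lead_jet j0 (c j0) A = B.
Proof.
move=> lek hB; pose N := invmx (M j0).
have MN : M j0 *m N = 1%:M by rewrite mulmxV.
have Hl j : exists l : R, l \is 1.-homog /\ (j != j0 -> ordge (M j) 1 l /\ (jet (M j0) l)`_0 = 1).
  have [->|ne] := eqVneq j j0; first by exists 'X_0; split; [apply: dhomogXi|].
  have [i hi] := cross_PP P_neq0 P_distinct ne.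
  exists ((cross (P j 0) (P j0 0) i)^-1 *: cross (fun l => (P j 0 l)%:MP) (fun l => 'X_l) i); split.
    apply/rpredZ/rpredB; rewrite mul_mpolyC; exact/rpredZ/dhomogXi.
  move=> _; split=> [[|//] _|]; rewrite jet_coef0 mevalZ mevalB !mevalM !mevalC !mevalXU !M_row.
    by rewrite mulrC [P j 0 (i + 2) * _]mulrC subrr mul0r mpolyC0.
  by rewrite mulVf // mpolyC1.
have [l Hl'] := fin_all_exists Hl.
(* This linear form has jet 1 at P_j0, so its powers fill up the degree without changing the leading
   term. *)
have jX : jet (M j0) (linsub N 'X_0) = 1.
  by rewrite jet_linsub linsub_comp MN linsub1 jetXi !jet_arg1.
have jB : jet (M j0) (linsub N (emb12 B)) = B *: 'X^(c j0).
  by rewrite jet_linsub linsub_comp MN linsub1 (jet1_emb12 hB).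
have [w kE] : exists w, k = (\sum_(j | j != j0) c j + c j0 + w)%N.
  exists (k - \sum_j c j)%N.
  by rewrite -{1}(subnKC lek) [X in (X + _)%N](bigD1 j0) //= [X in (X + _)%N]addnC.
exists (\prod_(j | j != j0) l j ^+ c j * linsub N (emb12 B) * linsub N 'X_0 ^+ w).
  split=> [|j].
    rewrite kE; apply: dhomogM; first apply: dhomogM.
    - elim/big_rec2: _ => [|j A e _ IH]; first exact: dhomog1.
      apply: dhomogM => //; have [hl _] := Hl' j.
      by have := dhomogMn (c j) hl; rewrite mul1n.
    - exact/linsub_homog/emb12_homog.
    - by have := dhomogMn w (linsub_homog N (@dhomogXi K 3 0)); rewrite mul1n.
  rewrite -mulrA; have [->|ne] := eqVneq j j0; last first.
    by rewrite (bigD1 j) //= -mulrA; apply/ordge_mulr/ordge_exp; have [_ /(_ ne) []] := Hl' j.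
  rewrite mulrC; apply/ordge_mulr/ordge_mulr => e lt.
  by rewrite jB coefZ coefXn; case: eqP lt => [->|_]; rewrite ?ltnn // mulr0.
rewrite /lead_jet !rmorphM rmorphXn /= jX expr1n mulr1 jB -scalerAr coefZ coefMXn ltnn subnn.
rewrite -horner_coef0 rmorph_prod -/(horner_eval 0 _) rmorph_prod big1 ?mulr1 // => j ne.
have [_ /(_ ne) [_ e]] := Hl' j.
by rewrite -[LHS]/(horner_eval 0 (jet (M j0) (l j ^+ c j))) rmorphXn /= /horner_eval horner_exp horner_coef0 e expr1n.
Qed.

(** The two halves are used differently: the inequality, for all multiplicities, bounds from below
    in the induction along E; the equality, for \sum_j c_j <= k, serves the ample class. *)
Lemma fdim_W k c : exists r, [/\ fdim (W k c) r,
  ('C(k.+2, 2) <= r + \sum_j 'C((c j).+1, 2))%N &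
  (\sum_j c j <= k)%N -> 'C(k.+2, 2) = (r + \sum_j 'C((c j).+1, 2))%N].
Proof.
move: {2}(\sum_j c j)%N (leqnn (\sum_j c j)%N) => N; elim: N c => [|N IH] c.
  rewrite leqn0 sum_nat_eq0 => /forallP c0; exists 'C(k.+2, 2).
  have {}c0 j : c j = 0%N by apply/eqP; apply: implyP (c0 j) _.
  have E : (\sum_j 'C((c j).+1, 2) = 0)%N by rewrite big1 // => j _; rewrite c0.
  rewrite E addn0; split=> //; apply: fdim_ext (fdim_form3 K k) => A; split=> [hA|[]//].
  by split=> // j; rewrite c0; apply: ordge0.
have [/existsP [j0 cj0]|/existsPn c0 _] := boolP [exists j, c j != 0%N]; last first.
  by apply: IH; rewrite big1 // => j _; apply/eqP; have := c0 j; rewrite negbK.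
pose c1 j := (c j - (j == j0))%N.
have cE : bump c1 j0 =1 c.
  move=> j; rewrite /bump /c1; case: eqP => [->|_]; last by rewrite subn0 addn0.
  by rewrite subn1 addn1 prednK // lt0n.
have sumE : (\sum_j c j = (\sum_j c1 j).+1)%N.
  rewrite -(eq_bigr _ (fun j _ => cE j)) big_split /= -addn1; congr (_ + _)%N.
  by rewrite (bigD1 j0) //= eqxx big1 ?addn0 // => j /negPf ->.
have bE : (\sum_j 'C((c j).+1, 2) = \sum_j 'C((c1 j).+1, 2) + (c1 j0).+1)%N.
  rewrite (bigD1 j0) //= [in RHS](bigD1 j0) //= addnAC; congr (_ + _)%N.
    by rewrite -(cE j0) /bump eqxx addn1 binS bin1 addnC.
  by apply: eq_bigr => j ne; rewrite -(cE j) /bump (negPf ne) addn0.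
rewrite sumE ltnS => /IH [r1 [d1 le1 eq1]].
have [s [t [st ds le_t teq]]] := fdim_W_step j0 d1.
exists s; split.
- by apply: fdim_ext ds => A; split; apply: W_ext => // j; rewrite cE.
- by rewrite bE; move: le1 st le_t; clear; lia.
move=> lek; have te : t = (c1 j0).+1.
  by apply: teq => B hB; apply: lead_jet_surj => //; apply: ltnW.
by rewrite bE eq1 1?ltnW // -st te; clear; lia.
Qed.

End Multiplicities.

(** * Degrees of line bundles on the curve *)

Section FieldIdentities.
Variable F : fieldType.
Implicit Types A B G H g h s : F.

Lemma unit_cancel g h s : g != 0 -> h != 0 -> s != 0 -> g * h * (s / h / g * s^-1) = 1.
Proof. by move=> g0 h0 s0; field; rewrite g0 h0 s0. Qed.

Lemma cross_ratio A B G H G' H' g g' h : B != 0 -> H != 0 -> G' != 0 -> H' != 0 -> h != 0 ->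
  g / g' = A / B -> g * h = G / H -> g' * h = G' / H' -> A * (H * G') = B * (G * H').
Proof.
move=> B0 H0 G'0 H'0 h0 gg gE g'E.
have g'E' : g' = G' / H' / h by rewrite -g'E mulfK.
have gE' : g = G / H / h by rewrite -gE mulfK.
move: gg; rewrite gE' g'E' => e; have -> : A = B * (G / H / h / (G' / H' / h)) by rewrite e mulrCA divff // mulr1.
by field; rewrite H0 G'0 H'0 h0.
Qed.

Lemma cross_ratio_div A B G H G' H' g g' : B != 0 -> G != 0 -> G' != 0 -> g' != 0 ->
  A * (H * G') = B * (G * H') -> g / g' = A / B -> g * (H / G) = g' * (H' / G').
Proof.
move=> B0 G0 G'0 g'0 E gg; have -> : g = A / B * g' by rewrite -gg divfK.
have -> : H' = A * (H * G') / (B * G).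
  by apply: (canRL (mulfK _)); rewrite ?mulf_neq0 // E mulrC mulrA.
by field; rewrite B0 G0 G'0.
Qed.

End FieldIdentities.

Section LocalOP1.
Variable K : closedFieldType.
Local Notation S := {mpoly K[2]}.

Lemma OP1_neg (k : int) (c : ratfun K 2) : k < 0 -> (forall q : 'rV[K]_2, q != 0 -> OP1 k q c) -> c = 0.
Proof. by move=> k0 /OP1_global [A [-> _ /(_ k0) ->]]; rewrite tofrac0. Qed.

Lemma OP1_mul (k k' : int) (q : 'rV[K]_2) (c c' : ratfun K 2) : OP1 k q c -> OP1 k' q c' -> OP1 (k + k') q (c * c').
Proof.
move=> [u [v [A [B [hA hB <- B0 ->]]]]] [u' [v' [A' [B' [hA' hB' <- B0' ->]]]]].
exists (u + u')%N, (v + v')%N, (A * A'), (B * B'); split; try exact: dhomogM.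
- by rewrite !PoszD; ring.
- by rewrite mevalM mulf_neq0.
- by rewrite tofrac_divM.
Qed.

Lemma OP1_frac (u v : nat) (A B : S) (q : 'rV[K]_2) : A \is u.-homog -> B \is v.-homog -> B.@[q 0] != 0 ->
  OP1 (u%:Z - v%:Z) q (A%:F / B%:F).
Proof. by move=> hA hB B0; exists u, v, A, B. Qed.

Lemma OP1_1 (q : 'rV[K]_2) : OP1 0 q (1 : ratfun K 2).
Proof.
exists 0%N, 0%N, 1, 1; split; rewrite ?dhomog1 //; first by rewrite meval1 oner_eq0.
by rewrite tofrac1 divr1.
Qed.

Lemma OP1_gen (k : int) (q : 'rV[K]_2) : q != 0 -> exists s : ratfun K 2, [/\ s != 0, OP1 k q s & OP1 (- k) q s^-1].
Proof.
move=> q0; have Hs (l : nat) : exists s : ratfun K 2, [/\ s != 0, OP1 l q s & OP1 (- l%:Z) q s^-1].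
  have [A hA Aq] := form2_nonzero_at l q0.
  have A0 : A != 0 by apply: contraNneq Aq => ->; rewrite meval0.
  exists A%:F; split; first by rewrite tofrac_eq0.
    have := @OP1_frac l 0 A 1 q hA (dhomog1 _ _); rewrite subr0 tofrac1 divr1; apply.
    by rewrite meval1 oner_eq0.
  by have := @OP1_frac 0 l 1 A q (dhomog1 _ _) hA Aq; rewrite tofrac1 sub0r mul1r.
case: k => l; first exact: Hs.
rewrite NegzE opprK; have [s [s0 h1 h2]] := Hs l.+1.
exists s^-1; split; [by rewrite invr_eq0|exact: h2|rewrite invrK; exact: h1].
Qed.

Lemma generates_OP1 (k : int) (q : 'rV[K]_2) (c : ratfun K 2) : q != 0 -> generates (OP1 k q) (OP1 0 q) c ->
  OP1 k q c /\ OP1 (- k) q c^-1.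
Proof.
move=> q0 [c0 Hc]; split; first by apply/Hc; rewrite divff //; apply: OP1_1.
have [s [s0 h1 h2]] := OP1_gen k q0.
have /(OP1_mul h2) : OP1 0 q (s / c) by apply/Hc.
by rewrite addr0 mulrA mulVf // mul1r.
Qed.

Lemma OP1_unit_degree (k : int) (c : ratfun K 2) : c != 0 ->
  (forall q : 'rV[K]_2, q != 0 -> OP1 k q c) ->
  (forall q : 'rV[K]_2, q != 0 -> OP1 (- k) q c^-1) -> k = 0.
Proof.
move=> c0 h1 h2; have [lt|[lt|//]] : k < 0 \/ - k < 0 \/ k = 0 by clear; lia.
  by case/eqP: c0; apply: OP1_neg lt h1.
by case/eqP: c0; apply/eqP; rewrite -invr_eq0; apply/eqP; apply: OP1_neg lt h2.
Qed.

End LocalOP1.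

Section Curve.
Variables (K : closedFieldType) (n : nat) (P : 'I_n -> 'rV[K]_3).
Hypothesis P_neq0 : forall j, P j != 0.
Hypothesis P_distinct : forall j j', proj_eq (P j) (P j') -> j = j'.
Variable M : 'I_n -> 'M[K]_3.
Hypothesis M_unit : forall j, M j \in unitmx.
Hypothesis M_row : forall j, M j 0 = P j 0 :> ('I_3 -> K).
Local Notation T := {mpoly K[n.+1 * 3]}.
Local Notation R := {mpoly K[3]}.
Local Notation S := {mpoly K[2]}.
Implicit Types (G H : T) (z : 'M[K]_(n.+1, 3)).
Local Notation sec := (sec P).
Local Notation sunit := (sunit P).

Definition delta0 (t : nat) (i : 'I_n.+1) : int := t%:Z * ((i == ord0) : nat)%:Z.

Lemma OXL_sec t z f : OXL P t z f <-> sec (delta0 t) z f.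
Proof.
split=> [[e [G [H [hG hH H0 fE]]]]|[u [v [G [H [hG hH uv H0 fE]]]]]].
  exists (fun i => e i + (if i == ord0 then t else 0))%N, e, G, H; split=> //; last first.
    by rewrite sg.unlock.
  by move=> i; rewrite /delta0 PoszD addrAC subrr add0r; case: eqP => _; rewrite ?mulr1 ?mulr0.
exists v, G, H; split=> //; last by rewrite fE sg.unlock.
apply: mh_ext hG => i; have := uv i; rewrite /delta0; case: (i == ord0); rewrite ?mulr1 ?mulr0; clear; lia.
Qed.

Variables (phi : 'M[S]_(n.+1, 3)) (dg : 'I_n.+1 -> nat).
Hypothesis phi_homog : forall i k, phi i k \is (dg i).-homog.
Hypothesis phi_X : forall q : 'rV[K]_2, q != 0 -> blowup_pt P (image_pt phi q).

Lemma evpt_image q G : evpt (image_pt phi q) G = (sp phi G).@[q 0].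
Proof.
rewrite sp.unlock /subst meval_mmap /evpt /image_pt; apply: meval_eq => i.
by rewrite -map_mxvec mxE.
Qed.

Lemma form2_ext (A B : S) : (forall q : 'rV[K]_2, q != 0 -> A.@[q 0] = B.@[q 0]) -> A = B.
Proof.
move=> AB; apply/eqP; rewrite -subr_eq0; apply/eqP.
suff /eqP : (A - B) * 'X_0 = 0 by rewrite mulf_eq0 (negPf (mpolyXU_neq0 _ _)) orbF => /eqP.
apply: mpoly_eq0_closed => v; rewrite mevalM mevalXU.
have [->|v0] := eqVneq (v 0) 0; first by rewrite mulr0.
pose q : 'rV[K]_2 := \row_i v i.
have qv : q 0 =1 v by move=> i; rewrite mxE.
have q0 : q != 0 by apply: contraNneq v0 => e; rewrite -qv e mxE.
by rewrite mevalB -!(meval_eq _ qv) (AB q q0) subrr mul0r.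
Qed.

(** Polynomials with the same image at the generic point agree at the points of X, and the curve
    lies in X. *)
Lemma sp_eq e G H : multihomog e G -> multihomog e H -> sg P G = sg P H -> sp phi G = sp phi H.
Proof.
move=> hG hH GH; apply: form2_ext => q q0; rewrite -!evpt_image.
exact: (evpt_eq P_neq0 P_distinct M_unit M_row (phi_X q0) hG hH GH).
Qed.

Lemma sp_neq0 q G : evpt (image_pt phi q) G != 0 -> sp phi G != 0.
Proof. by rewrite evpt_image; apply: contraNneq => ->; rewrite meval0. Qed.

Lemma sec_unit e z f f' : blowup_pt P z -> sec e z f -> sec (fun i => - e i) z f' -> f * f' = 1 ->
  sunit e z f.
Proof.
move=> zX [u [v [G [H [hG hH uv H0 fE]]]]] [u' [v' [G' [H' [hG' hH' uv' H0' f'E]]]]] ff'.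
exists u, v, G, H; split=> //; split=> //.
have sH := evpt_sg_neq0 P_neq0 P_distinct M_unit M_row zX hH H0.
have sH' := evpt_sg_neq0 P_neq0 P_distinct M_unit M_row zX hH' H0'.
have E : sg P (G * G') = sg P (H * H').
  rewrite !rmorphM /=; apply: tofrac_inj; rewrite -[RHS]mul1r -ff' fE f'E tofrac_divM divfK //.
  by rewrite tofrac_eq0 mulf_neq0.
have hHH : multihomog (fun i => u i + u' i)%N (H * H').
  by apply: mh_ext (mhM hH hH') => i; have := uv i; have := uv' i; clear; lia.
have := evpt_eq P_neq0 P_distinct M_unit M_row zX (mhM hG hG') hHH E.
by rewrite !evptM => EE; apply: contraNneq (mulf_neq0 H0 H0') => G0; rewrite -EE G0 mul0r.
Qed.

Lemma generates_sunit (J : ratfun K 3 -> Prop) e (h : ratfun K 3) z (g : ratfun K 3) : blowup_pt P z -> h != 0 ->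
  (forall f, J f <-> sec e z (f * h)) -> generates J (OXL P 0 z) g -> sunit e z (g * h).
Proof.
move=> zX h0 JE [g0 Hg].
have [s hs] := sunit_exists e zX.
have s0 := sunit_neq0 P_neq0 P_distinct M_unit M_row zX hs.
have gh : sec e z (g * h).
  apply/JE/Hg; rewrite divff //; apply/OXL_sec; apply: sec_ext (sunit_sec (sunit1 P z)) => i.
  by rewrite /delta0 mul0r.
have sg' : sec (fun=> 0) z (s / h / g).
  have shh : s / h * h = s by rewrite (divfK h0).
  have /OXL_sec : OXL P 0 z (s / h / g).
    by apply: (proj1 (Hg _)); apply: (proj2 (JE _)); rewrite shh; apply: sunit_sec.
  by apply: sec_ext => i; rewrite /delta0 mul0r.
have gs : sec (fun i => - e i) z (s / h / g * s^-1).
  by apply: sec_ext (sec_mul sg' (sunit_sec (sunit_inv hs))) => i; rewrite add0r.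
exact: (sec_unit zX gh gs (unit_cancel g0 h0 s0)).
Qed.

Let degs (u : 'I_n.+1 -> nat) := (\sum_i u i * dg i)%N.

(** The trivialization of [degree_on] and that by multidegrees differ by a section of O(k - \sum_i
    e_i dg_i) without zeros, which forces the degree to be 0. *)
Lemma degree_sec (J : sheaf K n) (e : 'I_n.+1 -> int) (h : ratfun K 3) (k : int) : h != 0 ->
  (forall z, blowup_pt P z -> forall f, J z f <-> sec e z (f * h)) ->
  degree_on P phi J k -> k = \sum_i e i * (dg i)%:Z.
Proof.
move=> h0 JE [g [c [Hgc Hpb]]].
have Hq (q : 'rV[K]_2) : q != 0 -> exists u v G H, [/\ multihomog u G, multihomog v H,
    forall i, (u i)%:Z - (v i)%:Z = e i,
    evpt (image_pt phi q) G != 0 /\ evpt (image_pt phi q) H != 0 & g q * h = (sg P G)%:F / (sg P H)%:F].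
  by move=> q0; have [hg _] := Hgc q q0; exact: (generates_sunit (phi_X q0) h0 (JE _ (phi_X q0)) hg).
have p0 : pt2 1 0 != 0 :> 'rV[K]_2 by apply: pt2_neq0; rewrite oner_eq0.
have [u [v [G [H [hG hH uv [G0 H0] gE]]]]] := Hq _ p0.
set p := pt2 1 0 in p0 G0 H0 gE.
have sG0 := sp_neq0 G0; have sH0 := sp_neq0 H0.
(* The quotient of [c q] by the pullback of the local generator at q, written at q = p; the
   compatibility of [g] and [c] shows that it does not depend on q. *)
pose psi := c p * ((sp phi H)%:F / (sp phi G)%:F).
have Hpsi (q : 'rV[K]_2) : q != 0 -> exists u' v' G' H', [/\ multihomog u' G', multihomog v' H',
    forall i, (u' i)%:Z - (v' i)%:Z = e i,
    (sp phi G').@[q 0] != 0 /\ (sp phi H').@[q 0] != 0 & psi = c q * ((sp phi H')%:F / (sp phi G')%:F)].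
  move=> q0; have [u' [v' [G' [H' [hG' hH' uv' [G0' H0'] gE']]]]] := Hq _ q0.
  exists u', v', G', H'; split=> //; first by rewrite -!evpt_image.
  have sG0' := sp_neq0 G0'; have sH0' := sp_neq0 H0'.
  have [w [A [B [hA hB B0 ggE ccE]]]] := Hpb p q p0 q0.
  have [[gp0 _] [cp0 _]] := Hgc p p0; have [[gq0 _] [cq0 _]] := Hgc q q0.
  have sgn (z : 'rV[K]_2) (u0 : 'I_n.+1 -> nat) X : z != 0 -> multihomog u0 X -> evpt (image_pt phi z) X != 0 -> sg P X != 0.
    move=> z0 hX; exact: (evpt_sg_neq0 P_neq0 P_distinct M_unit M_row (phi_X z0) hX).
  have gG := sgn _ _ _ p0 hG G0; have gH := sgn _ _ _ p0 hH H0.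
  have gG' := sgn _ _ _ q0 hG' G0'; have gH' := sgn _ _ _ q0 hH' H0'.
  have gB : sg P B != 0.
    apply: contraNneq B0 => e0; rewrite -/(sp phi B) in e0 *.
    have := @sp_eq w B 0 hB (@mh0 _ _ _); rewrite e0 rmorph0 => /(_ erefl).
    by rewrite sp.unlock => ->; rewrite /subst rmorph0.
  have gE2 : g p / g q = (sg P A)%:F / (sg P B)%:F by rewrite ggE sg.unlock.
  have fr (X : R) : X != 0 -> X%:F != 0 by rewrite tofrac_eq0.
  have E : sg P (A * (H * G')) = sg P (B * (G * H')).
    rewrite !rmorphM /=; apply: tofrac_inj; rewrite !tofracM.
    by apply: (cross_ratio (fr _ gB) (fr _ gH) (fr _ gG') (fr _ gH') h0 gE2 gE gE').
  have {}E : sp phi (A * (H * G')) = sp phi (B * (G * H')).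
    apply: (sp_eq (mhM hA (mhM hH hG')) _ E); apply: mh_ext (mhM hB (mhM hG hH')) => i.
    by have := uv i; have := uv' i; clear; lia.
  have B0' : sp phi B != 0 by rewrite sp.unlock.
  have cc : c p / c q = (sp phi A)%:F / (sp phi B)%:F by rewrite ccE sp.unlock.
  have {}E : (sp phi A)%:F * ((sp phi H)%:F * (sp phi G')%:F) = (sp phi B)%:F * ((sp phi G)%:F * (sp phi H')%:F).
    by rewrite -!tofracM; congr (_%:F); move: E; rewrite !rmorphM.
  have sF (X : S) : X != 0 -> X%:F != 0 by rewrite tofrac_eq0.
  exact: (cross_ratio_div (sF _ B0') (sF _ sG0) (sF _ sG0') cq0 E cc).
have psi0 : psi != 0.
  have [_ [cp0 _]] := Hgc p p0.
  have hH0 : (sp phi H)%:F != 0 by rewrite tofrac_eq0.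
  have hG0 : ((sp phi G)%:F)^-1 != 0 by rewrite invr_eq0 tofrac_eq0.
  exact: (mulf_neq0 cp0 (mulf_neq0 hH0 hG0)).
have degE u' v' : (forall i, (u' i)%:Z - (v' i)%:Z = e i) ->
   (degs u')%:Z - (degs v')%:Z = \sum_i e i * (dg i)%:Z.
  move=> uv'; rewrite /degs !(big_morph Posz PoszD (erefl _)) -sumrB; apply: eq_bigr => i _.
  by rewrite -uv' !PoszM mulrBl.
have h1 : forall q : 'rV[K]_2, q != 0 -> OP1 (k - \sum_i e i * (dg i)%:Z) q psi.
  move=> q q0; have [u' [v' [G' [H' [hG' hH' uv' [G0' H0'] ->]]]]] := Hpsi q q0.
  have [_ /(generates_OP1 q0) [hc _]] := Hgc q q0.
  apply: (OP1_mul hc); rewrite -(degE _ _ uv') opprB.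
  by apply: OP1_frac => //; apply: sp_homog.
have h2 : forall q : 'rV[K]_2, q != 0 -> OP1 (\sum_i e i * (dg i)%:Z - k) q psi^-1.
  move=> q q0; have [u' [v' [G' [H' [hG' hH' uv' [G0' H0'] ->]]]]] := Hpsi q q0.
  have [_ /(generates_OP1 q0) [_ hc]] := Hgc q q0.
  rewrite invfM invf_div addrC; apply: (OP1_mul hc); rewrite -(degE _ _ uv').
  by apply: OP1_frac => //; apply: sp_homog.
move: h1 h2; set k' := \sum_i _ => h1 h2.
have kk : k' - k = - (k - k') by rewrite opprB.
rewrite kk in h2.
by have := OP1_unit_degree psi0 h1 h2; clear; lia.
Qed.

End Curve.

(** * The class of a smooth rational curve *)

Section Positivity.
Variables (K : closedFieldType) (n : nat) (P : 'I_n -> 'rV[K]_3).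
Hypothesis P_neq0 : forall j, P j != 0.
Hypothesis P_distinct : forall j j', proj_eq (P j) (P j') -> j = j'.
Variable M : 'I_n -> 'M[K]_3.
Hypothesis M_unit : forall j, M j \in unitmx.
Hypothesis M_row : forall j, M j 0 = P j 0 :> ('I_3 -> K).
Local Notation T := {mpoly K[n.+1 * 3]}.
Local Notation S := {mpoly K[2]}.
Variables (phi : 'M[S]_(n.+1, 3)) (dg : 'I_n.+1 -> nat).
Hypothesis phi_homog : forall i k, phi i k \is (dg i).-homog.
Hypothesis phi_X : forall q : 'rV[K]_2, q != 0 -> blowup_pt P (image_pt phi q).
Hypothesis phi_imm : forall q : 'rV[K]_2, q != 0 -> forall c, OP1 0 q c ->
  exists h, OXL P 0 (image_pt phi q) h /\ pulls_back P phi h c.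

Let T_ e (A : S) := exists2 G : T, multihomog e G & sp phi G = A.

Lemma pulls_back_eval (q : 'rV[K]_2) (A B : S) N : q != 0 -> A \is N.-homog -> B \is N.-homog -> B.@[q 0] != 0 ->
  exists e (G H : T), [/\ multihomog e G, multihomog e H, (sp phi H).@[q 0] != 0 &
    sp phi G * B = A * sp phi H].
Proof.
move=> q0 hA hB Bq.
have hc : OP1 0 q (A%:F / B%:F) by rewrite -(subrr N%:Z); apply: OP1_frac.
have [h [hO [e' [A' [B' [hA' hB' B0' hE cE]]]]]] := phi_imm q0 hc.
have [u [v [G [H [hG hH uv H0 hE']]]]] := proj1 (OXL_sec _ _ _ _) hO.
have {}uv i : u i = v i by have := uv i; rewrite /delta0 mul0r; clear; lia.
have {}hG : multihomog v G by apply: mh_ext hG.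
exists v, G, H; rewrite -evpt_image; split=> //.
have B0 : B != 0 by apply: contraNneq Bq => ->; rewrite meval0.
have sH0 := sp_neq0 H0.
have sH := evpt_sg_neq0 P_neq0 P_distinct M_unit M_row (phi_X q0) hH H0.
have sB : sg P B' != 0.
  apply: contraNneq B0' => e0.
  have := @sp_eq _ _ _ P_neq0 P_distinct _ M_unit M_row _ phi_X e' B' 0 hB' (@mh0 _ _ _).
  by rewrite e0 rmorph0 => /(_ erefl); rewrite sp.unlock => ->; rewrite /subst rmorph0.
have E : sg P (G * B') = sg P (A' * H).
  have hE2 : h = (sg P A')%:F / (sg P B')%:F by rewrite hE sg.unlock.
  by rewrite !rmorphM; apply: (tofrac_divK sH sB); rewrite -hE'; exact: hE2.
have hAH : multihomog (fun i => v i + e' i)%N (A' * H).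
  by apply: mh_ext (mhM hA' hH) => i; rewrite addnC.
have := sp_eq P_neq0 P_distinct M_unit M_row phi_X (mhM hG hB') hAH E.
have B'0 : sp phi B' != 0 by rewrite sp.unlock.
rewrite !rmorphM /= => E2.
have E3 : A * sp phi B' = sp phi A' * B by apply: tofrac_divK => //; rewrite cE sp.unlock.
by apply: (mulIf B'0); rewrite mulrAC E2 mulrAC -E3 mulrAC.
Qed.

Lemma curve_full : exists e0 : 'I_n.+1 -> nat, forall e, (forall i, e0 i <= e i)%N ->
  exists x0, forall x, (x0 <= x)%N ->
  forall A : S, A \is (x * \sum_i e i * dg i)%N.-homog ->
  exists2 G : T, multihomog (fun i => x * e i)%N G & sp phi G = A.
Proof.
apply: (@ample_full K n.+1 dg T_).
- by move=> e e' A ee [G hG GA]; exists G => //; apply: mh_ext hG.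
- by move=> e A [G hG <-]; apply: sp_homog.
- move=> e c A B [G hG <-] [H hH <-]; exists (G + c *: H); last by rewrite rmorphD /= spZ.
  by apply: mhD => //; apply: mhZ.
- move=> e e' A B [G hG <-] [H hH <-]; exists (G * H); last by rewrite rmorphM.
  exact: mhM.
- by exists 1; [apply: mh1|rewrite rmorph1].
- move=> e q q0.
  have Hi i : exists k, (phi i k).@[q 0] != 0.
    by have [h _] := phi_X q0; have [k hk] := row_neq0 (h i); exists k; move: hk; rewrite !mxE.
  have [k hk] := fin_all_exists Hi.
  exists (\prod_i phi i (k i) ^+ e i); last first.
    rewrite rmorph_prod; apply/prodf_neq0 => i _; rewrite /= rmorphXn; apply: expf_neq0; exact: hk.
  exists (\prod_i 'X_(mxvec_index i (k i)) ^+ e i).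
    have := mh_prod (r := index_enum 'I_n.+1) (fun i => @mhXn K n _ _ (e i) (@mhX K n i (k i))).
    apply: mh_ext => i.
    rewrite (bigD1 i) //= eqxx muln1 big1 ?addn0 // => i' ne.
    by rewrite eq_sym (negPf ne) muln0.
  by rewrite rmorph_prod; apply: eq_bigr => i _; rewrite /= rmorphXn /= spX.
move=> q q0; have [i qi] := rV2P q0.
pose i' : 'I_2 := if i == 0 then 1 else 0.
have [|e [G [H [hG hH Hq E]]]] := pulls_back_eval q0 (dhomogXi K i') (dhomogXi K i).
  by rewrite mevalXU.
(* The zero of X_i. The function X_i' / X_i lifts to G / H near q, and evaluation at [w] shows that
   H is divisible by X_i; the common cofactor of both is the form required by [T_imm]. *)
pose w : 'rV[K]_2 := \row_j (j == i')%:R.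
have w0 : w != 0 by apply/eqP => /rowP/(_ i'); rewrite !mxE eqxx => /eqP; rewrite oner_eq0.
have Hw : (sp phi H).@[w 0] = 0.
  have := congr1 (meval (w 0)) E; rewrite !mevalM !mevalXU !mxE eqxx mul1r => <-.
  rewrite (_ : i == i' = false) ?mulr0 //; by rewrite /i'; case: (ord2P i) => ->.
have hHd := sp_homog phi_homog hH.
have [H' [hH' HE]] := form2_factor hHd w0 Hw.
have [c [c0 lE]] : exists c : K, c != 0 /\ lam w = c *: 'X_i.
  rewrite /lam !mxE /i'; case: (ord2P i) => -> /=.
    by exists 1; rewrite oner_eq0 /= scale0r subr0.
  by exists (-1); rewrite oppr_eq0 oner_eq0 /= scale0r sub0r scaleNr.
have HE' : sp phi H = 'X_i * (c *: H') by rewrite HE lE -scalerAl scalerAr.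
have GE' : sp phi G = 'X_i' * (c *: H').
  by apply: (mulIf (mpolyXU_neq0 K i)); rewrite E HE' mulrCA mulrC.
(* H vanishes at [w] but not at q, so it is not constant. *)
have dpos : (0 < \sum_i e i * dg i)%N.
  rewrite lt0n; apply: contraNneq Hq => d0; rewrite d0 in hHd.
  by move: Hw; rewrite (homog_eq0C hHd) !mevalC => ->.
exists e, (c *: H'), (\sum_i e i * dg i).-1; split.
- by rewrite /T_; case: (ord2P i) HE' GE' => e1; rewrite /i' e1 /= => h1 h2; [exists H|exists G].
- by rewrite /T_; case: (ord2P i) HE' GE' => e1; rewrite /i' e1 /= => h1 h2; [exists G|exists H].
- exact: rpredZ.
- by rewrite prednK.
- by apply: contraNneq Hq => e2; rewrite HE' mevalM e2 mulr0.
Qed.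

End Positivity.

Lemma cross_par (A : comNzRingType) (u v w : 'I_3 -> A) k l : dot u w = 0 -> dot v w = 0 ->
  w k * cross u v l = w l * cross u v k.
Proof.
move=> uw vw; have E i : cross w (cross u v) i = 0 by rewrite cross_crossr uw vw !mulr0 subrr.
have := (E 0, E 1, E 2%:R); rewrite !crossE => -[[/eqP]].
rewrite subr_eq0 => /eqP e0 /eqP; rewrite subr_eq0 => /eqP e1 /eqP; rewrite subr_eq0 => /eqP e2.
by case: (ord3P k) (ord3P l) => -> [] ->; rewrite !crossE ?e0 ?e1 ?e2.
Qed.

(** * The equation and the class of the curve *)

Section CurveGeometry.
Variables (K : closedFieldType) (n : nat) (P : 'I_n -> 'rV[K]_3).
Hypothesis P_neq0 : forall j, P j != 0.
Hypothesis P_distinct : forall j j', proj_eq (P j) (P j') -> j = j'.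
Variable M : 'I_n -> 'M[K]_3.
Hypothesis M_unit : forall j, M j \in unitmx.
Hypothesis M_row : forall j, M j 0 = P j 0 :> ('I_3 -> K).
Local Notation T := {mpoly K[n.+1 * 3]}.
Local Notation R := {mpoly K[3]}.
Local Notation S := {mpoly K[2]}.
Implicit Types (G H : T) (z : 'M[K]_(n.+1, 3)) (A : R) (c e : 'I_n -> nat).
Variables (phi : 'M[S]_(n.+1, 3)) (dg : 'I_n.+1 -> nat).
Hypothesis phi_homog : forall i k, phi i k \is (dg i).-homog.
Hypothesis phi_X : forall q : 'rV[K]_2, q != 0 -> blowup_pt P (image_pt phi q).
Hypothesis d_gt0 : (0 < dg ord0)%N.
Local Notation d := (dg ord0).
Local Notation f := (phi ord0).
Local Notation W := (W M).

Lemma phi_bpf i (q : 'rV[K]_2) : q != 0 -> exists k, (phi i k).@[q 0] != 0.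
Proof.
move=> q0; have [h _] := phi_X q0; have [k hk] := row_neq0 (h i).
by exists k; move: hk; rewrite !mxE.
Qed.

Lemma phi_neq0 i : exists k, phi i k != 0.
Proof.
have p0 : pt2 1 0 != 0 :> 'rV[K]_2 by apply: pt2_neq0; rewrite oner_eq0.
by have [k hk] := phi_bpf i p0; exists k; apply: contraNneq hk => ->; rewrite meval0.
Qed.

Lemma meval_dot (u v : 'I_3 -> S) (q : 'rV[K]_2) :
  (dot u v).@[q 0] = dot (fun k => (u k).@[q 0]) (fun k => (v k).@[q 0]).
Proof. by rewrite /dot rmorph_sum; apply: eq_bigr => k _; rewrite /= mevalM. Qed.

Lemma phi_incident j : dot (fun l => (P j 0 l)%:MP) (phi (lift ord0 j)) = 0 /\
  dot f (phi (lift ord0 j)) = 0.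
Proof.
split; apply: form2_ext => q q0; have [_ /(_ j) [/row_dot h1 /row_dot h2]] := phi_X q0;
  rewrite meval_dot meval0 dotC.
  rewrite -[RHS]h1; apply: eq_bigr => k _; by rewrite /image_pt !mxE mevalC.
by rewrite -[RHS]h2; apply: eq_bigr => k _; rewrite /image_pt !mxE.
Qed.

Lemma meval_cross (v : 'rV[K]_3) (u : 'I_3 -> S) (q : 'rV[K]_2) k :
  (cross (fun l => (v 0 l)%:MP) u k).@[q 0] = cross (v 0) (fun l => (u l).@[q 0]) k.
Proof. by rewrite /cross mevalB !mevalM !mevalC. Qed.

Lemma crossP_homog j k : cross (fun l => (P j 0 l)%:MP) f k \is d.-homog.
Proof. rewrite /cross !mul_mpolyC; apply: rpredB; apply: rpredZ; exact: phi_homog. Qed.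

Lemma crossP_neq0 j : exists k, cross (fun l => (P j 0 l)%:MP) f k != 0.
Proof.
apply/existsP; rewrite -negb_forall; apply/negP => /forallP h.
have [k0 pk] := row1_neq0 (P_neq0 j).
have [q q0 fq] := form2_root (phi_homog ord0 k0) d_gt0.
have [l0 fl] := phi_bpf ord0 q0.
have [|c [c0 cE]] := @cross_eq0_prop K (P j 0) (fun l => (f l).@[q 0]) k0 l0 _ pk fl.
  by move=> k; rewrite -meval_cross (eqP (h k)) meval0.
by move/eqP: fq; rewrite (cE k0) mulf_eq0 (negPf c0) (negPf pk).
Qed.

(** Both P_j x f and row j of [phi] are orthogonal to P_j and f, hence parallel; the row has no
    common zero, so the ratio is a form. It is the equation of phi^* E_j, and its degree [m j] is
    E.E_j. *)
Lemma exists_g : exists (g : 'I_n -> S) (m : 'I_n -> nat), forall j,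
  [/\ g j != 0, g j \is (m j).-homog, (m j + dg (lift ord0 j) = d)%N &
   forall k, cross (fun l => (P j 0 l)%:MP) f k = g j * phi (lift ord0 j) k].
Proof.
suff H j : exists gm : S * nat, [/\ gm.1 != 0, gm.1 \is (gm.2).-homog, (gm.2 + dg (lift ord0 j) = d)%N &
   forall k, cross (fun l => (P j 0 l)%:MP) f k = gm.1 * phi (lift ord0 j) k].
  have [gm Hgm] := fin_all_exists H.
  by exists (fun j => (gm j).1), (fun j => (gm j).2).
have [d1 d2] := phi_incident j; have [k0 lk0] := phi_neq0 (lift ord0 j).
pose X k := cross (fun l => (P j 0 l)%:MP) f k; pose l k := phi (lift ord0 j) k.
have par k k' : l k * X k' = l k' * X k by apply: cross_par.
have Hq (q : 'rV[K]_2) : q != 0 -> OP1 (d%:Z - (dg (lift ord0 j))%:Z) q ((X k0)%:F / (l k0)%:F).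
  move=> q0; have [k lk] := phi_bpf (lift ord0 j) q0.
  have -> : (X k0)%:F / (l k0)%:F = (X k)%:F / (l k)%:F.
    apply: tofrac_div_eq => //; first by apply: contraNneq lk => e; rewrite -/(l k) e meval0.
    by rewrite mulrC par mulrC.
  exact: (OP1_frac (crossP_homog j k) (phi_homog _ k) lk).
have [A [AE Ah An]] := OP1_global Hq.
have XA k : X k = A * l k.
  apply: (mulfI lk0); rewrite -/(l k0) par (tofrac_div_eqE lk0 AE) -/(l k0).
  by rewrite mulrCA mulrA mulrC.
have A0 : A != 0.
  have [k] := crossP_neq0 j; apply: contraNneq => e; by rewrite -/(X k) XA e mul0r.
have le : (dg (lift ord0 j) <= d)%N.
  rewrite leqNgt; apply/negP => lt; case/eqP: A0; apply: An; move: lt; clear; lia.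
exists (A, d - dg (lift ord0 j))%N; split=> //=; last by rewrite subnK.
by apply: Ah; rewrite subzn.
Qed.

Variables (g : 'I_n -> S) (m : 'I_n -> nat).
Hypothesis g_neq0 : forall j, g j != 0.
Hypothesis g_homog : forall j, g j \is (m j).-homog.
Hypothesis g_deg : forall j, (m j + dg (lift ord0 j) = d)%N.
Hypothesis g_cross : forall j k, cross (fun l => (P j 0 l)%:MP) f k = g j * phi (lift ord0 j) k.

(** The equation on P^1 of the pullback of \sum_j c_j E_j. *)
Definition gprod c : S := \prod_j g j ^+ c j.
Local Notation dotm c := (\sum_j c j * m j)%N.

Lemma gprod_neq0 c : gprod c != 0.
Proof. by apply/prodf_neq0 => j _; rewrite expf_neq0. Qed.

Lemma gprod_homog c : gprod c \is (dotm c).-homog.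
Proof.
rewrite /gprod; elim/big_rec2: _ => [|j A e _ IH]; first exact: dhomog1.
by apply: dhomogM => //; rewrite mulnC; apply: dhomogMn.
Qed.

Lemma gprodD c e : gprod (fun j => c j + e j)%N = gprod c * gprod e.
Proof. by rewrite /gprod -big_split; apply: eq_bigr => j _; rewrite exprD. Qed.

Lemma pb_sgE (u : 'I_n.+1 -> nat) G : multihomog u G ->
  pb f (sg P G) = gprod (fun j => u (lift ord0 j)) * sp phi G.
Proof. by move=> hG; rewrite (pb_sg hG g_cross). Qed.

(* Restriction to the curve: a section of O(kL - \sum_j c_j E_j) gives a form
   of degree kd - \sum_j c_j m_j. *)
Lemma pb_W k c A : W k c A -> exists h : S, [/\ pb f A = gprod c * h,
  forall N, (k * d = dotm c + N)%N -> h \is N.-homog & (k * d < dotm c)%N -> h = 0].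
Proof.
move=> [hA oA].
have hpA : pb f A \is (k * d)%N.-homog by rewrite mulnC; apply: pb_homog.
suff [h hE] : exists h, pb f A = gprod c * h.
  exists h; split=> // [N e|lt].
    by apply: (homog_cofactor (gprod_neq0 c) (gprod_homog c)); rewrite -e -hE.
  by apply: (homog_cofactor_lt (gprod_neq0 c) (gprod_homog c) _ lt); rewrite -hE.
have [pA0|pA0] := eqVneq (pb f A) 0; first by exists 0; rewrite mulr0.
have Hq (q : 'rV[K]_2) : q != 0 -> OP1 ((k * d)%:Z - (dotm c)%:Z) q ((pb f A)%:F / (gprod c)%:F).
  move=> q0; have zX := phi_X q0.
  have oA' j (c' : nat) : (c j)%:Z = c'%:Z -> ordge (M j) c' A by case=> <-.
  have [u [v [G [H [hG hH uv H0 AE]]]]] := sec_loc P_neq0 P_distinct M_unit M_row hA oA' zX.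
  have sH := evpt_sg_neq0 P_neq0 P_distinct M_unit M_row zX hH H0.
  have sH0 := sp_neq0 H0; rewrite evpt_image in H0.
  have uvc j : u (lift ord0 j) = (v (lift ord0 j) + c j)%N.
    by have := uv (lift ord0 j); rewrite /tw liftK; clear; lia.
  have E : pb f A * sp phi H = sp phi G * gprod c.
    have : pb f (sg P H) * pb f A = pb f (sg P G).
      by rewrite -rmorphM /=; congr (pb f _); apply/esym; rewrite mulrC; apply: (tofrac_div_eqE sH (esym AE)).
    rewrite (pb_sgE hH) (pb_sgE hG).
    have -> : gprod (fun j => u (lift ord0 j)) = gprod (fun j => v (lift ord0 j)) * gprod c.
      by rewrite -gprodD; apply: eq_bigr => j _; rewrite uvc.
    rewrite -!mulrA => /(mulfI (gprod_neq0 _)) e; by rewrite mulrC e mulrC.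
  rewrite (tofrac_div_eq (gprod_neq0 c) sH0 E).
  have hsG := sp_homog phi_homog hG; have hsH := sp_homog phi_homog hH.
  have e1 : (k * d + \sum_i v i * dg i = \sum_i u i * dg i + dotm c)%N.
    have h1 := dhomogM hpA hsH; have h2 := dhomogM hsG (gprod_homog c).
    by rewrite -E in h2; apply: (dhomog_uniq _ h1 h2); rewrite mulf_neq0.
  have -> : (k * d)%:Z - (dotm c)%:Z = (\sum_i u i * dg i)%:Z - (\sum_i v i * dg i)%:Z.
    by move: e1; clear; lia.
  exact: OP1_frac.
have [h [hE _ _]] := OP1_global Hq.
exists h; rewrite mulrC; exact: (tofrac_div_eqE (gprod_neq0 c) hE).
Qed.

Lemma pb_lin x A B : pb f (x *: A + B) = x *: pb f A + pb f B.
Proof. by rewrite rmorphD /= pbZ. Qed.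

Lemma exists_Q : exists (Q : R) (D : nat) (mu : 'I_n -> nat),
  [/\ Q \is D.-homog, Q != 0, pb f Q = 0,
   forall A k, A \is k.-homog -> pb f A = 0 -> exists A', A = Q * A' &
   forall j, ordge (M j) (mu j) Q /\ (jet (M j) Q)`_(mu j) != 0].
Proof.
have [k0 [l0 [kl ind]]] := exists_indep (phi_homog ord0) d_gt0 (@phi_bpf ord0).
have [|Q [D [hQ Q0 pQ HQ]]] := ker_principal kl ind.
  (* Degree 2d is large enough: there are 2d^2 + 3d + 1 ternary forms of degree 2d and only 2d^2 + 1
     binary forms of degree 2d^2, so some form vanishes on the curve. *)
  have [s [t [st ds dt]]] := rank_nullity pb_lin (homog_closed K 3 (2 * d)) (fdim_form3 K (2 * d)).
  have le : (t <= (d * (2 * d)).+1)%N.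
    apply: (fdim_le (homog_closed K 2 (d * (2 * d))) (closed_im pb_lin (homog_closed K 3 (2 * d))) _ dt (fdim_form2 K _)).
    by move=> _ [A hA <-]; apply: pb_homog.
  have s0 : (0 < s)%N.
    have := bin2 (2 * d).+2; move: st le d_gt0; move: (dg ord0) => x; clear; nia.
  have [A [hA pA] A0] := fdim_pos (closed_ker pb_lin (homog_closed K 3 (2 * d))) ds s0.
  by exists A, (2 * d)%N.
have Hmu j : exists a, ordge (M j) a Q /\ (jet (M j) Q)`_a != 0.
  have [|a Qa amin] := @ex_min_nat (fun a => (jet (M j) Q)`_a != 0).
    apply: NNPP => no; case/eqP: Q0.
    apply: (ordge_eq0 (M_unit j) hQ _ (ltnSn D)) => a _; apply/eqP/negPn/negP => h.
    by apply: no; exists a.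
  exists a; split=> // b lt; apply/eqP/negPn/negP => /amin.
  by rewrite leqNgt lt.
have [mu Hmu'] := fin_all_exists Hmu.
by exists Q, D, mu.
Qed.

Variables (Q : R) (D : nat) (mu : 'I_n -> nat).
Hypothesis Q_homog : Q \is D.-homog.
Hypothesis Q_neq0 : Q != 0.
Hypothesis Q_ker : pb f Q = 0.
Hypothesis ker_Q : forall A k, A \is k.-homog -> pb f A = 0 -> exists A', A = Q * A'.
Hypothesis Q_ord : forall j, ordge (M j) (mu j) Q.
Hypothesis Q_lead : forall j, (jet (M j) Q)`_(mu j) != 0.

Lemma W_ker k c A : (D <= k)%N ->
  (W k c A /\ pb f A = 0) <-> (exists2 B, W (k - D) (fun j => c j - mu j)%N B & Q * B = A).
Proof.
move=> le; split=> [[[hA oA] pA]|[B [hB oB] <-]]; last first.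
  split; last by rewrite rmorphM /= Q_ker mul0r.
  split=> [|j]; first by rewrite -(subnKC le); apply: dhomogM.
  by apply: ordge_le (ordgeM (@Q_ord j) (oB j)); rewrite -leq_subLR.
have [B BE] := ker_Q hA pA; exists B => //; split=> [|j].
  by apply: (homog_cofactor Q_neq0 Q_homog); rewrite -BE subnKC.
(* Where c_j < mu_j the truncated difference is 0 and imposes no condition. *)
have [lt|leM] := ltnP (c j) (mu j).
  by rewrite (eqP (ltnW lt : (c j - mu j == 0)%N)); apply: ordge0.
by apply: (ordge_cancel (@Q_ord j) (Q_lead j)); rewrite subnK // -BE.
Qed.

Lemma curve_count k c N r s : (D <= k)%N -> (k * d = dotm c + N)%N ->
  fdim (W k c) r -> fdim (W (k - D) (fun j => c j - mu j)%N) s ->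
  (s <= r <= s + N.+1)%N /\
  (r = (s + N.+1)%N <-> forall h : S, h \is N.-homog -> exists2 A, W k c A & pb f A = gprod c * h).
Proof.
move=> le kd dr ds.
have [s' [t [st ds' dt]]] := rank_nullity pb_lin (W_closed M k c) dr.
have ss' : s' = s.
  apply: (fdim_uniq (closed_ker pb_lin (W_closed M k c)) ds').
  have lQ x (A B : R) : Q * (x *: A + B) = x *: (Q * A) + Q * B by rewrite mulrDr scalerAr.
  have Qinj (v : R) : W (k - D) (fun j => c j - mu j)%N v -> Q * v = 0 -> v = 0.
    by move=> _ /eqP; rewrite mulf_eq0 (negPf Q_neq0) => /eqP.
  apply: fdim_ext (fdim_inj_im lQ (W_closed M _ _) Qinj ds) => A.
  by split=> /(W_ker c A le).
have lG x (A B : S) : gprod c * (x *: A + B) = x *: (gprod c * A) + gprod c * B by rewrite mulrDr scalerAr.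
have Ginj (v : S) : v \is N.-homog -> gprod c * v = 0 -> v = 0.
  by move=> _ /eqP; rewrite mulf_eq0 (negPf (gprod_neq0 c)) => /eqP.
have dG := fdim_inj_im lG (homog_closed K 2 N) Ginj (fdim_form2 K N).
have cI := closed_im pb_lin (W_closed M k c).
have cG := closed_im lG (homog_closed K 2 N).
have sub w : (exists2 v, W k c v & pb f v = w) -> exists2 v, v \is N.-homog & gprod c * v = w.
  by move=> [A WA <-]; have [h [hE hh _]] := pb_W WA; exists h => //; apply: hh.
have tN := fdim_le cG cI sub dt dG.
split; first by rewrite -ss' -st leq_addr leq_add2l.
rewrite -ss' -st; split=> [/addnI e h hh|surj].
  have [t' [_ dt' Ht']] := fdim_sub cG cI sub dG.
  have tt : t' = N.+1 by rewrite -e; apply: fdim_uniq cI dt' dt.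
  have [|A WA pA] := Ht' tt (gprod c * h); first by exists h.
  by exists A.
congr addn; apply/eqP; rewrite eqn_leq tN /=.
apply: (fdim_le cI cG _ dG dt) => _ [h hh <-].
by have [A WA pA] := surj h hh; exists A.
Qed.

Hypothesis phi_full : exists e0 : 'I_n.+1 -> nat, forall e : 'I_n.+1 -> nat, (forall i, e0 i <= e i)%N ->
  exists x0, forall x, (x0 <= x)%N ->
  forall A : S, A \is (x * \sum_i e i * dg i)%N.-homog ->
  exists2 G : T, multihomog (fun i => x * e i)%N G & sp phi G = A.

(* The intersection numbers of (D - d)L - \sum_j (mu_j - m_j) E_j with L and the
   L - E_j. *)
Definition wt (i : 'I_n.+1) : int :=
  if unlift ord0 i is Some j then D%:Z - (mu j)%:Z - d%:Z + (m j)%:Z else D%:Z - d%:Z.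

(* Riemann-Roch on X minus Riemann-Roch on the curve, for a multiple of an
   ample class. *)
Lemma curve_RR (e : 'I_n.+1 -> nat) x : (0 < x)%N -> (D <= e ord0)%N ->
  (forall j, mu j <= e (lift ord0 j))%N ->
  (forall A : S, A \is (x * \sum_i e i * dg i)%N.-homog ->
     exists2 G : T, multihomog (fun i => x * e i)%N G & sp phi G = A) ->
  2%:Z * x%:Z * \sum_i (e i)%:Z * wt i =
  D%:Z * D%:Z - 3%:Z * D%:Z + 2%:Z - \sum_j ((mu j)%:Z * (mu j)%:Z - (mu j)%:Z).
Proof.
move=> x0 eD emu full.
pose k := (\sum_i x * e i)%N; pose c j := (x * e (lift ord0 j))%N.
have kE : k = (x * e ord0 + \sum_j c j)%N by rewrite /k big_ord_recl.
have ck : (\sum_j c j <= k)%N by rewrite kE leq_addl.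
have cmu j : (mu j <= c j)%N by apply: leq_trans (emu j) _; rewrite /c leq_pmull.
have kD : (D <= k)%N by rewrite kE; apply: leq_trans (leq_addr _ _); apply: leq_trans eD _; rewrite leq_pmull.
have ck' : (\sum_j (c j - mu j) <= k - D)%N.
  have : (\sum_j (c j - mu j) <= \sum_j c j)%N by apply: leq_sum => j _; apply: leq_subr.
  have : (D <= x * e ord0)%N by apply: leq_trans eD _; rewrite leq_pmull.
  by rewrite kE; clear; lia.
pose N := (x * \sum_i e i * dg i)%N.
have kN : (k * d = dotm c + N)%N.
  rewrite kE /N big_ord_recl mulnDr mulnDl mulnA addnCA; congr (_ + _)%N.
  rewrite big_distrl big_distrr /= -big_split; apply: eq_bigr => j _ /=.
  by rewrite mulnA -mulnDr -/(c j) g_deg.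
have [r [dr _ /(_ ck) rE]] := fdim_W P_neq0 P_distinct M_unit M_row k c.
have [s [ds _ /(_ ck') sE]] := fdim_W P_neq0 P_distinct M_unit M_row (k - D) (fun j => c j - mu j)%N.
have [_ [_ rs]] := curve_count kD kN dr ds.
have {}rs : r = (s + N.+1)%N.
  apply: rs => h /full [G hG <-]; exists (sg P G).
    split; first exact: (sg_homog P hG).
    by move=> j; have [] := jet_sg_over M_row j (pt2 1 0) hG.
  exact: (pb_sgE hG).
have rZ := binZ k.+1; have sZ := binZ (k - D).+1; rewrite rE in rZ; rewrite sE in sZ.
(* The terms quadratic in c_j cancel, so that the comparison is affine in x. *)
have cZ : 2%:Z * (\sum_j 'C((c j).+1, 2))%:Z - 2%:Z * (\sum_j 'C((c j - mu j).+1, 2))%:Z =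
    2%:Z * \sum_j (c j)%:Z * (mu j)%:Z - \sum_j ((mu j)%:Z * (mu j)%:Z - (mu j)%:Z).
  rewrite !(big_morph Posz PoszD (erefl _)) !mulr_sumr -!sumrB; apply: eq_bigr => j _.
  rewrite !binZ -(subzn (cmu j)); ring.
have sumE : x%:Z * \sum_i (e i)%:Z * wt i =
    k%:Z * D%:Z - \sum_j (c j)%:Z * (mu j)%:Z - k%:Z * d%:Z + (dotm c)%:Z.
  rewrite big_ord_recl /wt unlift_none kE PoszD PoszM !(big_morph Posz PoszD (erefl _)).
  have -> : \sum_i (e (lift ord0 i))%:Z * wt (lift ord0 i) =
     \sum_j (e (lift ord0 j))%:Z * (D%:Z - (mu j)%:Z - d%:Z + (m j)%:Z).
    by apply: eq_bigr => j _; rewrite /wt liftK.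
  rewrite mulrDr !mulr_sumr.
  have -> : \sum_i x%:Z * ((e (lift ord0 i))%:Z * (D%:Z - (mu i)%:Z - d%:Z + (m i)%:Z)) =
    (\sum_i (c i)%:Z) * (D%:Z - d%:Z) - \sum_i (c i)%:Z * (mu i)%:Z + \sum_i (c i * m i)%:Z.
    rewrite mulr_suml -sumrB -big_split; apply: eq_bigr => j _ /=.
    rewrite /c !PoszM; ring.
  ring.
have kDz : ((k - D)%N)%:Z = k%:Z - D%:Z by rewrite subzn.
have kNz : k%:Z * d%:Z = (dotm c)%:Z + N%:Z by rewrite -PoszM kN PoszD.
rewrite -mulrA sumE; move: rZ sZ cZ kNz; rewrite rs !PoszD !intS kDz.
move: (\sum_j 'C((c j).+1, 2))%N (\sum_j 'C((c j - mu j).+1, 2))%N => X Y.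
move: (\sum_j (c j)%:Z * (mu j)%:Z) (\sum_j ((mu j)%:Z * (mu j)%:Z - (mu j)%:Z)) => Z U.
move: (Posz (dotm c)) (Posz N) (Posz k) (Posz d) (Posz D) (Posz s) => dc n' k' d' D' s'.
clear; lia.
Qed.

(** Both the coefficient of x and the constant in [curve_RR] vanish. The coefficient is linear in e,
    and adding a unit vector to e isolates each [wt i]; so the equation Q has the degree and the
    multiplicities of phi. The constant gives the genus formula. *)
Lemma curve_class : [/\ D = d, mu =1 m &
  \sum_j ((m j)%:Z * (m j)%:Z - (m j)%:Z) = d%:Z * d%:Z - 3%:Z * d%:Z + 2%:Z].
Proof.
have [e0 He0] := phi_full.
pose e1 i := (e0 i + D + \sum_j mu j)%N.
pose C := D%:Z * D%:Z - 3%:Z * D%:Z + 2%:Z - \sum_j ((mu j)%:Z * (mu j)%:Z - (mu j)%:Z).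
have key (e : 'I_n.+1 -> nat) : (forall i, e1 i <= e i)%N -> \sum_i (e i)%:Z * wt i = 0 /\ C = 0.
  move=> le; have [|x0 Hx0] := He0 e.
    by move=> i; apply: leq_trans (le i); rewrite /e1 -addnA leq_addr.
  have HH x : (x0 < x)%N -> 2%:Z * x%:Z * \sum_i (e i)%:Z * wt i = C.
    move=> lt; apply: curve_RR; first exact: leq_ltn_trans lt.
    - by apply: leq_trans (le ord0); rewrite /e1 addnAC leq_addl.
    - by move=> j; apply: leq_trans (le _); rewrite /e1 (bigD1 j) //= addnCA leq_addr.
    - exact: Hx0 (ltnW lt).
  exact: affine_int_eq0 (HH x0.+1 (leqnn _)) (HH x0.+2 (leqnSn _)).
have [F1 C0] := key e1 (fun i => leqnn _).
have w0 i : wt i = 0.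
  have [|F2 _] := key (fun l => e1 l + (l == i))%N; first by move=> l; apply: leq_addr.
  rewrite -[LHS]addr0 -[in LHS]F1 -[RHS]F2 addrC.
  transitivity (\sum_l (e1 l)%:Z * wt l + \sum_l ((l == i) : nat)%:Z * wt l).
    congr (_ + _); rewrite (bigD1 i) //= eqxx mul1r big1 ?addr0 // => l /negPf ->.
    exact: mul0r.
  by rewrite -big_split; apply: eq_bigr => l _ /=; rewrite PoszD mulrDl.
have Dd : D = d by have := w0 ord0; rewrite /wt unlift_none; clear; lia.
have mum : mu =1 m.
  by move=> j; have := w0 (lift ord0 j); rewrite /wt liftK Dd; clear; lia.
split=> //; move: C0; rewrite /C Dd.
have -> : \sum_j ((mu j)%:Z * (mu j)%:Z - (mu j)%:Z) = \sum_j ((m j)%:Z * (m j)%:Z - (m j)%:Z).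
  by apply: eq_bigr => j _; rewrite mum.
by move: (\sum_j _) => X /eqP; rewrite subr_eq0 => /eqP.
Qed.

End CurveGeometry.

Lemma mulr_div_cancel (F : fieldType) (x y q : F) : q != 0 -> x * q * (y / q) = x * y.
Proof. by move=> q0; field. Qed.

Lemma Posz_sum (I : Type) (r : seq I) (F : I -> nat) :
  (\sum_(i <- r) F i)%N%:Z = \sum_(i <- r) (F i)%:Z.
Proof. exact: (big_morph Posz PoszD (erefl _)). Qed.

(** * The sheaves O(tL + iZ) *)

Section Divisors.
Variables (K : closedFieldType) (n : nat) (P : 'I_n -> 'rV[K]_3).
Hypothesis P_neq0 : forall j, P j != 0.
Hypothesis P_distinct : forall j j', proj_eq (P j) (P j') -> j = j'.
Variable M : 'I_n -> 'M[K]_3.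
Hypothesis M_unit : forall j, M j \in unitmx.
Hypothesis M_row : forall j, M j 0 = P j 0 :> ('I_3 -> K).
Local Notation T := {mpoly K[n.+1 * 3]}.
Local Notation R := {mpoly K[3]}.
Local Notation S := {mpoly K[2]}.
Implicit Types (G H : T) (z : 'M[K]_(n.+1, 3)).
Local Notation sec := (sec P).
Local Notation sunit := (sunit P).

Lemma sec_prod e z i (h : 'I_i -> ratfun K 3) : (forall k, sec e z (h k)) ->
  sec (fun l => i%:Z * e l) z (\prod_k h k).
Proof.
elim: i h => [|i IH] h hh.
  by rewrite big_ord0; apply: sec_ext (sunit_sec (sunit1 P z)) => l; rewrite mul0r.
rewrite big_ord_recl; apply: sec_ext (sec_mul (hh ord0) (IH _ (fun k => hh (lift ord0 k)))) => l.
by rewrite intS mulrDl mul1r.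
Qed.

(* For a curve whose ideal is generated by [q] times a unit of multidegree -e. *)
Lemma OX_sec (Z : 'M[K]_(n.+1, 3) -> Prop) e (q : ratfun K 3) t i z f :
  blowup_pt P z -> q != 0 ->
  (forall h, ideal_sheaf P Z z h <-> sec (fun l => - e l) z (h / q)) ->
  OX P t Z i z f <-> sec (fun l => delta0 t l + i%:Z * e l) z (f * q ^+ i).
Proof.
move=> zX q0 HI; split=> [hf|hf h hh].
  have [s hs] := sunit_exists (fun l => - e l) zX.
  have s0 := sunit_neq0 P_neq0 P_distinct M_unit M_row zX hs.
  have qs : ideal_sheaf P Z z (q * s).
    by apply: (proj2 (HI _)); rewrite mulrAC (divff q0) mul1r; apply: sunit_sec.
  have /OXL_sec := hf (fun=> q * s) (fun=> qs).
  rewrite prodr_const card_ord exprMn => h1.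
  have si0 : s ^+ i != 0 by rewrite expf_neq0.
  have := sec_mul h1 (sunit_sec (sunit_inv (sunit_exp i hs))).
  rewrite mulrA (mulfK si0); apply: sec_ext => l; by rewrite mulrN opprK.
apply/OXL_sec.
have hq : sec (fun l => i%:Z * - e l) z (\prod_k (h k / q)).
  by apply: sec_prod => k; apply: (proj1 (HI _)).
have := sec_mul hf hq.
have qi0 : q ^+ i != 0 by rewrite expf_neq0.
have -> : \prod_k (h k / q) = (\prod_k h k) / q ^+ i.
  by rewrite big_split /= prodr_const card_ord exprVn.
rewrite (mulr_div_cancel _ _ qi0); apply: sec_ext => l.
by rewrite mulrN addrK.
Qed.

(** The restriction of [G] to E_j is the jet coefficient of order equal to its j-th degree, so
    vanishing on E_j raises the multiplicity at P_j by one. *)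
Lemma ideal_exceptional j z h : blowup_pt P z ->
  ideal_sheaf P (exceptional P j) z h <-> sec (dv j) z h.
Proof.
move=> zX; split=> [[e [G [H [hG hH GZ H0 hE]]]]|[u [v [G [H [hG hH uv H0 hE]]]]]].
  have oG j' (c : nat) : (e (lift ord0 j') + (j' == j))%N%:Z = c%:Z -> ordge (M j') c (sg P G).
    case=> <-; have [oG lG] := jet_sg_over M_row j' (pt2 1 0) hG.
    case: (eqVneq j' j) => [jj|_]; last by rewrite addn0.
    rewrite addn1; apply/ordgeS; split=> //.
    apply: form2_ext => q q0; rewrite meval0 /lead_jet jj.
    have [_ ->] := jet_sg_over M_row j q hG.
    apply: GZ; split; first exact: over_pt_blowup.
    by exists 1; rewrite oner_eq0 scale1r; split=> //; apply/rowP => k; rewrite !mxE unlift_none.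
  have h1 := sec_loc P_neq0 P_distinct M_unit M_row (sg_homog P hG) oG zX.
  have h2 := sunit_inv (sunit_poly P hH H0).
  have := sec_mul h1 (sunit_sec h2).
  rewrite hE sg.unlock; apply: sec_ext => i.
  rewrite /tw /dv; case: (unliftP ord0 i) => [j'|] ->.
    rewrite PoszD addrAC subrr add0r (inj_eq lift_inj) [lift ord0 j' == ord0]eq_sym (negPf (neq_lift _ _)).
    by rewrite subr0.
  rewrite eqxx (negPf (neq_lift _ _)) big_ord_recl PoszD Posz_sum.
  have -> : \sum_j' (e (lift ord0 j') + (j' == j))%N%:Z = \sum_j' (e (lift ord0 j'))%:Z + 1.
    under eq_bigr do rewrite PoszD; rewrite big_split /=; congr (_ + _).
    by rewrite (bigD1 j) //= eqxx big1 ?addr0 // => j' /negPf ->.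
  move: (\sum_j' (e (lift ord0 j'))%:Z) => X; clear; lia.
(* Conversely, the quotient of [G1] by [H1] is 1 on X while [G1] vanishes on E_j: multiplying by it
   makes the numerator vanish there. *)
have [c hc] := row_lin_neq0 (lift ord0 j) zX.
pose G1 : T := \sum_k crossform P j c k *: 'X_(mxvec_index ord0 k).
pose H1 : T := \sum_k c k *: 'X_(mxvec_index (lift ord0 j) k).
have eH : evpt z H1 != 0 by rewrite evpt_lin.
have hH1 : multihomog (fun l => (l == lift ord0 j) : nat) H1 by exact: mh_lin.
have hG1 : multihomog (fun l => (l == ord0) : nat) G1 by exact: mh_lin.
exists (fun l => v l + (l == lift ord0 j))%N, (G * G1), (H * H1); split.
- apply: mh_ext (mhM hG hG1) => l; have := uv l; rewrite /dv; clear; lia.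
- exact: mhM.
- move=> w [wX [x [x0 /rowP wE]]]; rewrite evptM /G1 evpt_lin.
  rewrite (@crossformE _ _ P j c K idfun (w ord0)) /= [X in _ * X]big1 ?mulr0 // => k _.
  have wE' l : w ord0 l = x * P j 0 l by have := wE l; rewrite !mxE.
  by rewrite /cross !wE'; ring.
- by rewrite evptM mulf_neq0.
suff E : h = (sg P (G * G1))%:F / (sg P (H * H1))%:F by rewrite E sg.unlock.
have sH1 := evpt_sg_neq0 P_neq0 P_distinct M_unit M_row zX hH1 eH.
have G1E : sg P G1 = sg P H1 by exact: sg_crossform.
by rewrite hE -(tofrac_div_cancel (sg P G) (sg P H) sH1) -{1}G1E; congr (_%:F / _%:F); rewrite rmorphM mulrC.
Qed.

Lemma OX_exceptional j z f : blowup_pt P z ->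
  OX P 0 (exceptional P j) 1 z f <-> sec (fun l => - dv j l) z (f * 1).
Proof.
move=> zX; have HI h : ideal_sheaf P (exceptional P j) z h <-> sec (fun l => - - dv j l) z (h / 1).
  rewrite divr1 ideal_exceptional //; split; apply: sec_ext => l; by rewrite opprK.
rewrite (OX_sec 0 1 f zX (oner_neq0 _) HI) expr1; split; apply: sec_ext => l;
  by rewrite /delta0 mul0r add0r mul1r.
Qed.

Lemma sum_dv j (dg : 'I_n.+1 -> nat) :
  \sum_i - dv j i * (dg i)%:Z = (dg ord0)%:Z - (dg (lift ord0 j))%:Z.
Proof.
have nl j' : (lift ord0 j' == ord0 :> 'I_n.+1) = false by rewrite eq_sym (negPf (neq_lift _ _)).
rewrite big_ord_recl /dv eqxx (negPf (neq_lift _ _)) sub0r opprK mul1r; congr (_ + _).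
transitivity (\sum_j' - ((j' == j) : nat)%:Z * (dg (lift ord0 j'))%:Z).
  by apply: eq_bigr => j' _; rewrite nl (inj_eq lift_inj) subr0.
rewrite (bigD1 j) //= eqxx mulN1r big1 ?addr0 // => j' /negPf ->.
by rewrite oppr0 mul0r.
Qed.

End Divisors.

(** * Splitting type and syzygies *)

Lemma det2 (F : comNzRingType) (A : 'M[F]_2) : \det A = A 0 0 * A 1 1 - A 0 1 * A 1 0.
Proof.
rewrite (expand_det_row _ 0) !big_ord_recl big_ord0 addr0 /cofactor !det_mx11 !mxE /=.
rewrite expr0 mul1r expr1 mulN1r mulrN.
by congr (A _ _ * A _ _ - A _ _ * A _ _); apply: val_inj.
Qed.

Section Frames.
Variable F : fieldType.
Implicit Types f h : 'I_3 -> F.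

Lemma sum_lift3 (A : nmodType) (i : 'I_3) (G : 'I_3 -> A) : \sum_k G k = G i + \sum_k G (lift i k).
Proof.
rewrite (bigD1 i) //=; congr (_ + _).
rewrite (reindex_omap (lift i) (unlift i)) /=.
  by apply: eq_bigl => k; rewrite liftK eqxx andbT eq_sym neq_lift.
by move=> k ne; case: unliftP => [k' ->|e] //; rewrite e eqxx in ne.
Qed.

Lemma Omega1_transitionE f i j k l : f i != 0 -> f j != 0 ->
  Omega1_transition f i j k l =
  (lift i k == lift j l)%:R - (i == lift j l)%:R * (f (lift i k) / f i).
Proof. by move=> fi fj; rewrite !mxE; field; rewrite fi fj. Qed.

(* By the Euler sequence a syzygy h of f is a section of Omega(1); its
   coordinates on the i-th chart are the h_l with l <> i. *)
Lemma syz_transition f h i j : f i != 0 -> f j != 0 -> \sum_k h k * f k = 0 ->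
  (\row_k h (lift i k)) *m Omega1_transition f i j = \row_k h (lift j k).
Proof.
move=> fi fj hs; apply/rowP => l; rewrite [LHS]mxE [RHS]mxE.
transitivity (\sum_k (h (lift i k) * ((lift i k == lift j l)%:R - (i == lift j l)%:R * (f (lift i k) / f i)))).
  by apply: eq_bigr => k _; rewrite Omega1_transitionE // mxE.
have hi : h i = - (\sum_k h (lift i k) * f (lift i k)) / f i.
  move: hs; rewrite (sum_lift3 i) => /eqP; rewrite addr_eq0 => /eqP <-.
  by rewrite mulfK.
case: (unliftP i (lift j l)) => [k' ->|->].
  transitivity (\sum_k h (lift i k) * (k == k')%:R).
    apply: eq_bigr => k _; rewrite (negPf (neq_lift _ _)) mul0r subr0.
    by rewrite (inj_eq lift_inj).
  rewrite (bigD1 k') //= eqxx mulr1 big1 ?addr0 // => k /negPf ->.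
  by rewrite mulr0.
rewrite eqxx; transitivity (\sum_k - (h (lift i k) * f (lift i k)) / f i).
  apply: eq_bigr => k _; rewrite eq_sym (negPf (neq_lift _ _)) mul1r sub0r.
  by rewrite mulrN mulNr mulrA.
by rewrite -mulr_suml sumrN hi.
Qed.

(** Expresses det Omega(1) = O(-1) on charts; the sign depends on the order in which [lift] lists
    the two remaining coordinates. *)
Lemma Omega1_det f i j : f i != 0 -> f j != 0 ->
  exists s : bool, \det (Omega1_transition f i j) = (-1) ^+ s * (f j / f i).
Proof.
move=> fi fj; exists (odd (i + j)); rewrite det2 !Omega1_transitionE //.
have lE : ((lift (0 : 'I_3) (0 : 'I_2) = 1) * (lift (0 : 'I_3) (1 : 'I_2) = 2%:R) *
  (lift (1 : 'I_3) (0 : 'I_2) = 0) * (lift (1 : 'I_3) (1 : 'I_2) = 2%:R) *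
  (lift (2%:R : 'I_3) (0 : 'I_2) = 0) * (lift (2%:R : 'I_3) (1 : 'I_2) = 1))%type.
  by do !split; apply: val_inj.
by case: (ord3P i) (ord3P j) fi fj => -> [] -> fi fj; rewrite !lE /=; field; rewrite ?fi ?fj.
Qed.

Lemma frame_det f (Ci Cj : 'M[F]_2) i j : f i != 0 -> f j != 0 ->
  Ci = Omega1_transition f i j *m Cj ->
  exists s : bool, f i * \det Ci = (-1) ^+ s * (f j * \det Cj).
Proof.
move=> fi fj ->; have [s sE] := Omega1_det fi fj; exists s.
by rewrite det_mulmx sE; field; exact: fi.
Qed.

End Frames.

(* [O k q] stands for the stalk of O_{P^1}(k) at q, inside the field F, and
   [nz q k] says that [f k] generates O(d) at q. *)
Section AbstractSplitting.
Variables (F : fieldType) (Pt : Type) (O : int -> Pt -> F -> Prop).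
Hypothesis O_ext : forall k l q x, k = l -> O k q x -> O l q x.
Hypothesis O_add : forall k q x y, O k q x -> O k q y -> O k q (x + y).
Hypothesis O_opp : forall k q x, O k q x -> O k q (- x).
Hypothesis O_mul : forall k l q x y, O k q x -> O l q y -> O (k + l) q (x * y).
Variables (f : 'I_3 -> F) (nz : Pt -> 'I_3 -> Prop) (d a b : int).
Hypothesis nz_f : forall q k, nz q k -> f k != 0.
Hypothesis ex_nz : forall q, exists k, nz q k.
Hypothesis O_f : forall q k, O d q (f k).
Hypothesis O_fV : forall q k, nz q k -> O (- d) q (f k)^-1.
Variable C : 'I_3 -> 'M[F]_2.
Hypothesis C_a : forall q i k, nz q i -> O (- a) q (C i k 0).
Hypothesis C_b : forall q i k, nz q i -> O (- b) q (C i k 1).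
Hypothesis C_det : forall q i, nz q i -> O (- a - b) q (\det (C i)).
Hypothesis C_detV : forall q i, nz q i -> O (- (- a - b)) q (\det (C i))^-1.
Hypothesis C_det0 : forall q i, nz q i -> \det (C i) != 0.
Hypothesis C_trans : forall i j, f i != 0 -> f j != 0 -> C i = Omega1_transition f i j *m C j.
Variable q0 : Pt.

Lemma O_sign k q (s : bool) x : O k q x -> O k q ((-1) ^+ s * x).
Proof. by case: s => h; rewrite ?expr1 ?mulN1r ?expr0 ?mul1r //; apply: O_opp. Qed.

Lemma det_chart_neq0 i : f i != 0 -> \det (C i) != 0.
Proof.
move=> fi; have [j fj] := ex_nz q0; have fj0 := nz_f fj.
have [s cE] := frame_det fi fj0 (C_trans fi fj0).
have : f i * \det (C i) != 0 by rewrite cE !mulf_neq0 ?signr_eq0 // (C_det0 fj).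
by rewrite mulf_eq0 negb_or => /andP[].
Qed.

Lemma C_unit i : f i != 0 -> C i \in unitmx.
Proof. by move=> fi; rewrite unitmxE unitfE det_chart_neq0. Qed.

(* The determinant of Omega(1) is O(-1). *)
Lemma det_section : exists c, c != 0 /\
  forall q, O (d - (a + b)) q c /\ O (- (d - (a + b))) q c^-1.
Proof.
have [i fi] := ex_nz q0; have {}fi := nz_f fi.
exists (f i * \det (C i)); split; first by rewrite mulf_neq0 // det_chart_neq0.
move=> q; have [j fj] := ex_nz q; have fj0 := nz_f fj.
have [s cE] := frame_det fi fj0 (C_trans fi fj0); rewrite cE; split.
  apply: (@O_ext (d + (- a - b))); first by ring.
  by apply: O_sign; apply: O_mul; [apply: O_f|apply: C_det].
apply: (@O_ext (- d + - (- a - b))); first by ring.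
rewrite invfM -exprVn invrN1 invfM; apply: O_sign.
by apply: O_mul; [apply: O_fV|apply: C_detV].
Qed.

Definition lift_row (h : 'I_3 -> F) i : 'rV[F]_2 := \row_k h (lift i k).

Lemma frame_indep_chart h i j : f i != 0 -> f j != 0 -> \sum_k h k * f k = 0 ->
  lift_row h i *m C i = lift_row h j *m C j.
Proof. by move=> fi fj hs; rewrite (C_trans fi fj) mulmxA syz_transition. Qed.

Lemma O_sum2 k q (x : 'I_2 -> F) : (forall i, O k q (x i)) -> O k q (\sum_i x i).
Proof. by move=> hx; rewrite big_ord_recl big_ord1; apply: O_add. Qed.

(* Sections of Omega(1)(k) are syzygies of f of degree k. *)
Lemma syz_sections h i k : f i != 0 -> \sum_l h l * f l = 0 -> (forall q l, O k q (h l)) ->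
  forall q, O (k - a) q ((lift_row h i *m C i) 0 0) /\ O (k - b) q ((lift_row h i *m C i) 0 1).
Proof.
move=> fi hs hh q; have [j fj] := ex_nz q.
rewrite (frame_indep_chart fi (nz_f fj) hs) [X in O _ _ X /\ _]mxE [X in _ /\ O _ _ X]mxE.
by split; apply: O_sum2 => l; rewrite mxE; apply: O_mul; rewrite ?hh //; [apply: C_a|apply: C_b].
Qed.

Lemma sections_syz (x : 'rV[F]_2) i k : f i != 0 ->
  (forall q, O (k - a) q (x 0 0) /\ O (k - b) q (x 0 1)) ->
  exists h, [/\ lift_row h i *m C i = x, \sum_l h l * f l = 0 & forall q l, O k q (h l)].
Proof.
move=> fi hx; pose y := x *m invmx (C i).
pose h l := if unlift i l is Some l' then y 0 l' else - (\sum_l' y 0 l' * f (lift i l')) / f i.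
have hl l : h (lift i l) = y 0 l by rewrite /h liftK.
have hE : lift_row h i = y by apply/rowP => l; rewrite mxE hl.
have hs : \sum_l h l * f l = 0.
  rewrite (sum_lift3 i) {1}/h unlift_none (divfK fi) addrC; apply/eqP; rewrite subr_eq0; apply/eqP.
  by apply: eq_bigr => l _; rewrite hl.
exists h; split=> //; first by rewrite hE mulmxKV // C_unit.
move=> q l; have [j fj] := ex_nz q; have fj0 := nz_f fj.
have [x0 x1] := hx q.
have e : lift_row h j *m C j = x by rewrite -(frame_indep_chart fi fj0 hs) hE mulmxKV // C_unit.
have ab0 : forall u v w, O (k - a) q u -> O (- b) q v -> O (- (- a - b)) q w -> O k q (u * v * w).
  move=> u v w hu hv hw; apply: (@O_ext (k - a + - b + - (- a - b))); first by ring.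
  exact: (O_mul (O_mul hu hv) hw).
have ab1 : forall u v w, O (k - b) q u -> O (- a) q v -> O (- (- a - b)) q w -> O k q (u * v * w).
  move=> u v w hu hv hw; apply: (@O_ext (k - b + - a + - (- a - b))); first by ring.
  exact: (O_mul (O_mul hu hv) hw).
have D0 := det_chart_neq0 fj0.
have eq0 : h (lift j 0) * C j 0 0 + h (lift j 1) * C j 1 0 = x 0 0.
  have := congr1 (fun X : 'rV_2 => X 0 0) e; rewrite mxE big_ord_recl big_ord1 !mxE => <-.
  by congr (h (lift j _) * C j _ _ + h (lift j _) * C j _ _); apply: val_inj.
have eq1 : h (lift j 0) * C j 0 1 + h (lift j 1) * C j 1 1 = x 0 1.
  have := congr1 (fun X : 'rV_2 => X 0 1) e; rewrite mxE big_ord_recl big_ord1 !mxE => <-.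
  by congr (h (lift j _) * C j _ _ + h (lift j _) * C j _ _); apply: val_inj.
(* Cramer's rule: the inverse of the determinant is regular in degree a + b, since the determinant
   generates O(-a - b). *)
have hj l' : O k q (h (lift j l')).
  case: (ord2P l') => ->.
    have -> : h (lift j 0) = x 0 0 * C j 1 1 * (\det (C j))^-1 + - (x 0 1 * C j 1 0 * (\det (C j))^-1).
      by apply: (mulIf D0); rewrite mulrDl mulNr !(divfK D0) -eq0 -eq1 det2; ring.
    apply: O_add; last apply: O_opp.
      by apply: ab0; [|apply: C_b|apply: C_detV].
    by apply: ab1; [|apply: C_a|apply: C_detV].
  have -> : h (lift j 1) = x 0 1 * C j 0 0 * (\det (C j))^-1 + - (x 0 0 * C j 0 1 * (\det (C j))^-1).
    by apply: (mulIf D0); rewrite mulrDl mulNr !(divfK D0) -eq0 -eq1 det2; ring.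
  apply: O_add; last apply: O_opp.
    by apply: ab1; [|apply: C_a|apply: C_detV].
  by apply: ab0; [|apply: C_b|apply: C_detV].
case: (unliftP j l) => [l' ->|->]; first exact: hj.
have -> : h j = - (\sum_l' h (lift j l') * f (lift j l')) * (f j)^-1.
  by move: hs; rewrite (sum_lift3 j) => /eqP; rewrite addr_eq0 => /eqP <-; rewrite (mulfK fj0).
apply: (@O_ext (k + d + - d)); first by ring.
apply: O_mul; last exact: O_fV.
by apply: O_opp; apply: O_sum2 => l'; apply: O_mul; [apply: hj|apply: O_f].
Qed.

Lemma lift_row_inj h i : f i != 0 -> \sum_l h l * f l = 0 -> lift_row h i *m C i = 0 ->
  forall l, h l = 0.
Proof.
move=> fi hs /(congr1 (mulmx^~ (invmx (C i)))); rewrite mulmxK ?C_unit // mul0mx => e.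
have hl l' : h (lift i l') = 0 by have /rowP/(_ l') := e; rewrite !mxE.
move=> l; case: (unliftP i l) => [l' ->|->]; first exact: hl.
move: hs; rewrite (sum_lift3 i) big1 ?addr0 => [/eqP|l' _]; last by rewrite hl mul0r.
by rewrite mulf_eq0 (negPf fi) orbF => /eqP.
Qed.

End AbstractSplitting.

Lemma OP1_add (K : closedFieldType) (k : int) (q : 'rV[K]_2) (x y : ratfun K 2) :
  OP1 k q x -> OP1 k q y -> OP1 k q (x + y).
Proof.
move=> [u [v [A [B [hA hB e B0 ->]]]]] [u' [v' [A' [B' [hA' hB' e' B0' ->]]]]].
exists (u + v')%N, (v + v')%N, (A * B' + A' * B), (B * B'); split.
- apply: rpredD; first exact: dhomogM.
  by have -> : (u + v' = u' + v)%N; [move: e e'; clear; lia|apply: dhomogM].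
- exact: dhomogM.
- by move: e; clear; lia.
- by rewrite mevalM mulf_neq0.
have nz (q' : 'rV[K]_2) (X : {mpoly K[2]}) : X.@[q' 0] != 0 -> X%:F != 0.
  by rewrite tofrac_eq0; apply: contraNneq => ->; rewrite meval0.
by rewrite addf_div ?(nz q) // tofracD !tofracM.
Qed.

Lemma OP1_opp (K : closedFieldType) (k : int) (q : 'rV[K]_2) (x : ratfun K 2) :
  OP1 k q x -> OP1 k q (- x).
Proof.
move=> [u [v [A [B [hA hB e B0 ->]]]]]; exists u, v, (- A), B; split=> //.
  by rewrite rpredN.
by rewrite tofracN mulNr.
Qed.

(** Transport of dimension along a linear bijective relation. Syzygies and pairs of forms are
    matched only through the fraction field, where no map between the polynomial modules is at
    hand. *)
Lemma fdim_rel (K : fieldType) (L L' : lmodType K) (V : L -> Prop) (V' : L' -> Prop)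
    (rel : L -> L' -> Prop) r :
  closed_lin V -> closed_lin V' -> rel 0 0 ->
  (forall c u v u' v', rel u u' -> rel v v' -> rel (c *: u + v) (c *: u' + v')) ->
  (forall v, V v -> exists2 v', V' v' & rel v v') ->
  (forall v', V' v' -> exists2 v, V v & rel v v') ->
  (forall v', V' v' -> rel 0 v' -> v' = 0) ->
  (forall v, V v -> rel v 0 -> v = 0) ->
  fdim V r -> fdim V' r.
Proof.
move=> lV lV' rel0 rel_lin relV relV' inj' inj [b [Vb Hb]].
have [b' Vb' Hb'] := fin_all_exists2 (fun i => relV _ (Vb i)).
have relB u v u' v' : rel u u' -> rel v v' -> rel (u - v) (u' - v').
  by move=> h1 h2; have := rel_lin (-1) _ _ _ _ h2 h1; rewrite !scaleN1r ![- _ + _]addrC.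
have relC c : rel (comb b c) (comb b' c).
  rewrite /comb; elim: (index_enum _) => [|i s IH]; first by rewrite !big_nil.
  by rewrite !big_cons; apply: rel_lin.
exists b'; split=> // v' V'v'; have [v Vv vv'] := relV' v' V'v'.
have [c [vc uc]] := Hb v Vv; exists c; split=> [|c' e].
  apply/eqP; rewrite -subr_eq0; apply/eqP; apply: inj'.
    by apply: closedB => //; apply: closed_comb.
  by rewrite -(subrr v) {2}vc; apply: relB.
apply: uc; apply/eqP; rewrite -subr_eq0; apply/eqP; apply: inj.
  by apply: closedB => //; apply: closed_comb.
by rewrite -(subrr v') {2}e; apply: relB.
Qed.

Section Splitting.
Variables (K : closedFieldType) (n : nat).
Local Notation S := {mpoly K[2]}.
Local Notation F := (ratfun K 2).
Variables (phi : 'M[S]_(n.+1, 3)) (d : nat).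
Hypothesis f_homog : forall k, phi ord0 k \is d.-homog.
Hypothesis f_bpf : forall q : 'rV[K]_2, q != 0 -> exists k, (phi ord0 k).@[q 0] != 0.
Variables (a b : int).
Hypothesis split_ab : splitting_type phi a b.

Definition frac_f (k : 'I_3) : F := (phi ord0 k)%:F.

(** The product of the chart coordinates of a syzygy with the frame matrix does not depend on the
    chart, so a single chart serves all points of P^1. The relation a + b = d comes from comparing
    determinants. *)
Lemma splitting_frame : a + b = d%:Z /\ exists i (C : 'M[F]_2), [/\ 
  forall h (k : int), \sum_l h l * frac_f l = 0 -> (forall (q : 'rV[K]_2) l, q != 0 -> OP1 k q (h l)) ->
    forall q : 'rV[K]_2, q != 0 -> OP1 (k - a) q ((lift_row h i *m C) 0 0) /\
                                 OP1 (k - b) q ((lift_row h i *m C) 0 1),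
  forall (x : 'rV[F]_2) (k : int),
    (forall q : 'rV[K]_2, q != 0 -> OP1 (k - a) q (x 0 0) /\ OP1 (k - b) q (x 0 1)) ->
    exists h, [/\ lift_row h i *m C = x, \sum_l h l * frac_f l = 0 &
                 forall (q : 'rV[K]_2) l, q != 0 -> OP1 k q (h l)] &
  forall h, \sum_l h l * frac_f l = 0 -> lift_row h i *m C = 0 -> forall l, h l = 0].
Proof.
have [C [C_reg C_trans]] := split_ab.
pose Pt := {q : 'rV[K]_2 | q != 0}.
pose O (k : int) (q : Pt) (x : F) := OP1 k (sval q) x.
pose nz (q : Pt) (k : 'I_3) := (phi ord0 k).@[sval q 0] != 0.
have O_ext k l q x : k = l -> O k q x -> O l q x by move=> ->.
have O_add k q x y : O k q x -> O k q y -> O k q (x + y) by exact: OP1_add.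
have O_opp k q x : O k q x -> O k q (- x) by exact: OP1_opp.
have O_mul k l q x y : O k q x -> O l q y -> O (k + l) q (x * y) by exact: OP1_mul.
have nz_f q k : nz q k -> frac_f k != 0.
  by rewrite /frac_f tofrac_eq0; apply: contraNneq => e; rewrite /nz e meval0.
have ex_nz q : exists k, nz q k by exact: f_bpf (svalP q).
have O_f q k : O d%:Z q (frac_f k).
  exists d, 0%N, (phi ord0 k), 1; split; rewrite ?dhomog1 ?meval1 ?oner_eq0 // ?subr0 //.
  by rewrite tofrac1 divr1.
have O_fV q k : nz q k -> O (- d%:Z) q (frac_f k)^-1.
  move=> fk; exists 0%N, d, 1, (phi ord0 k); split; rewrite ?dhomog1 // ?sub0r //.
  by rewrite tofrac1 div1r.
have C_a q i k : nz q i -> O (- a) q (C i k 0).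
  by move=> h; have [hC _] := C_reg i _ (svalP q) h; case: (hC k).
have C_b q i k : nz q i -> O (- b) q (C i k 1).
  by move=> h; have [hC _] := C_reg i _ (svalP q) h; case: (hC k).
have C_gen q i : nz q i -> O (- a - b) q (\det (C i)) /\ O (- (- a - b)) q (\det (C i))^-1.
  by move=> h; have [_ gC] := C_reg i _ (svalP q) h; exact: (generates_OP1 (svalP q) gC).
have C_det0 q i : nz q i -> \det (C i) != 0.
  by move=> h; have [_ [c0 _]] := C_reg i _ (svalP q) h.
have p0 : pt2 1 0 != 0 :> 'rV[K]_2 by apply: pt2_neq0; rewrite oner_eq0.
pose mkPt (q : 'rV[K]_2) (hq : q != 0) : Pt := exist (fun q : 'rV[K]_2 => is_true (q != 0)) q hq.
pose q0 : Pt := mkPt _ p0.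
have C_d q i h := proj1 (C_gen q i h).
have C_dV q i h := proj2 (C_gen q i h).
have [i i0] := ex_nz q0; have fi := nz_f _ _ i0.
split.
  have [c [c0 Hc]] := det_section O_ext O_opp O_mul nz_f ex_nz O_f O_fV C_d C_dV C_det0 C_trans q0.
  have := OP1_unit_degree c0 (fun q hq => proj1 (Hc (mkPt q hq))) (fun q hq => proj2 (Hc (mkPt q hq))).
  by clear; lia.
exists i, (C i); split.
- move=> h k hs hh q hq.
  exact: (syz_sections O_add O_mul nz_f ex_nz C_a C_b C_trans fi hs (fun q l => hh _ l (svalP q)) (mkPt q hq)).
- move=> x k hx.
  have [h [h1 h2 h3]] := sections_syz O_ext O_add O_opp O_mul nz_f ex_nz O_f O_fV C_a C_b C_dV C_det0 C_trans q0 fi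
     (fun q => hx _ (svalP q)).
  by exists h; split=> // q l hq; exact: (h3 (mkPt q hq) l).
- move=> h hs h0; exact: (lift_row_inj nz_f ex_nz C_det0 C_trans q0 fi hs h0).
Qed.

Lemma OP1_poly (k : nat) (A : S) (q : 'rV[K]_2) : A \is k.-homog -> OP1 k q A%:F.
Proof.
move=> hA; exists k, 0%N, A, 1; split; rewrite ?dhomog1 ?meval1 ?oner_eq0 // ?subr0 //.
by rewrite tofrac1 divr1.
Qed.

Lemma OP1_zero (k : int) (q : 'rV[K]_2) : q != 0 -> OP1 k q (0 : F).
Proof.
move=> q0; have [s [s0 hs _]] := OP1_gen k q0.
have := OP1_add hs (OP1_opp hs); by rewrite subrr.
Qed.

(** There are no syzygies of degree -1, whereas O(-1 - a) or O(-1 - b) would have sections if a or b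
    were negative. *)
Lemma splitting_ge0 : 0 <= a /\ 0 <= b.
Proof.
have [_ [i [C [_ C_surj C_inj]]]] := splitting_frame.
have key (x : 'rV[F]_2) : (forall q : 'rV[K]_2, q != 0 -> OP1 (-1 - a) q (x 0 0) /\ OP1 (-1 - b) q (x 0 1)) -> x = 0.
  move=> /C_surj [h [hx hs hh]].
  have h0 l : h l = 0 by apply: (@OP1_neg K (-1)) => // q q0; apply: hh.
  rewrite -hx (_ : lift_row h i = 0) ?mul0mx //; by apply/rowP => l; rewrite !mxE h0.
have X0 (N : nat) : ('X_0 ^+ N : S)%:F != 0 :> F by rewrite tofrac_eq0 expf_neq0 // mpolyXU_neq0.
have [a0|a0] : 0 <= a \/ exists N : nat, -1 - a = N%:Z.
- by case: a => N; [left|right; exists N; rewrite NegzE; lia].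
- split=> //.
  have [//|[N bN]] : 0 <= b \/ exists N : nat, -1 - b = N%:Z.
    by case: b => N; [left|right; exists N; rewrite NegzE; lia].
  have /key/rowP/(_ 1) : forall q : 'rV[K]_2, q != 0 ->
     OP1 (-1 - a) q ((\row_k (if k == 0 then 0 else ('X_0 ^+ N : S)%:F) : 'rV[F]_2) 0 0) /\
     OP1 (-1 - b) q ((\row_k (if k == 0 then 0 else ('X_0 ^+ N : S)%:F) : 'rV[F]_2) 0 1).
    move=> q q0; rewrite !mxE /=; split; first exact: OP1_zero.
    rewrite bN; apply: OP1_poly; exact: dhomogXin.
  by rewrite !mxE /= => /eqP; rewrite (negPf (X0 N)).
have [N aN] := a0.
have /key/rowP/(_ 0) : forall q : 'rV[K]_2, q != 0 ->
   OP1 (-1 - a) q ((\row_k (if k == 0 then ('X_0 ^+ N : S)%:F else 0) : 'rV[F]_2) 0 0) /\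
   OP1 (-1 - b) q ((\row_k (if k == 0 then ('X_0 ^+ N : S)%:F else 0) : 'rV[F]_2) 0 1).
  move=> q q0; rewrite !mxE /=; split; last exact: OP1_zero.
  rewrite aN; apply: OP1_poly; exact: dhomogXin.
by rewrite !mxE /= => /eqP; rewrite (negPf (X0 N)).
Qed.

Definition tri (w : S * S * S) (k : 'I_3) : S :=
  if k == 0 then w.1.1 else if k == 1 then w.1.2 else w.2.

Lemma tri_lin c w w' k : tri (c *: w + w') k = c *: tri w k + tri w' k.
Proof. by rewrite /tri; case: (ord3P k) => ->. Qed.

Definition Syz j w := (forall k, tri w k \is j.-homog) /\ \sum_k tri w k * phi ord0 k = 0.

Lemma Syz_closed j : closed_lin (Syz j).
Proof.
split.
  split=> [k|]; first by rewrite /tri; case: (ord3P k) => -> /=; apply: dhomog0.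
  by rewrite big1 // => k _; rewrite /tri; case: (ord3P k) => -> /=; rewrite mul0r.
move=> c u v [hu su] [hv sv]; split=> [k|].
  by rewrite tri_lin; apply: rpredD; rewrite ?rpredZ.
transitivity (c *: \sum_k tri u k * phi ord0 k + \sum_k tri v k * phi ord0 k).
  rewrite scaler_sumr -big_split; apply: eq_bigr => k _ /=.
  by rewrite tri_lin mulrDl scalerAl.
by rewrite su sv scaler0 addr0.
Qed.

(** The space H^0(P^1, O(j - e)); for e > j it is zero, where truncated subtraction alone would give
    the constants. *)
Definition trunc (j e : nat) (A : S) := if (e <= j)%N then A \is (j - e)%N.-homog : Prop else A = 0.

Lemma trunc_closed j e : closed_lin (trunc j e).
Proof.
rewrite /trunc; case: (e <= j)%N; first exact: homog_closed.
by split=> // x u v -> ->; rewrite scaler0 addr0.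
Qed.

Lemma fdim_trunc j e : fdim (trunc j e) (j.+1 - e).
Proof.
rewrite /trunc; case: leqP => [le|lt]; first by rewrite subSn //; apply: fdim_form2.
rewrite (eqP (lt : (j.+1 - e == 0)%N)); exists (fun=> 0); split=> // v ->.
by exists 0; split=> [|x _]; [rewrite comb0|apply/rowP; case].
Qed.

Lemma OP1_trunc (j e : nat) (k : int) (x : F) : k = e%:Z ->
  (forall q : 'rV[K]_2, q != 0 -> OP1 (j%:Z - k) q x) <-> exists2 A, trunc j e A & x = A%:F.
Proof.
move=> ->; rewrite /trunc; split=> [/OP1_global [A [-> hA A0]]|[A hA ->] q q0].
  exists A => //; case: leqP => [le|lt]; first by apply: hA; rewrite subzn.
  by apply: A0; move: lt; clear; lia.
move: hA; case: leqP => [le hA|_ ->]; last by rewrite tofrac0; apply: OP1_zero.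
by rewrite subzn //; apply: OP1_poly.
Qed.

Lemma fdim_syz (j a' b' : nat) : a = a'%:Z -> b = b'%:Z ->
  fdim (Syz j) ((j.+1 - a') + (j.+1 - b')).
Proof.
move=> aE bE; have [_ [i [C [C_im C_surj C_inj]]]] := splitting_frame.
pose frow (w : S * S * S) : 'rV[F]_2 := lift_row (fun k => (tri w k)%:F) i *m C.
pose rel (p : S * S) (w : S * S * S) := frow w 0 0 = p.1%:F /\ frow w 0 1 = p.2%:F.
have frow_lin c w w' : frow (c *: w + w') = (c%:MP : S)%:F *: frow w + frow w'.
  rewrite /frow scalemxAl -mulmxDl; congr (_ *m _); apply/rowP => k; rewrite !mxE tri_lin.
  by rewrite tofracD -mul_mpolyC tofracM.
have syzF w : \sum_k tri w k * phi ord0 k = 0 -> \sum_l (tri w l)%:F * frac_f l = 0 :> F.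
  move=> hs; rewrite -[RHS]tofrac0 -hs rmorph_sum /=; apply: eq_bigr => l _.
  by rewrite tofracM.
have e2 k : k = 0 \/ k = 1 :> 'I_2 := ord2P k.
have frow0 w j' : Syz j' w -> frow w 0 0 = 0 -> frow w 0 1 = 0 -> w = 0.
  move=> [hw hs] h0 h1.
  have fw0 : frow w = 0 by apply/rowP => k; rewrite [RHS]mxE; case: (e2 k) => ->.
  have t0 l : tri w l = 0.
    by have := C_inj _ (syzF w hs) fw0 l; rewrite -tofrac0 => /tofrac_inj.
  move: (t0 0) (t0 1) (t0 2%:R); rewrite /tri /=.
  by case: w {hw hs h0 h1 fw0 t0} => -[w0 w1] w2 /= -> -> ->.
apply: (@fdim_rel K _ _ (fun p : S * S => trunc j a' p.1 /\ trunc j b' p.2) _ rel).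
- split; first by split; [case: (trunc_closed j a')|case: (trunc_closed j b')].
  move=> c u v [u1 u2] [v1 v2]; have [_ h1] := trunc_closed j a'; have [_ h2] := trunc_closed j b'.
  by split; [apply: h1|apply: h2].
- exact: Syz_closed.
- have f0 : frow 0 = 0.
    rewrite /frow (_ : lift_row _ i = 0) ?mul0mx //; apply/rowP => k; rewrite !mxE.
    by rewrite /tri; case: (ord3P (lift i k)) => -> /=; rewrite tofrac0.
  by split; rewrite f0 mxE tofrac0.
- move=> c u v u' v' [u1 u2] [v1 v2]; have fl k : frow (c *: u' + v') 0 k = (c%:MP : S)%:F * frow u' 0 k + frow v' 0 k.
    by rewrite frow_lin mxE [X in X + _]mxE.
  by split; rewrite fl ?u1 ?v1 ?u2 ?v2 -tofracM -tofracD mul_mpolyC.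
- move=> [A B] /= [hA hB].
  have [|h [hx hs hh]] := C_surj (\row_k (if k == 0 then A%:F else B%:F)) j%:Z.
    move=> q q0; rewrite !mxE /=.
    split; [apply: (proj2 (OP1_trunc j _ aE)) q0|apply: (proj2 (OP1_trunc j _ bE)) q0].
      by exists A.
    by exists B.
  have Hl l : exists H, H \is j.-homog /\ h l = H%:F.
    have [H [hE hH _]] := OP1_global (fun q q0 => hh q l q0).
    by exists H; split=> //; apply: hH.
  have [H HE] := fin_all_exists Hl.
  have tE l : tri (H 0, H 1, H 2%:R) l = H l by rewrite /tri; case: (ord3P l) => ->.
  exists (H 0, H 1, H 2%:R).
    split=> [l|]; first by rewrite tE; case: (HE l).
    apply: tofrac_inj; rewrite rmorph_sum tofrac0 -[RHS]hs; apply: eq_bigr => l _ /=.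
    by rewrite tE tofracM; congr (_ * _); case: (HE l).
  have fr : frow (H 0, H 1, H 2%:R) = \row_k (if k == 0 then A%:F else B%:F).
    rewrite -hx /frow; congr (_ *m _); apply/rowP => l; rewrite !mxE tE.
    by case: (HE (lift i l)).
  by split; rewrite fr mxE.
- move=> w [hw hs].
  have hF (q : 'rV[K]_2) l : q != 0 -> OP1 j q (tri w l)%:F by move=> _; apply: OP1_poly.
  have HH := C_im _ _ (syzF w hs) hF.
  have [A hA AE] := proj1 (OP1_trunc j _ aE) (fun q q0 => proj1 (HH q q0)).
  have [B hB BE] := proj1 (OP1_trunc j _ bE) (fun q q0 => proj2 (HH q q0)).
  by exists (A, B).
- by move=> w hw [/=]; rewrite tofrac0 => h0 h1; apply: frow0 hw h0 h1.
- move=> [A B] _ [/=].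
  have f0 : frow 0 = 0.
    rewrite /frow (_ : lift_row _ i = 0) ?mul0mx //; apply/rowP => k; rewrite !mxE.
    by rewrite /tri; case: (ord3P (lift i k)) => -> /=; rewrite tofrac0.
  by rewrite f0 !mxE -tofrac0 => /tofrac_inj <- /tofrac_inj <-.
apply: fdim_prod; try exact: trunc_closed; exact: fdim_trunc.
Qed.

End Splitting.

(** * The multiplication map *)

Lemma homogS_split (K : comNzRingType) (N k : nat) (A : {mpoly K[N]}) : A \is k.+1.-homog ->
  exists2 B : 'I_N -> {mpoly K[N]}, forall l, B l \is k.-homog & A = \sum_l 'X_l * B l.
Proof.
move=> hA; rewrite (mpolyE A); elim: (msupp A) (dhomog_mf hA) => [|mm s IH] hs.
  by exists (fun=> 0) => [l|]; [apply: dhomog0|rewrite big_nil big1 // => l _; rewrite mulr0].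
have [|B hB BE] := IH; first by move=> x xs; apply: hs; rewrite inE xs orbT.
have e2 : mdeg mm = k.+1 by apply: hs; rewrite mem_head.
have [l hl] : exists l, mm l != 0%N.
  apply/existsP; rewrite -negb_forall; apply/negP => /forallP h; move: e2.
  by rewrite mdegE big1 // => l _; apply/eqP/h.
have mmE : mm = (U_(l) + (mm - U_(l)))%MM.
  apply/mnmP => x; rewrite mnmDE mnmBE mnm1E.
  by case: eqP => [<-|_]; rewrite ?subnKC ?lt0n // subn0.
exists (fun x => B x + (if x == l then A@_mm *: 'X_[mm - U_(l)] else 0)) => [x|].
  apply: rpredD => //; case: eqP => _; last exact: dhomog0.
  by apply: rpredZ; rewrite dhomogX /=; move: e2; rewrite {1}mmE mdegD mdeg1 add1n => -[->].
rewrite big_cons BE addrC; under [RHS]eq_bigr do rewrite mulrDr.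
rewrite big_split /=; congr (_ + _); rewrite (bigD1 l) //= eqxx big1 ?addr0 => [|x /negPf ->].
  by rewrite -scalerAr -mpolyXD -mmE.
exact: mulr0.
Qed.

Lemma exists_frame (K : fieldType) (v : 'rV[K]_3) : v != 0 ->
  exists M : 'M[K]_3, M \in unitmx /\ forall k, M 0 k = v 0 k.
Proof.
move=> v0; have rv : \rank v = 1%N by rewrite rank_rV v0.
pose x := col_ebase v 0 0.
have x0 : x != 0.
  have := col_ebase_unit v; rewrite [col_ebase v]mx11_scalar -/x unitmxE det_scalar1 unitfE.
  by [].
exists (x *: row_ebase v); split; first by rewrite unitmxZ ?unitfE // row_ebase_unit.
have vE : v = x *: (pid_mx 1 *m row_ebase v).
  by rewrite -[LHS]mulmx_ebase rv [col_ebase v]mx11_scalar -/x mul_scalar_mx -scalemxAl.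
move=> k; rewrite [in RHS]vE !mxE (bigD1 0) //= big1 ?addr0 => [|l l0].
  by rewrite !mxE mul1r.
by rewrite !mxE; case: l l0 => -[|l] //= lt _; rewrite mul0r.
Qed.

Lemma quotient_dim_frac (K : fieldType) (N : nat) (V W : {mpoly K[N]} -> Prop)
    (V' W' : ratfun K N -> Prop) (q : ratfun K N) v w :
  closed_lin V -> closed_lin W -> (forall A, W A -> V A) -> fdim V v -> fdim W w -> q != 0 ->
  (forall f, V' f <-> exists2 A, V A & f = A%:F / q) ->
  (forall f, W' f <-> exists2 A, W A & f = A%:F / q) -> quotient_dim V' W' (v - w).
Proof.
move=> lV lW WV dV dW q0 V'E W'E.
have [s [t [b [st ds Vb Hb]]]] := fdim_quotient lV lW WV dV.
have -> : (v - w = t)%N by rewrite -st (fdim_uniq lW ds dW) addKn.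
have sumE (c : 'rV[K]_t) : \sum_k ((c 0 k)%:MP)%:F * ((b k)%:F / q) = (comb b c)%:F / q :> ratfun K N.
  rewrite /comb rmorph_sum mulr_suml; apply: eq_bigr => k _ /=.
  by rewrite -mul_mpolyC tofracM mulrA.
have WE A (c : 'rV[K]_t) : W' (A%:F / q - \sum_k ((c 0 k)%:MP)%:F * ((b k)%:F / q)) <-> W (A - comb b c).
  rewrite sumE -mulrBl -tofracB W'E; split=> [[B WB e]|WB]; last by exists (A - comb b c).
  have /tofrac_inj -> : (A - comb b c)%:F = B%:F :> ratfun K N; last exact: WB.
  by move: e => /(congr1 ( *%R^~ q)); rewrite !(divfK q0).
exists (fun k => (b k)%:F / q); split=> [k|h /V'E [A VA ->]].
  by apply: (proj2 (V'E _)); exists (b k).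
have [c [Wc uc]] := Hb A VA; exists c; split; first exact: (proj2 (WE A c) Wc).
by move=> c' /(proj1 (WE A c')) /uc.
Qed.

(** * Sections of tL, and the multiplication map of L *)

Section PlaneSections.
Variables (K : closedFieldType) (n : nat) (P : 'I_n -> 'rV[K]_3).
Hypothesis P_neq0 : forall j, P j != 0.
Hypothesis P_distinct : forall j j', proj_eq (P j) (P j') -> j = j'.
Variable M : 'I_n -> 'M[K]_3.
Hypothesis M_unit : forall j, M j \in unitmx.
Hypothesis M_row : forall j, M j 0 = P j 0 :> ('I_3 -> K).

Lemma delta0_tw t l : delta0 (n := n) t l = tw t%:Z (fun=> 0) l.
Proof.
rewrite /delta0 /tw; case: (unliftP ord0 l) => [j|] ->.
  by rewrite eq_sym (negPf (neq_lift _ _)) mulr0.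
by rewrite eqxx mulr1 big1 ?subr0.
Qed.

Lemma H0_OXL t h : H0 P (OXL P t) h <-> exists2 A : {mpoly K[3]}, A \is t.-homog & h = A%:F.
Proof.
split=> [hh|[A hA ->] z zX].
  have [|A [hA hE _]] := sec_global P_neq0 P_distinct M_unit M_row (k := t) (c := fun=> 0) (f := h).
    by move=> z zX; have /OXL_sec := hh z zX; apply: sec_ext => l; apply: delta0_tw.
  by exists A.
apply/OXL_sec; apply: sec_ext (sec_loc P_neq0 P_distinct M_unit M_row hA (c := fun=> 0) _ zX) => [l|j c' [<-]].
  by rewrite delta0_tw.
exact: ordge0.
Qed.

Lemma H0_OX0 t Z h : H0 P (OX P t Z 0) h <-> exists2 A : {mpoly K[3]}, A \is t.-homog & h = A%:F.
Proof.
rewrite -H0_OXL; split=> hh z zX.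
  have := hh z zX (fun=> 0); rewrite big_ord0 mulr1; apply; by case.
by move=> g _; rewrite big_ord0 mulr1; apply: hh.
Qed.

Lemma quotient_dim_plane Z :
  quotient_dim (H0 P (OX P 2 Z 0)) (mul_image (H0 P (OX P 1 Z 0)) (H0 P (OXL P 1))) 0.
Proof.
exists (fun=> 0); split=> [[]//|h /H0_OX0 [A hA ->]].
exists 0; split=> [|c _]; last by apply/rowP; case.
rewrite big_ord0 subr0; have [B hB ->] := homogS_split hA.
exists 3, (fun k => (B k)%:F), (fun k => ('X_k)%:F); split=> [k|k|].
- by apply: (proj2 (H0_OX0 _ _ _)); exists (B k).
- by apply: (proj2 (H0_OXL _ _)); exists 'X_k => //; apply: dhomogXi.
by rewrite rmorph_sum; apply: eq_bigr => k _ /=; rewrite tofracM mulrC.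
Qed.

End PlaneSections.

(** The squeeze in numbers: [s] and [r] are consecutive dimensions, [Y] counts the forms of degree
    k, [X] the multiplicity conditions, and N is the degree on E. The lower bound Y - X and the
    upper bound s + N + 1 coincide. *)
Lemma RR_arith (s r X Y N k t i em d : int) :
  2%:Z * s = (t + 2%:Z) * (t + 1) + 2%:Z * i * (t * d + em) - i * (i - 1) ->
  Y <= r + X -> r <= s + (N + 1) ->
  2%:Z * X = (i + 1) * (i + 1) * (d * d + 1) - 2%:Z * (i + 1) * em + (i + 1) * (3%:Z * d - 1) ->
  2%:Z * Y = (k + 1 + 1) * (k + 1) -> N = t * d + em - (i + 1) -> k = t + (i + 1) * d ->
  2%:Z * r = (t + 2%:Z) * (t + 1) + 2%:Z * (i + 1) * (t * d + em) - (i + 1) * (i + 1 - 1)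
  /\ r = s + N + 1.
Proof.
move=> hs hY hr hX hY2 hN hk; rewrite {}hk in hY2; rewrite {}hN in hr *.
have h1 : 2%:Z * Y <= 2%:Z * r + 2%:Z * X by move: hY; clear; lia.
have h2 : 2%:Z * r <= 2%:Z * s + 2%:Z * (t * d + em - (i + 1) + 1) by move: hr; clear; lia.
rewrite hX hY2 in h1; rewrite hs in h2.
have e : 2%:Z * r = 2%:Z * s + 2%:Z * (t * d + em - (i + 1) + 1).
  by rewrite hs; move: h1 h2; clear; lia.
by split; [rewrite e hs; ring|move: e; clear; lia].
Qed.

(** * Restriction to E and the count of the cokernel *)

Section ExceptionalCurve.
Variables (K : closedFieldType) (n : nat) (P : 'I_n -> 'rV[K]_3).
Hypothesis P_neq0 : forall j, P j != 0.
Hypothesis P_distinct : forall j j', proj_eq (P j) (P j') -> j = j'.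
Variable M : 'I_n -> 'M[K]_3.
Hypothesis M_unit : forall j, M j \in unitmx.
Hypothesis M_row : forall j, M j 0 = P j 0 :> ('I_3 -> K).
Local Notation T := {mpoly K[n.+1 * 3]}.
Local Notation R := {mpoly K[3]}.
Local Notation S := {mpoly K[2]}.
Implicit Types (G H : T) (z : 'M[K]_(n.+1, 3)) (A : R) (c : 'I_n -> nat).
Variables (phi : 'M[S]_(n.+1, 3)) (dg : 'I_n.+1 -> nat).
Hypothesis phi_homog : forall i k, phi i k \is (dg i).-homog.
Hypothesis phi_X : forall q : 'rV[K]_2, q != 0 -> blowup_pt P (image_pt phi q).
Hypothesis d_gt0 : (0 < dg ord0)%N.
Local Notation d := (dg ord0).
Local Notation f := (phi ord0).
Local Notation W := (W M).
Variables (g : 'I_n -> S) (m : 'I_n -> nat).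
Hypothesis g_neq0 : forall j, g j != 0.
Hypothesis g_homog : forall j, g j \is (m j).-homog.
Hypothesis g_deg : forall j, (m j + dg (lift ord0 j) = d)%N.
Hypothesis g_cross : forall j k, cross (fun l => (P j 0 l)%:MP) f k = g j * phi (lift ord0 j) k.
Variable Q : R.
Hypothesis Q_homog : Q \is d.-homog.
Hypothesis Q_neq0 : Q != 0.
Hypothesis Q_ker : pb f Q = 0.
Hypothesis ker_Q : forall A k, A \is k.-homog -> pb f A = 0 -> exists A', A = Q * A'.
Hypothesis Q_ord : forall j, ordge (M j) (m j) Q.
Hypothesis Q_lead : forall j, (jet (M j) Q)`_(m j) != 0.
Local Notation dotm c := (\sum_j c j * m j)%N.
Local Notation gprod := (gprod g).
Local Notation sec := (sec P).
Local Notation pbsgE hG := (pb_sgE g_cross hG).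

Lemma ideal_curve z h : blowup_pt P z ->
  ideal_sheaf P (image_curve P phi) z h <-> sec (fun l => - tw d (fun j => (m j)%:Z) l) z (h / Q%:F).
Proof.
move=> zX; have QF0 : Q%:F != 0 by rewrite tofrac_eq0.
split=> [[e [G [H [hG hH GZ H0 hE]]]]|].
  have spG : sp phi G = 0.
    apply: form2_ext => q q0; rewrite meval0 -evpt_image; apply: GZ; split; first exact: phi_X.
    by exists q; split=> // i; exists 1; rewrite oner_eq0 scale1r.
  have hsG := sg_homog P hG.
  have pG : pb f (sg P G) = 0 by rewrite (pbsgE hG) spG mulr0.
  have [A AE] := ker_Q hsG pG.
  have sH := evpt_sg_neq0 P_neq0 P_distinct M_unit M_row zX hH H0.
  have hE2 : h / Q%:F = A%:F * ((sg P H)%:F)^-1.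
    have -> : h = (sg P G)%:F / (sg P H)%:F by rewrite hE sg.unlock.
    by rewrite AE tofracM mulrAC [Q%:F * _]mulrC (mulfK QF0).
  have [lt|le] := ltnP (\sum_i e i) d.
    have A0 : A = 0 by apply: (homog_cofactor_lt Q_neq0 Q_homog _ lt); rewrite -AE.
    by rewrite hE2 A0 tofrac0 mul0r; exact: (sec0 _ zX).
  have hA : A \is (\sum_i e i - d)%N.-homog.
    by apply: (homog_cofactor Q_neq0 Q_homog); rewrite -AE subnKC.
  have oA j (c : nat) : (e (lift ord0 j))%:Z - (m j)%:Z = c%:Z -> ordge (M j) c A.
    move=> ec; apply: (ordge_cancel (@Q_ord j) (Q_lead j)); rewrite -AE.
    have [oG _] := jet_sg_over M_row j (pt2 1 0) hG.
    by apply: ordge_le oG; move: ec; clear; lia.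
  have h1 := sec_loc P_neq0 P_distinct M_unit M_row hA oA zX.
  have h2 := sunit_inv (sunit_poly P hH H0).
  rewrite hE2; apply: sec_ext (sec_mul h1 (sunit_sec h2)) => i.
  rewrite /tw; case: (unliftP ord0 i) => [j|] ->; first by ring.
  rewrite -(subzn le) big_ord_recl PoszD Posz_sum sumrB; ring.
move=> [u [v [G [H [hG hH uv H0 hE]]]]].
have oQ j (c : nat) : (m j)%:Z = c%:Z -> ordge (M j) c Q by case=> <-.
(* Locally Q is a quotient of [G'] by [H'] with [H'] nonzero at z; since Q pulls back to zero, [G']
   vanishes on the curve, and it supplies the numerator. *)
have [u' [v' [G' [H' [hG' hH' uv' H0' QE]]]]] := sec_loc P_neq0 P_distinct M_unit M_row Q_homog oQ zX.
have sH := evpt_sg_neq0 P_neq0 P_distinct M_unit M_row zX hH' H0'.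
have spG' : sp phi G' = 0.
  have : pb f (sg P G') = 0.
    have -> : sg P G' = Q * sg P H' by apply: (tofrac_div_eqE sH (esym QE)).
    by rewrite rmorphM /= Q_ker mul0r.
  by rewrite (pbsgE hG') => /eqP; rewrite mulf_eq0 (negPf (gprod_neq0 g_neq0 _)) => /eqP.
exists (fun l => v l + v' l)%N, (G * G'), (H * H'); split.
- by apply: mh_ext (mhM hG hG') => l; have := uv l; have := uv' l; clear; lia.
- exact: mhM.
- move=> w [wX [q [q0 wE]]]; rewrite evptM.
  have [x Hx] := fin_all_exists wE.
  have w0 : evpt w G' = 0.
    apply/eqP; rewrite (@evpt_scale _ _ w (image_pt phi q) x u' G' hG') ?evpt_image ?spG' ?meval0 //.
      by move=> l; case: (Hx l).
    by move=> l k; have [_ /rowP/(_ k)] := Hx l; rewrite !mxE.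
  by rewrite w0 mulr0.
- by rewrite evptM mulf_neq0.
suff E : h = (sg P (G * G'))%:F / (sg P (H * H'))%:F by rewrite E sg.unlock.
by rewrite -[LHS](divfK QF0) hE QE tofrac_divM; congr (_%:F / _%:F); rewrite rmorphM.
Qed.

Lemma OX_curve t i z h : blowup_pt P z ->
  OX P t (image_curve P phi) i z h <->
  sec (tw (t + i * d)%N (fun j => (i * m j)%N%:Z)) z (h * Q%:F ^+ i).
Proof.
move=> zX; have QF0 : Q%:F != 0 by rewrite tofrac_eq0.
rewrite (OX_sec P_neq0 P_distinct M_unit M_row t i h zX QF0 (fun h => ideal_curve h zX)).
suff E l : delta0 t l + i%:Z * tw d (fun j => (m j)%:Z) l = tw (t + i * d)%N (fun j => (i * m j)%N%:Z) l.
  by split; apply: sec_ext.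
rewrite /delta0 /tw; case: (unliftP ord0 l) => [j|] ->.
  by rewrite eq_sym (negPf (neq_lift _ _)) mulr0 add0r.
rewrite eqxx mulr1 mulrBr PoszD PoszM addrA mulr_sumr; congr (_ - _).
Qed.

Lemma H0_curve t i h :
  H0 P (OX P t (image_curve P phi) i) h <->
  exists2 A, W (t + i * d) (fun j => i * m j)%N A & h = A%:F / Q%:F ^+ i.
Proof.
have QF0 : Q%:F ^+ i != 0 by rewrite expf_neq0 // tofrac_eq0.
split=> [hh|[A [hA oA] hE] z zX]; last first.
  apply/OX_curve => //; rewrite hE (divfK QF0).
  by apply: (sec_loc P_neq0 P_distinct M_unit M_row hA _ zX) => j c' [<-].
have [|A [hA hE oA]] := sec_global P_neq0 P_distinct M_unit M_row (k := (t + i * d)%N) (c := fun j => (i * m j)%N%:Z) (f := h * Q%:F ^+ i).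
  by move=> z zX; apply/OX_curve => //; apply: hh.
exists A; last by rewrite -hE (mulfK QF0).
by split=> // j; apply: oA.
Qed.

Hypothesis m_sq : (d * d + 1 = \sum_j m j * m j)%N.
Hypothesis m_sum : (\sum_j m j + 1 = 3 * d)%N.

(* H^0(X, tL + iE - \sum_j eps_j E_j), multiplied by Q^i. *)
Local Notation V t eps i := (W (t + i * d) (fun j => i * m j - eps j)%N).

Lemma V_ker t eps i A : (V t eps i.+1 A /\ pb f A = 0) <-> exists2 B, V t eps i B & Q * B = A.
Proof.
have le : (d <= t + i.+1 * d)%N by rewrite mulSn addnCA leq_addr.
rewrite (W_ker Q_homog Q_neq0 Q_ker ker_Q Q_ord Q_lead _ _ le).
have -> : (t + i.+1 * d - d = t + i * d)%N by rewrite mulSn addnCA addKn.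
by split=> -[B WB BE]; exists B => //; apply: W_ext WB => j; rewrite mulSn; clear; lia.
Qed.

(** The dimension known for i bounds the next one from above, the number of conditions bounds it
    from below, and [RR_arith] identifies the bounds. Equality in [curve_count] is then the
    surjectivity, obtained together with the dimension needed for the next step. *)
Lemma restriction_V t eps i : (forall j, eps j <= 1)%N -> (forall j, eps j <= m j)%N ->
  (i <= t * d + dotm eps)%N ->
  (exists r, fdim (V t eps i) r /\
     2%:Z * r%:Z = (t%:Z + 2%:Z) * (t%:Z + 1) + 2%:Z * i%:Z * (t * d + dotm eps)%N%:Z - i%:Z * (i%:Z - 1)) /\
  ((0 < i)%N -> forall h : S, h \is (t * d + dotm eps - i)%N.-homog ->
     exists2 A, V t eps i A & pb f A = gprod (fun j => i * m j - eps j)%N * h).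
Proof.
move=> eps1 epsm; elim: i => [_|i IH lei].
  (* For i = 0 the truncated multiplicity is 0: lowering it to -eps_j, that is, adding eps_j E_j,
     gives no new sections. *)
  split=> //; exists 'C(t.+2, 2); split.
    apply: fdim_ext (fdim_form3 K t) => A; split=> [hA|[]]; last by rewrite mul0n addn0.
    by split=> [|j]; rewrite ?mul0n ?addn0 // sub0n; apply: ordge0.
  rewrite binZ !intS; clear; lia.
have [[s [ds sE]] _] := IH (ltnW lei).
pose k := (t + i.+1 * d)%N; pose c j := (i.+1 * m j - eps j)%N.
pose N := (t * d + dotm eps - i.+1)%N.
have ec j : (eps j <= i.+1 * m j)%N by apply: leq_trans (epsm j) _; rewrite leq_pmull.
have cz j : (c j)%:Z = i.+1%:Z * (m j)%:Z - (eps j)%:Z by rewrite /c -(subzn (ec j)) PoszM.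
have dk : (d <= k)%N by rewrite /k mulSn addnCA leq_addr.
have msqz : \sum_j (m j)%:Z * (m j)%:Z = d%:Z * d%:Z + 1.
  by rewrite -[RHS]/((d * d + 1)%N%:Z) m_sq Posz_sum.
have msumz : \sum_j (m j)%:Z = 3%:Z * d%:Z - 1.
  by have := congr1 Posz m_sum; rewrite PoszD Posz_sum PoszM => <-; rewrite addrK.
(* The numbers of conditions contain eps_j^2 - eps_j, which vanishes as E_j is added at most
   once. *)
have epsz j : (eps j)%:Z * (eps j)%:Z = (eps j)%:Z by case: (eps j) (eps1 j) => [|[|//]].
have emz : (dotm eps)%:Z = \sum_j (eps j)%:Z * (m j)%:Z by rewrite Posz_sum.
have Nz : N%:Z = t%:Z * d%:Z + (dotm eps)%:Z - i.+1%:Z by rewrite /N -(subzn lei) PoszD PoszM.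
have kN : (k * d = dotm c + N)%N.
  apply/eqP; rewrite -eqz_nat PoszD Posz_sum Nz emz /k mulnDl PoszD !PoszM.
  have -> : \sum_j (c j * m j)%N%:Z = i.+1%:Z * \sum_j (m j)%:Z * (m j)%:Z - \sum_j (eps j)%:Z * (m j)%:Z.
    by rewrite mulr_sumr -sumrB; apply: eq_bigr => j _; rewrite PoszM cz; ring.
  rewrite msqz; apply/eqP; ring.
have [r [dr le_r _]] := fdim_W P_neq0 P_distinct M_unit M_row k c.
have dks : fdim (W (k - d) (fun j => c j - m j)%N) s.
  have -> : (k - d = t + i * d)%N by rewrite /k mulSn addnCA addKn.
  by apply: fdim_ext ds => A; split; apply: W_ext => j; rewrite /c mulSn; clear; lia.
have [/andP[_ le2] [surj _]] := curve_count P_neq0 P_distinct M_unit M_row phi_homog phi_X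
  g_neq0 g_homog g_cross Q_homog Q_neq0 Q_ker ker_Q Q_ord Q_lead dk kN dr dks.
have cbin : 2%:Z * (\sum_j 'C((c j).+1, 2))%N%:Z =
    i.+1%:Z * i.+1%:Z * \sum_j (m j)%:Z * (m j)%:Z - 2%:Z * i.+1%:Z * \sum_j (eps j)%:Z * (m j)%:Z
    + i.+1%:Z * \sum_j (m j)%:Z.
  rewrite Posz_sum !mulr_sumr -sumrB -big_split; apply: eq_bigr => j _ /=.
  rewrite binZ cz; transitivity (i.+1%:Z * i.+1%:Z * ((m j)%:Z * (m j)%:Z) - 2%:Z * i.+1%:Z * ((eps j)%:Z * (m j)%:Z)
    + i.+1%:Z * (m j)%:Z + ((eps j)%:Z * (eps j)%:Z - (eps j)%:Z)); first by ring.
  by rewrite epsz subrr addr0.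
rewrite msqz msumz -emz in cbin.
have kbin := binZ k.+1.
have kz : k%:Z = t%:Z + i.+1%:Z * d%:Z by rewrite /k PoszD PoszM.
have le_rz : 'C(k.+2, 2)%:Z <= r%:Z + (\sum_j 'C((c j).+1, 2))%N%:Z by rewrite -PoszD lez_nat.
have le2z : r%:Z <= s%:Z + (N%:Z + 1) by rewrite -[_ + 1]/((N + 1)%N%:Z) addn1 -PoszD lez_nat.
have iz : i.+1%:Z = i%:Z + 1 by rewrite -addn1 PoszD.
have kz1 : k.+1%:Z = k%:Z + 1 by rewrite -addn1 PoszD.
rewrite PoszD PoszM in sE; rewrite kz1 in kbin; rewrite iz in cbin Nz kz.
have [rE1 rE2] := RR_arith sE le_rz le2z cbin kbin Nz kz.
split; first by exists r; rewrite PoszD PoszM iz.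
have rE3 : r = (s + N.+1)%N by apply/eqP; rewrite -eqz_nat PoszD rE2 -addn1 PoszD addrA.
move=> _ h hh; exact: (surj rE3 h hh).
Qed.

(* H^0(X, tL + iE), embedded in the forms of degree t + id by the i-th power of
   the equation Q of E. *)
Definition Vt (t i : nat) : R -> Prop := W (t + i * d) (fun j => i * m j)%N.

(* The image of H^0(L + iE) (x) H^0(L) in H^0(2L + iE). *)
Definition Im (i : nat) (A : R) : Prop :=
  exists2 B : 'I_3 -> R, (forall k, Vt 1 i (B k)) & A = \sum_k 'X_k * B k.

Local Notation G i := (gprod (fun j => i * m j)%N).

Lemma dotm0 : dotm (fun=> 0%N) = 0%N.
Proof. by rewrite big1. Qed.

Lemma Vt_V t i A : Vt t i A <-> V t (fun=> 0%N) i A.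
Proof. by split; apply: W_ext => j; rewrite subn0. Qed.

Lemma Vt_restriction t i : (i <= t * d)%N ->
  (exists r, fdim (Vt t i) r /\
     2%:Z * r%:Z = (t%:Z + 2%:Z) * (t%:Z + 1) + 2%:Z * i%:Z * (t * d)%N%:Z - i%:Z * (i%:Z - 1)) /\
  ((0 < i)%N -> forall h : S, h \is (t * d - i)%N.-homog -> exists2 A, Vt t i A & pb f A = G i * h).
Proof.
move=> le; have [//|//||[r [dr rE]] surj] := @restriction_V t (fun=> 0%N) i; first by rewrite dotm0 addn0.
rewrite dotm0 addn0 in rE surj; split.
  by exists r; split=> //; apply: fdim_ext dr => A; rewrite Vt_V.
move=> i0 h /(surj i0) [A /Vt_V VA pA]; exists A => //; rewrite pA; congr (_ * _).
by apply: eq_bigr => j _; rewrite subn0.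
Qed.

Lemma Vt_ker t i A : (Vt t i.+1 A /\ pb f A = 0) <-> exists2 B, Vt t i B & Q * B = A.
Proof.
rewrite Vt_V V_ker; split=> -[B VB BE]; exists B => //; exact/Vt_V.
Qed.

Lemma pb_Vt t i A : (i <= t * d)%N -> Vt t i A ->
  exists2 h : S, h \is (t * d - i)%N.-homog & pb f A = G i * h.
Proof.
move=> le /(pb_W P_neq0 P_distinct M_unit M_row phi_homog phi_X g_neq0 g_homog g_cross) [h [hE hh _]].
exists h => //; apply: hh.
have -> : (\sum_j i * m j * m j = i * (d * d + 1))%N.
  by rewrite m_sq big_distrr; apply: eq_bigr => j _ /=; rewrite mulnA.
by rewrite mulnDl mulnDr muln1 mulnA -addnA subnKC // addnC.
Qed.

Lemma Vt_mulX i k A : Vt 1 i A -> Vt 2 i ('X_k * A).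
Proof.
move=> [hA oA]; split=> [|j]; first by rewrite -[(2 + _)%N]/(1 + (1 + i * d))%N; apply: dhomogM => //; apply: dhomogXi.
by rewrite mulrC; apply: ordge_mulr.
Qed.

Lemma Im_V i A : Im i A -> Vt 2 i A.
Proof.
move=> [B VB ->]; elim/big_ind: _ => [|u v|k _]; last exact: Vt_mulX.
  by have [] := W_closed M (2 + i * d) (fun j => i * m j)%N.
exact: (closedD (W_closed M _ _)).
Qed.

Lemma Im_closed i : closed_lin (Im i).
Proof.
have [V0 Vl] := W_closed M (1 + i * d) (fun j => i * m j)%N.
split; first by exists (fun=> 0) => //; rewrite big1 // => k _; rewrite mulr0.
move=> c _ _ [B VB ->] [B' VB' ->]; exists (fun k => c *: B k + B' k); first by move=> k; exact: (Vl _ _ _ (VB k) (VB' k)).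
by rewrite scaler_sumr -big_split; apply: eq_bigr => k _ /=; rewrite mulrDr scalerAr.
Qed.

Lemma Vt_closed t i : closed_lin (Vt t i).
Proof. exact: W_closed. Qed.

Lemma Im_0 A : Vt 2 0 A -> Im 0 A.
Proof.
move=> [hA _]; have Vlin : forall B : R, B \is 1.-homog -> Vt 1 0 B.
  by move=> B hB; split=> // j; apply: ordge0.
rewrite /= mul0n addn0 in hA.
have [B hB ->] := homogS_split hA; exists B => // k; exact: Vlin.
Qed.

Lemma mul_image_curve i h :
  mul_image (H0 P (OX P 1 (image_curve P phi) i)) (H0 P (OXL P 1)) h <->
  exists2 A, Im i A & h = A%:F / Q%:F ^+ i.
Proof.
have QF0 : Q%:F ^+ i != 0 by rewrite expf_neq0 // tofrac_eq0.
have H0X := H0_OXL P_neq0 P_distinct M_unit M_row.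
split=> [[r [u [v [hu hv ->]]]]|[A [B VB ->] ->]].
  have [A VA AE] := fin_all_exists2 (fun k => proj1 (H0_curve 1 i (u k)) (hu k)).
  have [B hB BE] := fin_all_exists2 (fun k => proj1 (H0X 1 (v k)) (hv k)).
  exists (\sum_k A k * B k).
    elim/big_ind: _ => [|x y|k _]; [by case: (Im_closed i)|exact: (closedD (Im_closed i))|].
    have [C hC ->] := homogS_split (hB k); exists (fun l => C l * A k).
      move=> l; rewrite (homog_eq0C (hC l)) mul_mpolyC; exact: (closedZ _ (Vt_closed 1 i) (VA k)).
    by rewrite mulr_sumr; apply: eq_bigr => l _; rewrite mulrCA [A k * _]mulrC.
  rewrite rmorph_sum mulr_suml; apply: eq_bigr => k _ /=.
  by rewrite AE BE tofracM mulrAC.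
exists 3, (fun k => (B k)%:F / Q%:F ^+ i), (fun k => ('X_k)%:F); split=> [k|k|].
- by apply: (proj2 (H0_curve 1 i _)); exists (B k) => //; apply: VB.
- by apply: (proj2 (H0X 1 _)); exists 'X_k => //; apply: dhomogXi.
rewrite rmorph_sum mulr_suml; apply: eq_bigr => k _ /=.
by rewrite tofracM [RHS]mulrC mulrA.
Qed.

Lemma fdim_triple j : fdim (fun w : S * S * S => forall k, tri w k \is j.-homog) (3 * j.+1).
Proof.
have hc := homog_closed K 2 j; have fd := fdim_form2 K j.
have pc : closed_lin (fun w : S * S => w.1 \is j.-homog /\ w.2 \is j.-homog).
  by case: hc => h0 hl; split=> // c u v [u1 u2] [v1 v2]; split; apply: hl.
have -> : (3 * j.+1 = j.+1 + j.+1 + j.+1)%N by clear; lia.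
apply: fdim_ext (fdim_prod pc hc (fdim_prod hc hc fd fd) fd) => -[[w0 w1] w2] /=; split.
  by move=> [[h0 h1] h2] k; rewrite /tri; case: (ord3P k) => ->.
by move=> h; split; [split; [exact: (h 0)|exact: (h 1)]|exact: (h 2%:R)].
Qed.

Lemma triple_closed j : closed_lin (fun w : S * S * S => forall k, tri w k \is j.-homog).
Proof.
split=> [k|x u v hu hv k]; first by rewrite /tri; case: (ord3P k) => -> /=; apply: dhomog0.
by rewrite tri_lin; apply: rpredD; rewrite ?rpredZ.
Qed.

Definition tdot (w : S * S * S) : S := \sum_k tri w k * f k.

Lemma tdot_lin x u v : tdot (x *: u + v) = x *: tdot u + tdot v.
Proof.
rewrite /tdot scaler_sumr -big_split; apply: eq_bigr => k _ /=.
by rewrite tri_lin mulrDl scalerAl.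
Qed.

Lemma triE (h : 'I_3 -> S) k : tri (h 0, h 1, h 2%:R) k = h k.
Proof. by rewrite /tri; case: (ord3P k) => ->. Qed.

Variable sigma : nat -> nat.
Hypothesis fdim_sigma : forall j, fdim (Syz phi j) (sigma j).

(** A lift is a relation among the X_k with coefficients in H^0(L + (i+1)E); its pullback contains
    the factor that the multiplicities force, and the rest is the given syzygy. *)
Definition lifts i := forall w, Syz phi (d - i.+1) w ->
  exists2 A : 'I_3 -> R, forall k, Vt 1 i.+1 (A k) /\ pb f (A k) = G i.+1 * tri w k & \sum_k 'X_k * A k = 0.

(** Coefficients on E of degree d - (i+1) lift to X, so [Im i.+1] restricts onto the image of the
    triples of such forms, of dimension 3(d - i) minus that of the syzygies. The kernel contains Q
    times [Im i]; a strict inclusion there is the only source of inequality. *)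
Lemma Im_step i w w' : (i < d)%N -> fdim (Im i) w -> fdim (Im i.+1) w' ->
  (w + 3 * (d - i) <= w' + sigma (d - i.+1))%N /\
  ((forall A, Im i.+1 A -> pb f A = 0 -> exists2 B, Im i B & Q * B = A) ->
    (w + 3 * (d - i) = w' + sigma (d - i.+1))%N).
Proof.
move=> lt dw dw'; set j := (d - i.+1)%N; have jE : (d - i = j.+1)%N by rewrite /j; move: lt; clear; lia.
have le1 : (i.+1 <= 1 * d)%N by rewrite mul1n.
have [_ /(_ isT) surj1] := Vt_restriction le1.
have [s [t [st ds dt]]] := rank_nullity (@pb_lin K n phi) (Im_closed i.+1) dw'.
have [s' [u [su ds' du]]] := rank_nullity tdot_lin (triple_closed j) (fdim_triple j).
have s'E : s' = sigma j.
  apply: (fdim_uniq (closed_ker tdot_lin (triple_closed j)) ds').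
  by apply: fdim_ext (fdim_sigma j) => x.
have lG x (A B : S) : G i.+1 * (x *: A + B) = x *: (G i.+1 * A) + G i.+1 * B by rewrite mulrDr scalerAr.
have cIm := closed_im tdot_lin (triple_closed j).
have Ginj (v : S) : (exists2 x, (forall k, tri x k \is j.-homog) & tdot x = v) -> G i.+1 * v = 0 -> v = 0.
  by move=> _ /eqP; rewrite mulf_eq0 (negPf (gprod_neq0 g_neq0 _)) => /eqP.
have dGu := fdim_inj_im lG cIm Ginj du.
have tu : t = u.
  apply: (fdim_uniq (closed_im (@pb_lin K n phi) (Im_closed i.+1)) dt).
  apply: fdim_ext dGu.
  move=> v; split=> [[_ [x hx <-] <-]|[_ [B VB ->] <-]].
    have HA k : exists2 A, Vt 1 i.+1 A & pb f A = G i.+1 * tri x k.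
      by apply: surj1; rewrite mul1n; apply: hx.
    have [A VA pA] := fin_all_exists2 HA.
    exists (\sum_k 'X_k * A k); first by exists A.
    rewrite rmorph_sum /tdot mulr_sumr; apply: eq_bigr => k _ /=.
    by rewrite rmorphM /= pbX pA mulrCA [f k * _]mulrC.
  have [h Hh hE] := fin_all_exists2 (fun k => pb_Vt le1 (VB k)).
  exists (tdot (h 0, h 1, h 2%:R)).
    exists (h 0, h 1, h 2%:R) => // k; rewrite triE; have := Hh k; by rewrite mul1n.
  rewrite rmorph_sum /tdot mulr_sumr; apply: eq_bigr => k _ /=.
  by rewrite rmorphM /= pbX triE hE mulrA mulrC.
have lQ x (A B : R) : Q * (x *: A + B) = x *: (Q * A) + Q * B by rewrite mulrDr scalerAr.
have Qinj (v : R) : Im i v -> Q * v = 0 -> v = 0.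
  by move=> _ /eqP; rewrite mulf_eq0 (negPf Q_neq0) => /eqP.
have dQ := fdim_inj_im lQ (Im_closed i) Qinj dw.
have cQ := closed_im lQ (Im_closed i).
have cK := closed_ker (@pb_lin K n phi) (Im_closed i.+1).
have sub A : (exists2 B, Im i B & Q * B = A) -> Im i.+1 A /\ pb f A = 0.
  move=> [_ [B VB ->] <-]; split; last by rewrite rmorphM /= Q_ker mul0r.
  exists (fun k => Q * B k); last by rewrite mulr_sumr; apply: eq_bigr => k _; rewrite mulrCA.
  by move=> k; have [] := proj2 (Vt_ker 1 i (Q * B k)) (ex_intro2 _ _ (B k) (VB k) erefl).
have ws := fdim_le cK cQ sub dQ ds.
rewrite jE -st tu -s'E -su; split; first by move: ws; clear; lia.
move=> rev; suff -> : s = w by clear; lia.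
apply: (fdim_uniq cK ds); apply: fdim_ext dQ => A; split; first exact: sub.
by case; apply: rev.
Qed.

Lemma Im_full_step i : (forall A, Vt 2 i A -> Im i A) ->
  forall A, Im i.+1 A -> pb f A = 0 -> exists2 B, Im i B & Q * B = A.
Proof.
move=> full A /Im_V VA pA.
by have [B VB BE] := proj1 (Vt_ker 2 i A) (conj VA pA); exists B => //; apply: full.
Qed.

(** If \sum_k X_k B_k vanishes on E, the B_k restrict to a syzygy. Subtracting a lift of it does not
    change the sum and makes every coefficient divisible by Q. *)
Lemma lifts_step i : (i < d)%N -> lifts i ->
  forall A, Im i.+1 A -> pb f A = 0 -> exists2 B, Im i B & Q * B = A.
Proof.
move=> lt lf _ [B VB ->] pA; have le1 : (i.+1 <= 1 * d)%N by rewrite mul1n.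
have [h Hh hE] := fin_all_exists2 (fun k => pb_Vt le1 (VB k)).
have hs : Syz phi (d - i.+1) (h 0, h 1, h 2%:R).
  split=> [k|]; first by rewrite triE; have := Hh k; rewrite mul1n.
  apply: (mulfI (gprod_neq0 g_neq0 (fun j => i.+1 * m j)%N)); rewrite mulr0 -[RHS]pA rmorph_sum mulr_sumr.
  by apply: eq_bigr => k _; rewrite triE rmorphM /= pbX hE [in RHS]mulrCA [f k * _]mulrC.
have [A HA A0] := lf _ hs.
have HC k : exists2 C, Vt 1 i C & Q * C = B k - A k.
  apply: (proj1 (Vt_ker 1 i _)); have [VA pAk] := HA k; split.
    exact: (closedB (Vt_closed 1 i.+1) (VB k) VA).
  by rewrite rmorphB /= hE pAk triE subrr.
have [C VC CE] := fin_all_exists2 HC.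
exists (\sum_k 'X_k * C k); first by exists C.
rewrite mulr_sumr -[RHS]subr0 -[X in _ = _ - X]A0 -sumrB; apply: eq_bigr => k _.
by rewrite mulrCA CE mulrBr.
Qed.

Lemma lifts_nosyz i : sigma (d - i.+1) = 0%N -> lifts i.
Proof.
move=> s0 w Sw; have := fdim_sigma (d - i.+1); rewrite s0 => -[x [_ Hx]].
have [c [wc _]] := Hx w Sw; rewrite /comb big_ord0 in wc.
exists (fun=> 0); last by rewrite big1 // => k _; rewrite mulr0.
move=> k; split; first by have [] := Vt_closed 1 i.+1.
by rewrite rmorph0 wc /tri; case: (ord3P k) => ->; rewrite mulr0.
Qed.

(* The pencil of lines through P_j: its restriction to E is the syzygy given by
   the (lift ord0 j)-th row of phi, of degree d - m_j. *)
Lemma lifts_pencil j0 i : (i < m j0)%N -> sigma (d - i.+1) = (m j0 - i)%N -> lifts i.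
Proof.
move=> lt sE; set j := (d - i.+1)%N in sE *; pose l := phi (lift ord0 j0).
pose F (h : S) : S * S * S := (h * l 0, h * l 1, h * l 2%:R).
have Fl x u v : F (x *: u + v) = x *: F u + F v.
  by rewrite /F !mulrDl -!scalerAl.
have FE h k : tri (F h) k = h * l k by rewrite /F (triE (fun k => h * l k)).
have jE : (m j0 - i.+1 + dg (lift ord0 j0) = j)%N.
  by rewrite /j -(g_deg j0); move: lt; clear; lia.
have Finj (h : S) : h \is (m j0 - i.+1)%N.-homog -> F h = 0 -> h = 0.
  move=> _ F0; have [k lk] := phi_neq0 phi_X (lift ord0 j0).
  have : h * l k = 0 by rewrite -FE F0 /tri; case: (ord3P k) => ->.
  by move=> /eqP; rewrite mulf_eq0 (negPf lk) orbF => /eqP.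
have dU := fdim_inj_im Fl (homog_closed K 2 (m j0 - i.+1)) Finj (fdim_form2 K _).
have cU := closed_im Fl (homog_closed K 2 (m j0 - i.+1)).
have ldot : \sum_k l k * f k = 0.
  have [_ d2] := phi_incident phi_X j0; by rewrite -[RHS]d2 dotC.
have sub w : (exists2 h, h \is (m j0 - i.+1)%N.-homog & F h = w) -> Syz phi j w.
  move=> [h hh <-]; split=> [k|].
    rewrite FE -jE; exact: (dhomogM hh (phi_homog _ _)).
  transitivity (h * \sum_k l k * f k); last by rewrite ldot mulr0.
  rewrite mulr_sumr; apply: eq_bigr => k _.
  by rewrite FE mulrA.
(* The multiples of the pencil syzygy by forms of degree m_j0 - i - 1 have dimension m_j0 - i, the
   same as all syzygies of this degree. *)
have [s [_ ds surj]] := fdim_sub (Syz_closed phi j) cU sub (fdim_sigma j).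
have ss : s = sigma j.
  by rewrite sE (fdim_uniq cU ds dU); move: lt; clear; lia.
move=> w /(surj ss) [h hh <-].
pose eps (j' : 'I_n) : nat := (j' == j0).
have eps1 j' : (eps j' <= 1)%N by rewrite /eps; case: eqP.
have epsm j' : (eps j' <= m j')%N.
  by rewrite /eps; case: eqP => // ->; apply: leq_ltn_trans lt.
have deps : dotm eps = m j0.
  by rewrite (bigD1 j0) //= /eps eqxx mul1n big1 ?addn0 // => j' /negPf ->.
(* The multiplier [h] has the degree of (i+1)E + E_j0 on E and lifts to a section [eta] of this
   class; times the sections of L - E_j0 given by the pencil, it yields sections of L + (i+1)E. *)
have [|_ /(_ isT h)] := @restriction_V 0 eps i.+1 eps1 epsm; first by rewrite mul0n add0n deps.
rewrite mul0n add0n deps => /(_ hh) [eta Veta peta].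
pose X k : R := cross (fun l => (P j0 0 l)%:MP) (fun l => 'X_l) k.
have WX k : W 1 eps (X k).
  split; first by rewrite /X /cross !mul_mpolyC; apply: rpredB; apply/rpredZ/dhomogXi.
  move=> j'; rewrite /eps; case: eqP => [->|_]; last exact: ordge0.
  move=> e; rewrite ltnS leqn0 => /eqP ->; rewrite jet_coef0 mevalB !mevalM !mevalC !mevalXU !M_row.
  by rewrite mulrC subrr mpolyC0.
exists (fun k => eta * X k); last first.
  transitivity (eta * dot (fun k => 'X_k) X); last by rewrite crossr mulr0.
  by rewrite mulr_sumr; apply: eq_bigr => k _; rewrite mulrCA.
move=> k; split.
  have := W_M Veta (WX k); rewrite add0n addnC; apply: W_le => j'.
  by rewrite addnC -leq_subLR.
have geps : gprod eps = g j0.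
  rewrite /gprod (bigD1 j0) //= /eps eqxx expr1 big1 ?mulr1 // => j' /negPf ->.
  exact: expr0.
have GE : G i.+1 = gprod (fun j' => i.+1 * m j' - eps j')%N * g j0.
  rewrite -geps -gprodD; apply: eq_bigr => j' _; rewrite subnK //.
  by apply: leq_trans (epsm j') _; rewrite leq_pmull.
have pX : pb f (X k) = g j0 * l k.
  by rewrite -g_cross /X /cross rmorphB !rmorphM /= !pbC !pbX.
by rewrite rmorphM /= peta pX FE GE; ring.
Qed.

Variables a b : nat.
Hypothesis a_le_b : (a <= b)%N.
Hypothesis ab_d : (a + b = d)%N.
Hypothesis sigmaE : forall j, sigma j = (j.+1 - a + (j.+1 - b))%N.

(** The condition for equality persists when i decreases, so equality can be carried through the
    induction. *)
Lemma cokernel_count i : (i <= d)%N -> exists v w, [/\ fdim (Vt 2 i) v, fdim (Im i) w,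
  (v <= w + ('C(i - b, 2) + 'C(i - a, 2)))%N &
  (i <= a + 2)%N \/ (b <= a + 2)%N \/ (exists j, b = m j) ->
    v = (w + ('C(i - b, 2) + 'C(i - a, 2)))%N].
Proof.
have ImV i' := Im_V (i := i').
elim: i => [_|i IH lt].
  exists 6, 6; have d6 : fdim (Vt 2 0) 6.
    apply: fdim_ext (fdim_form3 K 2) => A; split=> [hA|[]].
      by split; [rewrite mul0n addn0|move=> j; rewrite mul0n; apply: ordge0].
    by rewrite mul0n addn0.
  split=> //; first by apply: fdim_ext d6 => A; split; [apply: Im_0|apply: Im_V].
have [v [w [dv dw le_vw eq_vw]]] := IH (ltnW lt).
have le2 : (i.+1 <= 2 * d)%N by move: lt; clear; lia.
have [[v' [dv' v'E]] _] := Vt_restriction le2.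
have [[v0 [dv0 v0E]] _] := Vt_restriction (ltnW le2).
have vv0 := fdim_uniq (Vt_closed 2 i) dv dv0; rewrite -{}vv0 in v0E.
have vE : v' = (v + (2 * d - i))%N.
  move: v'E v0E le2; rewrite !PoszM -addn1 PoszD; clear; nia.
have [w' [_ dw' w'full]] := fdim_sub (Vt_closed 2 i.+1) (Im_closed i.+1) (@ImV _) dv'.
have [w'le w'eq] := Im_step lt dw dw'.
(* The target grows by 2d - i and the image by at least 3(d - i) minus the number of syzygies; the
   difference is (i - a) + (i - b) with truncated subtraction. *)
have sigE : (sigma (d - i.+1) + 2 * i = d + (i - a) + (i - b))%N.
  by rewrite sigmaE; move: lt ab_d; clear; lia.
(* Pascal's rule survives truncation: for x > i all three terms are zero. *)
have binS2 x : 'C(i.+1 - x, 2) = ('C(i - x, 2) + (i - x))%N.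
  have [le|gt] := leqP x i; first by rewrite subSn // binS bin1 addnC.
  by rewrite (eqP (ltnW gt : (i - x == 0)%N)) (eqP (gt : (i.+1 - x == 0)%N)).
exists v', w'; split=> //.
  by rewrite !binS2 vE; move: le_vw w'le sigE lt; clear; lia.
move=> cond; have cond' : (i <= a + 2)%N \/ (b <= a + 2)%N \/ (exists j, b = m j).
  by case: cond => [/ltnW|]; [left|right].
have {}eq_vw := eq_vw cond'.
have rev : forall A, Im i.+1 A -> pb f A = 0 -> exists2 B, Im i B & Q * B = A.
  (* For i <= a + 1 <= b + 1 both binomials at i vanish, so the multiplication map at i is already
     onto. *)
  have [small|big] := leqP i a.+1.
    apply: Im_full_step.
    have vw : v = w.
      rewrite eq_vw !bin_small ?addn0 //; move: small a_le_b; clear; lia.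
    have [w1 [_ dw1 full]] := fdim_sub (Vt_closed 2 i) (Im_closed i) (@ImV _) dv.
    by apply: full; rewrite vw; apply: (fdim_uniq (Im_closed i)).
  (* Now i >= a + 2. For i >= b the degree d - i - 1 is less than a, so there are no syzygies; for i
     < b only the condition b = m_j can hold. *)
  apply: (lifts_step lt); have [le_bi|lt_ib] := leqP b i.
    by apply: lifts_nosyz; rewrite sigmaE; move: le_bi big ab_d lt; clear; lia.
  case: cond => [|[|[j0 bj]]]; try by move: lt_ib big; clear; lia.
  apply: (@lifts_pencil j0); first by rewrite -bj.
  by rewrite -bj sigmaE; move: lt_ib big ab_d lt; clear; lia.
have := w'eq rev; rewrite !binS2 vE eq_vw; move: sigE lt; clear; lia.
Qed.

End ExceptionalCurve.

(** * From intersection numbers and stalks to the numerical setting *)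

Lemma binom2_sub (i b : nat) : binom2 (i%:Z - b%:Z) = 'C(i - b, 2).
Proof.
rewrite /binom2; have [le|lt] := leqP b i; last first.
  by rewrite (eqP (ltnW lt : (i - b == 0)%N)); case: ifP => //; move: lt; clear; lia.
rewrite subzn //=; case: ifP => // h; rewrite bin_small //.
by move: h; clear; lia.
Qed.

Theorem theorem3p3 (K : closedFieldType) (n : nat) (P : 'I_n -> 'rV[K]_3)
    (P_neq0 : forall j, P j != 0)
    (P_distinct : forall j j', proj_eq (P j) (P j') -> j = j')
    (phi : 'M[{mpoly K[2]}]_(n.+1, 3))
    (E_smooth_rational : smooth_rational_curve P phi)
    (E_E : degree_on P phi (OX P 0 (image_curve P phi) 1) (-1))
    (d : int) (E_L : degree_on P phi (OXL P 1) d)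
    (mult : 'I_n -> int)
    (E_Ej : forall j, degree_on P phi (OX P 0 (exceptional P j) 1) (mult j))
    (m : int) (m_max : (exists j, mult j = m) /\ (forall j, mult j <= m))
    (i : nat) (i_le_d : i%:Z <= d)
    (a b : int) (a_le_b : a <= b) (E_splitting : splitting_type phi a b) :
  exists r : nat,
    [/\ quotient_dim
          (H0 P (OX P 2 (image_curve P phi) i))
          (mul_image (H0 P (OX P 1 (image_curve P phi) i)) (H0 P (OXL P 1)))
          r,
        (r <= binom2 (i%:Z - b) + binom2 (i%:Z - a))%N &
        (i%:Z <= a + 2 \/ b - a <= 2 \/ a = d - m ->
         r = (binom2 (i%:Z - b) + binom2 (i%:Z - a))%N)].
Proof.
have [[[dg phi_homog] phi_X] _ phi_imm] := E_smooth_rational.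
have HM j : exists M : 'M[K]_3, M \in unitmx /\ M 0 = P j 0 :> ('I_3 -> K).
  have [M [uM ME]] := exists_frame (P_neq0 j).
  exists M; split=> //.
  by apply: functional_extensionality => k; apply: ME.
have [M HM'] := fin_all_exists HM.
have M_unit j : M j \in unitmx by case: (HM' j).
have M_row j : M j 0 = P j 0 :> ('I_3 -> K) by case: (HM' j).
have f_bpf (q : 'rV[K]_2) : q != 0 -> exists k, (phi ord0 k).@[q 0] != 0.
  move=> q0; have [h _] := phi_X q q0; have [k hk] := row_neq0 (h ord0).
  by exists k; move: hk; rewrite !mxE.
have [a_ge0 b_ge0] := splitting_ge0 (phi_homog ord0) f_bpf E_splitting.
have [ab_d _] := splitting_frame (phi_homog ord0) f_bpf E_splitting.
have dE : d = (dg ord0)%:Z.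
  have HJ z : blowup_pt P z -> forall h, OXL P 1 z h <-> sec P (delta0 1) z (h * 1).
    by move=> zX h; rewrite mulr1 OXL_sec.
  have := degree_sec P_neq0 P_distinct M_unit M_row phi_homog phi_X (oner_neq0 _) HJ E_L.
  by move=> ->; rewrite big_ord_recl /delta0 eqxx !mul1r big1 ?addr0 // => j _; rewrite mul1r mul0r.
have multE j : mult j = (dg ord0)%:Z - (dg (lift ord0 j))%:Z.
  have HJ z : blowup_pt P z -> forall h, OX P 0 (exceptional P j) 1 z h <-> sec P (fun l => - dv j l) z (h * 1).
    by move=> zX h; apply: OX_exceptional.
  have := degree_sec P_neq0 P_distinct M_unit M_row phi_homog phi_X (oner_neq0 _) HJ (E_Ej j).
  by rewrite sum_dv.
have [a' aE] : exists a' : nat, a = a'%:Z by exists `|a|%N; rewrite gez0_abs.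
have [b' bE] : exists b' : nat, b = b'%:Z by exists `|b|%N; rewrite gez0_abs.
rewrite {}dE in E_L i_le_d *; rewrite aE bE !binom2_sub.
rewrite {}aE {}bE in a_le_b E_splitting ab_d *; clear a_ge0 b_ge0.
(* Only for i = 0 can d be 0; the remaining argument needs d > 0 in order to have a plane equation
   of E. *)
case: i i_le_d => [_|i lei].
  by exists 0%N; rewrite !sub0n; split=> //; apply: (quotient_dim_plane P_neq0 P_distinct M_unit M_row).
have d_gt0 : (0 < dg ord0)%N by apply: leq_ltn_trans (lei : (i < dg ord0)%N).
have [g [m' Hg]] := exists_g P_neq0 phi_homog phi_X d_gt0.
have g_neq0 j : g j != 0 by case: (Hg j).
have g_homog j : g j \is (m' j).-homog by case: (Hg j).
have g_deg j : (m' j + dg (lift ord0 j) = dg ord0)%N by case: (Hg j).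
have g_cross j : forall k, cross (fun l => (P j 0 l)%:MP) (phi ord0) k = g j * phi (lift ord0 j) k by case: (Hg j).
have [Q [D [mu [Q_homog Q_neq0 Q_ker ker_Q Q_mu]]]] := exists_Q M_unit phi_homog phi_X d_gt0.
have phi_full := curve_full P_neq0 P_distinct M_unit M_row phi_homog phi_X phi_imm.
have [DE muE msq] := curve_class P_neq0 P_distinct M_unit M_row phi_homog phi_X g_neq0 g_homog g_deg g_cross
  Q_homog Q_neq0 Q_ker ker_Q (fun j => proj1 (Q_mu j)) (fun j => proj2 (Q_mu j)) phi_full.
rewrite DE in Q_homog.
have Q_ord j : ordge (M j) (m' j) Q by rewrite -muE; case: (Q_mu j).
have Q_lead j : (jet (M j) Q)`_(m' j) != 0 by rewrite -muE; case: (Q_mu j).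
(* The equation Q trivializes O_X(E) in the class dL - \sum_j m_j E_j, whose degree on E is d^2 -
   \sum_j m_j^2; by hypothesis it is -1. *)
have m_sq : (dg ord0 * dg ord0 + 1 = \sum_j m' j * m' j)%N.
  have QF0 : Q%:F ^+ 1 != 0 by rewrite expr1 tofrac_eq0.
  have HJ z : blowup_pt P z -> forall h, OX P 0 (image_curve P phi) 1 z h <->
      sec P (tw (0 + 1 * dg ord0)%N (fun j => (1 * m' j)%N%:Z)) z (h * Q%:F ^+ 1).
    by move=> zX h; apply: (OX_curve P_neq0 P_distinct M_unit M_row phi_X g_neq0 g_cross Q_homog Q_neq0 Q_ker ker_Q Q_ord Q_lead).
  have := degree_sec P_neq0 P_distinct M_unit M_row phi_homog phi_X QF0 HJ E_E.
  rewrite big_ord_recl /tw unlift_none add0n mul1n.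
  under [X in _ = _ + X -> _]eq_bigr => j _.
    rewrite liftK mul1n [X in _ * X](_ : _ = (dg ord0)%:Z - (m' j)%:Z); last first.
      by rewrite -(g_deg j) PoszD addrAC subrr add0r.
    rewrite mulrBr; over.
  rewrite (eq_bigr (fun j => (m' j)%:Z)) => [|j _]; last by rewrite mul1n.
  rewrite sumrB -mulr_suml mulrBl addrA subrK => e.
  apply/eqP; rewrite -eqz_nat PoszD PoszM Posz_sum; apply/eqP.
  under eq_bigr do rewrite PoszM.
  have solve (x s : int) : -1 = x - s -> x + 1 = s by clear; lia.
  exact: solve e.
(* The genus formula of [curve_class] combined with E^2 = -1; the result says that E meets the
   anticanonical class in degree 1. *)
have m_sum : (\sum_j m' j + 1 = 3 * dg ord0)%N.
  have e := congr1 Posz m_sq; rewrite PoszD PoszM Posz_sum in e.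
  apply/eqP; rewrite -eqz_nat PoszD PoszM Posz_sum; apply/eqP.
  have solve (x t s u : int) : x + 1 = s -> s - t = x - 3%:Z * u + 2%:Z -> t + 1 = 3%:Z * u by clear; lia.
  rewrite sumrB in msq; apply: solve msq; rewrite e.
  by apply: eq_bigr => j _; rewrite PoszM.
have {}a_le_b : (a' <= b')%N by rewrite -lez_nat.
have {}ab_d : (a' + b' = dg ord0)%N by apply/eqP; rewrite -eqz_nat PoszD ab_d.
have fdim_s j := fdim_syz (phi_homog ord0) f_bpf E_splitting j erefl erefl.
have [v [w [dv dw le_vw eq_vw]]] := cokernel_count P_neq0 P_distinct M_unit M_row phi_homog phi_X
  g_neq0 g_homog g_deg g_cross Q_homog Q_neq0 Q_ker ker_Q Q_ord Q_lead m_sq m_sum fdim_s a_le_b ab_d (fun=> erefl) lei.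
have QF0 : Q%:F ^+ i.+1 != 0 by rewrite expf_neq0 // tofrac_eq0.
exists (v - w)%N; split.
- apply: (quotient_dim_frac _ _ _ dv dw QF0).
  + exact: Vt_closed.
  + exact: Im_closed.
  + exact: Im_V.
  + exact: (H0_curve P_neq0 P_distinct M_unit M_row phi_X g_neq0 g_cross Q_homog Q_neq0 Q_ker ker_Q Q_ord Q_lead 2 i.+1).
  + exact: (mul_image_curve P_neq0 P_distinct M_unit M_row phi_X g_neq0 g_cross Q_homog Q_neq0 Q_ker ker_Q Q_ord Q_lead i.+1).
- by rewrite leq_subLR.
move=> cond; rewrite eq_vw ?addKn //.
case: cond => [h|[h|h]]; [left|right; left|right; right].
- by move: h; clear; lia.
- by move: h; clear; lia.
(* Since a + b = d, the condition a = d - m says that b is the multiplicity at a point where the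
   maximum is attained. *)
have [[j mE] _] := m_max; rewrite -mE multE in h.
exists j; move: h (g_deg j) ab_d; clear; lia.
Qed.
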